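(* Let $L$ be a separable Hilbert space and let $\mathcal{M}\subset H^2\otimes L$ be a multiplication invariant subspace of the $L$-valued symmetric Fock space in two variables. Let $(M_z,M_w)$ be the pair of operators of multiplication by the coordinate functions $z,w$ on $\mathcal{M}$. (1) $(M_z,M_w)$ is Fredholm if and only if $\dim \mathcal{M}/(z\mathcal{M}+w\mathcal{M})<\infty$. (2) When $(M_z,M_w)$ is Fredholm, its index is $$\mathrm{index}(M_z,M_w)=e_0,$$ where $e_0=\lim_{k\to\infty}\frac{\dim \mathcal{M}/(z^k\mathcal{M}+w^k\mathcal{M})}{k^2}$, which equals the Samuel multiplicity $e(I,\mathcal{M})=2!\lim_{k\to\infty}\frac{\dim\mathcal{M}/I^k\mathcal{M}}{k^2}$ of $\mathcal{M}$ with respect to $I=(z,w)\subset\mathbb{C}[z,w]$.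
   Context: $H^2$ denotes the symmetric Fock space in two variables: the Hilbert space of holomorphic functions on the open unit ball $B_2\subset\mathbb{C}^2$ with reproducing kernel $k((z,w),(\zeta,\eta))=\frac{1}{1-z\bar\zeta-w\bar\eta}$. $H^2\otimes L$ is the corresponding space of $L$-valued holomorphic functions. A multiplication invariant subspace is a closed subspace invariant under multiplication by $z$ and by $w$; it is a module over $\mathbb{C}[z,w]$. For a commuting pair $T=(T_1,T_2)$ of bounded operators on a Hilbert space $H$, regard $H$ as a module over $A=\mathbb{C}[z_1,z_2]$ with $z_i$ acting as $T_i$, let $K(z_i)$ be the complex $0\to A\xrightarrow{z_i}A\to 0$ (in degrees $1,0$), and let $K(T_1,T_2;H)=H\otimes_A K(z_1)\otimes_A K(z_2)$ be the Koszul complex with homology groups $H_iK(T_1,T_2;H)$, $i=0,1,2$. The pair is Fredholm if all these are finite-dimensional, and then $\mathrm{index}(T_1,T_2)=\dim H_2K-\dim H_1K+\dim H_0K$. Here $H_0K(M_z,M_w;\mathcal{M})=\mathcal{M}/(z\mathcal{M}+w\mathcal{M})$. *)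

(* Defs.v *)
From HB Require Import structures.
From mathcomp Require Import all_boot all_order all_algebra.
From mathcomp Require Import complex.
From mathcomp Require Import all_classical all_reals.
From mathcomp Require Import topology normedtype sequences derive.
Import Order.TTheory GRing.Theory Num.Theory numFieldNormedType.Exports.

Set Implicit Arguments.
Unset Strict Implicit.
Unset Printing Implicit Defensive.

Local Open Scope classical_set_scope.
Local Open Scope ring_scope.
Local Notation "R [i]" := (complex R) : type_scope.

Section QuotientDimension.
Variables (K : fieldType) (V : lmodType K).
Implicit Types E F : set V.

(* For subspaces F `<=` E: some n-tuple of elements of E is a basis of E
   modulo F, i.e. dim E/F = n. Uniqueness of the coordinates is independence. *)
Definition has_qdim E F (n : nat) : Prop :=
  exists v : 'I_n -> V,
    (forall i, E (v i)) /\
    (forall x, E x -> exists! c : 'rV[K]_n, F (x - \sum_(i < n) c 0 i *: v i)).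

Definition qfindim E F : Prop := exists n, has_qdim E F n.

(* The junk value 0 is returned when E/F is infinite dimensional. *)
Definition qdim E F : nat := xget 0%N [set n | has_qdim E F n].

End QuotientDimension.

Section KoszulComplex.
Variables (K : fieldType) (V : lmodType K).
(* T1 and T2 are only used on the subspace E, which they are meant to preserve;
   the Koszul complex is that of the restrictions of T1, T2 to E. *)
Variables (E : set V) (T1 T2 : V -> V).

(* With e_i the degree 1 generator of K(z_i), so that d (e_i) = z_i, the
   component (x, y) in degree 1 stands for x e_1 + y e_2, and
   d (x e_1 e_2) = T1 x e_2 - T2 x e_1. *)
Definition koszul_d2 (x : V) : V * V := (- T2 x, T1 x).
Definition koszul_d1 (p : V * V) : V := T1 p.1 + T2 p.2.

Definition koszul_cycles2 : set V := [set x | E x /\ koszul_d2 x = 0].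
Definition koszul_cycles1 : set (V * V) :=
  [set p | (E `*` E) p /\ koszul_d1 p = 0].
Definition koszul_boundaries1 : set (V * V) := koszul_d2 @` E.
Definition koszul_boundaries0 : set V := koszul_d1 @` (E `*` E).

Definition fredholm : Prop :=
  [/\ qfindim koszul_cycles2 [set 0],
      qfindim koszul_cycles1 koszul_boundaries1
    & qfindim E koszul_boundaries0].

Definition fredholm_index : int :=
  (qdim koszul_cycles2 [set 0])%:Z
    - (qdim koszul_cycles1 koszul_boundaries1)%:Z
    + (qdim E koszul_boundaries0)%:Z.

(* T1^k E + T2^k E *)
Definition power_image (k : nat) : set V :=
  [set iter k T1 f + iter k T2 g | f in E & g in E].

End KoszulComplex.

Section IdealPowers.

Definition finite_sums (V : nmodType) (S : set V) : set V :=
  [set x | exists (n : nat) (s : 'I_n -> V),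
     (forall i, S (s i)) /\ x = \sum_(i < n) s i].

Definition ideal_gen (A : comNzRingType) (S : set A) : set A :=
  finite_sums [set a * s | a in [set: A] & s in S].

Definition ideal_mul (A : comNzRingType) (I J : set A) : set A :=
  finite_sums [set a * b | a in I & b in J].

Definition ideal_exp (A : comNzRingType) (I : set A) (k : nat) : set A :=
  iter k (ideal_mul I) [set: A].

Variables (K : fieldType) (V : lmodType K).

(* K[z,w] is {poly {poly K}}: z is the inner variable and w the outer one. *)
Definition polyz : {poly {poly K}} := ('X)%:P.
Definition polyw : {poly {poly K}} := 'X.

(* The action on V of a polynomial in z, w, with z acting as T1, w as T2. *)
Definition poly2_act (T1 T2 : V -> V) (p : {poly {poly K}}) (v : V) : V :=
  \sum_(j < size p) \sum_(i < size p`_j) p`_j`_i *: iter i T1 (iter j T2 v).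

Definition ideal_smul (T1 T2 : V -> V) (I : set {poly {poly K}}) (E : set V) :
    set V :=
  finite_sums [set poly2_act T1 T2 p v | p in I & v in E].

Definition maxideal0 : set {poly {poly K}} := ideal_gen [set polyz; polyw].

End IdealPowers.

Section FockSpace.
Variable R : realType.

(* The norm of a normed module over R[i] is R[i]-valued; a form in {dot _ for _}
   is linear in its first argument. *)
Definition hilbert_dot (V : completeNormedModType R[i])
    (dot : {dot V for @Num.conj R[i]}) : Prop :=
  forall x : V, `|x| ^+ 2 = dot x x.

Definition separable_space (T : topologicalType) : Prop :=
  exists2 D : set T, countable D & dense D.

Definition C2 : Type := (R[i]^o * R[i]^o)%type.

Definition ball2 : set C2 := [set x | `|x.1| ^+ 2 + `|x.2| ^+ 2 < 1].

Definition fock_kernel (x y : C2) : R[i] :=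
  (1 - x.1 * Num.conj y.1 - x.2 * Num.conj y.2)^-1.

Variables (L H : completeNormedModType R[i]).
Variables (dotL : {dot L for @Num.conj R[i]}) (dotH : {dot H for @Num.conj R[i]}).
Variable ev : H -> C2 -> L.

(* The Hilbert space H, whose element f is identified with the function
   x |-> ev f x on the ball, is H^2 (x) L, the space of L-valued holomorphic
   functions with reproducing kernel fock_kernel: evaluation at y paired with
   l is represented by the function x |-> fock_kernel x y *: l. Values of ev
   outside the ball are irrelevant. *)
Definition is_fock_space : Prop :=
  [/\ forall x, ball2 x -> linear (ev ^~ x),
      forall f, (forall x, ball2 x -> ev f x = 0) -> f = 0,
      forall f x, ball2 x -> differentiable (ev f : R[i]^o * R[i]^o -> L) x
    & forall y l, ball2 y -> exists2 g : H,
        forall x, ball2 x -> ev g x = fock_kernel x y *: l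
      & forall f, dotH f g = dotL (ev f y) l].

Definition is_product (phi : C2 -> R[i]) (f g : H) : Prop :=
  forall x, ball2 x -> ev g x = phi x *: ev f x.

Definition mulop (phi : C2 -> R[i]) (f : H) : H :=
  xget 0 [set g | is_product phi f g].

Definition mul_invariant (phi : C2 -> R[i]) (M : set H) : Prop :=
  forall f, M f -> exists2 g, M g & is_product phi f g.

Definition mulz : H -> H := mulop (fun x => x.1).
Definition mulw : H -> H := mulop (fun x => x.2).

Definition mult_invariant_subspace (M : set H) : Prop :=
  [/\ submod_closed (mem M), closed M,
      mul_invariant (fun x => x.1) M & mul_invariant (fun x => x.2) M].

End FockSpace.

(* Main.v *)
Require Import Defs.
From HB Require Import structures.
From mathcomp Require Import all_boot all_order all_algebra.
From mathcomp Require Import complex.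
From mathcomp Require Import all_classical all_reals.
From mathcomp Require Import topology normedtype sequences derive.
From mathcomp Require Import fingroup perm.
From mathcomp Require Import ring lra zify.
Import Order.TTheory GRing.Theory Num.Theory numFieldNormedType.Exports.
Import Normc.

Set Implicit Arguments.
Unset Strict Implicit.
Unset Printing Implicit Defensive.

Local Open Scope complex_scope.
Local Open Scope classical_set_scope.
Local Open Scope ring_scope.

(* Let M be a closed invariant subspace and n = dim M / (zM + wM). Multiplication
   by (z, w) is a row contraction on M, so applying the defect operator
   1 - z z^* - w w^* to a basis of M modulo zM + wM gives generators v_1, ..., v_n
   which are multipliers of the scalar Fock space into M. Let r be the generic
   rank of their values and delta a nonzero r x r minor. By Cramer's rule delta f
   is, for f in M, a combination of r of the generators with coefficients in the
   scalar Fock space, and comparing Taylor coefficients gives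
   dim M/JM = r #{monomials not in J} + O(k) for J = (z^k, w^k) and J = (z, w)^k.
   Hence both limits are r.
   For the index, H_2 = 0 because |f|^2 <= |zf|^2 + |wf|^2. Take a point l near 0
   with delta(l) <> 0. The multiplier argument, applied to the space of cycles of
   (z - l1, w - l2), shows that these cycles are limits of boundaries; applied to
   M, it shows that an element of the span of the v_j vanishing at l belongs to
   (z - l1)M + (w - l2)M. A perturbation argument then identifies H_1 at the
   origin with the relations sum_j c_j v_j(l) = 0, so dim H_1 = n - r and the
   index is n - (n - r) = r. *)

(** * Complex numbers and inner product spaces *)

(** The generators need not be free over the scalar Fock space and delta may vanish at the origin,
    so the Koszul complex cannot be analysed there directly. At l with delta(l) <> 0 it can, but
    only through delta: on a multiplier u the series delta acts as the scalar delta(l) modulo limits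
    of elements of the images of z - l1 and w - l2, while Cramer's rule reduces delta u to scalar
    cycles, which are divided by an iteration that ends only in the limit. Everything at l is
    therefore known up to closure. The closure is harmless because the boundary map is bounded below
    by |f|^2 <= |zf|^2 + |wf|^2, because (f, g, c) |-> (z - l1) f + (w - l2) g + sum_j c_j v_j stays
    onto M with a uniform bound, and because what is left is finite dimensional. The bounds 1/8, 1/4
    and 1/2 on l are those of these perturbations. The term O(k) in the count is the price of
    dividing by delta: its lexicographically first exponent (a, b) displaces exponents by (a, b),
    which costs only the strips i < a and j < b. *)

Lemma le_eps (R : realType) (x y : R) :
  (forall e : R, 0 < e -> x <= y + e) -> x <= y.
Proof. by move=> h; apply/ler_addgt0Pr => e e0; apply: h. Qed.

Section ComplexModulus.
Variable R : realType.
Implicit Types (a b : R[i]) (x y : R).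

Lemma normcE2 a : normc a ^+ 2 = complex.Re a ^+ 2 + complex.Im a ^+ 2.
Proof. by case: a => x y /=; rewrite sqr_sqrtr // addr_ge0 ?sqr_ge0. Qed.

Lemma normc_ge0 a : 0 <= normc a.
Proof. by case: a => x y /=; apply: sqrtr_ge0. Qed.

Lemma normcC x : normc x%:C = `|x|.
Proof. by rewrite /= expr0n addr0 sqrtr_sqr. Qed.

Lemma conjE a : Num.conj a = conjc a.
Proof. by []. Qed.

Lemma normc_conj a : normc (Num.conj a) = normc a.
Proof. by rewrite conjE; case: a => x y /=; rewrite sqrrN. Qed.

Lemma norm_normc a : `|a| = (normc a)%:C.
Proof. by rewrite normc_def; case: a => x y. Qed.

Lemma ReD a b : complex.Re (a + b) = complex.Re a + complex.Re b.
Proof. by case: a; case: b. Qed.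

Lemma ReN a : complex.Re (- a) = - complex.Re a.
Proof. by case: a. Qed.

Lemma ReB a b : complex.Re (a - b) = complex.Re a - complex.Re b.
Proof. by rewrite ReD ReN. Qed.

Lemma Re_conj a : complex.Re (Num.conj a) = complex.Re a.
Proof. by rewrite conjE; case: a. Qed.

Lemma ReZ x a : complex.Re (x%:C * a) = x * complex.Re a.
Proof. by case: a => u v /=; rewrite mul0r subr0. Qed.

Lemma Re_le_normc a : `|complex.Re a| <= normc a.
Proof.
rewrite -(@ler_pXn2r _ 2) ?nnegrE ?normr_ge0 ?normc_ge0 //.
by rewrite normcE2 real_normK ?num_real // lerDl sqr_ge0.
Qed.

Lemma mul_conj a : a * Num.conj a = (normc a ^+ 2)%:C.
Proof. by rewrite -normCK norm_normc rmorphXn. Qed.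

Lemma normcB a b : normc (a - b) <= normc a + normc b.
Proof. by rewrite (le_trans (le_normcD _ _)) // normcN. Qed.

Lemma normcX a n : normc (a ^+ n) = normc a ^+ n.
Proof. by elim: n => [|n IHn]; rewrite ?normc1 // !exprS normcM IHn. Qed.

Lemma normc_eq0 a : (normc a == 0) = (a == 0).
Proof. by apply/eqP/eqP => [/eq0_normc//|->]; rewrite normc0. Qed.

Lemma normc_nat n : normc n%:R = n%:R :> R.
Proof. by rewrite -(rmorph_nat (real_complex R)) normcC ger0_norm ?ler0n. Qed.

Lemma normc_sqD a b : normc (a + b) ^+ 2 <= 2 * normc a ^+ 2 + 2 * normc b ^+ 2.
Proof.
rewrite !normcE2; case: a => a1 a2; case: b => b1 b2 /=.
by have := sqr_ge0 (a1 - b1); have := sqr_ge0 (a2 - b2); rewrite !expr2; lra.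
Qed.

Lemma normc_distC a b : normc (a - b) = normc (b - a).
Proof. by rewrite -normcN opprB. Qed.

Lemma normc_sum (I : Type) (r : seq I) (P : pred I) (F : I -> R[i]) :
  normc (\sum_(i <- r | P i) F i) <= \sum_(i <- r | P i) normc (F i).
Proof.
elim/big_rec2: _ => [|i x y _ h]; first by rewrite normc0.
by rewrite (le_trans (le_normcD _ _)) // lerD2l.
Qed.

Lemma normc_small a : (forall e : R, 0 < e -> normc a <= e) -> a = 0.
Proof.
move=> h; apply/eqP; rewrite -normc_eq0 eq_le normc_ge0 andbT.
by apply: le_eps => e e0; rewrite add0r h.
Qed.

End ComplexModulus.

Section Subspace.
Variables (K : nzRingType) (V : lmodType K).
Implicit Types (x y : V) (a : K).

Definition lsub (E : set V) :=
  E 0 /\ forall a x y, E x -> E y -> E (a *: x + y).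

Variables (E : set V) (sE : lsub E).

Lemma sub0 : E 0. Proof. exact: sE.1. Qed.

Lemma subZ a x : E x -> E (a *: x).
Proof. by move=> Ex; rewrite -[_ *: _]addr0; apply: sE.2 => //; apply: sub0. Qed.

Lemma subD x y : E x -> E y -> E (x + y).
Proof. by move=> Ex Ey; rewrite -[x]scale1r; apply: sE.2. Qed.

Lemma subN x : E x -> E (- x).
Proof. by rewrite -scaleN1r; apply: subZ. Qed.

Lemma subB x y : E x -> E y -> E (x - y).
Proof. by move=> Ex Ey; apply: subD => //; apply: subN. Qed.

Lemma sub_sum (I : Type) (r : seq I) (P : pred I) (F : I -> V) :
  (forall i, P i -> E (F i)) -> E (\sum_(i <- r | P i) F i).
Proof. by move=> h; apply: big_ind => //; [exact: sub0|exact: subD]. Qed.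

Lemma subDl x y : E x -> E (y + x) -> E y.
Proof. by move=> Ex /subB/(_ Ex); rewrite addrK. Qed.

End Subspace.

Section InnerProduct.
Variable R : realType.

(** Completeness is not part of the structure but a property of subsets ([complete_set]), so that M
    and the space of cycles inside a product can be handled by the same lemmas. *)
Record ip (V : lmodType R[i]) := Ip {
  dt :> V -> V -> R[i];
  ip_lin : forall a x y z, dt (a *: x + y) z = a * dt x z + dt y z;
  ip_sym : forall x y, dt y x = Num.conj (dt x y);
  ip_pos : forall x, x != 0 -> 0 < dt x x }.

Variables (V : lmodType R[i]) (d : ip V).
Implicit Types (x y z : V) (a : R[i]) (E : set V) (u v : nat -> V).

Lemma dtDl x y z : d (x + y) z = d x z + d y z.
Proof. by rewrite -[x]scale1r ip_lin mul1r scale1r. Qed.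

Lemma dt0l z : d 0 z = 0.
Proof. by apply: (addIr (d 0 z)); rewrite -dtDl !add0r. Qed.

Lemma dtZl a x z : d (a *: x) z = a * d x z.
Proof. by rewrite -[a *: x]addr0 ip_lin dt0l addr0. Qed.

Lemma dtNl x z : d (- x) z = - d x z.
Proof. by rewrite -scaleN1r dtZl mulN1r. Qed.

Lemma dtBl x y z : d (x - y) z = d x z - d y z.
Proof. by rewrite dtDl dtNl. Qed.

Lemma dtDr x y z : d z (x + y) = d z x + d z y.
Proof. by rewrite !(ip_sym d _ z) dtDl rmorphD. Qed.

Lemma dt0r z : d z 0 = 0.
Proof. by rewrite (ip_sym d _ z) dt0l rmorph0. Qed.

Lemma dtZr a x z : d z (a *: x) = Num.conj a * d z x.
Proof. by rewrite !(ip_sym d _ z) dtZl rmorphM. Qed.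

Lemma dtNr x z : d z (- x) = - d z x.
Proof. by rewrite !(ip_sym d _ z) dtNl rmorphN. Qed.

Lemma dtBr x y z : d z (x - y) = d z x - d z y.
Proof. by rewrite dtDr dtNr. Qed.

Lemma dt_suml (I : Type) (r : seq I) (P : pred I) (F : I -> V) z :
  d (\sum_(i <- r | P i) F i) z = \sum_(i <- r | P i) d (F i) z.
Proof.
by elim/big_rec2: _ => [|i a b _ <-]; rewrite ?dt0l ?dtDl.
Qed.

Definition rd x y : R := complex.Re (d x y).
Definition sqn x : R := rd x x.
Definition nm x : R := Num.sqrt (sqn x).

Lemma rdC x y : rd x y = rd y x.
Proof. by rewrite /rd ip_sym Re_conj. Qed.

Lemma rdDl x y z : rd (x + y) z = rd x z + rd y z.
Proof. by rewrite /rd dtDl ReD. Qed.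

Lemma rdNl x z : rd (- x) z = - rd x z.
Proof. by rewrite /rd dtNl ReN. Qed.

Lemma rdBl x y z : rd (x - y) z = rd x z - rd y z.
Proof. by rewrite rdDl rdNl. Qed.

Lemma rdDr x y z : rd z (x + y) = rd z x + rd z y.
Proof. by rewrite rdC rdDl !(rdC z). Qed.

Lemma rdNr x z : rd z (- x) = - rd z x.
Proof. by rewrite rdC rdNl (rdC z). Qed.

Lemma rdBr x y z : rd z (x - y) = rd z x - rd z y.
Proof. by rewrite rdDr rdNr. Qed.

Lemma rdZl (t : R) x z : rd (t%:C *: x) z = t * rd x z.
Proof. by rewrite /rd dtZl ReZ. Qed.

Lemma rdZr (t : R) x z : rd z (t%:C *: x) = t * rd z x.
Proof. by rewrite rdC rdZl (rdC z). Qed.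

Lemma dtxx x : d x x = (sqn x)%:C.
Proof.
have: d x x \is Num.real by rewrite CrealE {2}ip_sym.
by move=> /RRe_real.
Qed.

Lemma sqn_gt0 x : x != 0 -> 0 < sqn x.
Proof. by move=> /ip_pos-/(_ d); rewrite dtxx ltcR. Qed.

Lemma sqn0 : sqn 0 = 0.
Proof. by rewrite /sqn /rd dt0l. Qed.

Lemma sqn_ge0 x : 0 <= sqn x.
Proof. by have [->|/sqn_gt0/ltW//] := eqVneq x 0; rewrite sqn0. Qed.

Lemma sqn_eq0 x : sqn x = 0 -> x = 0.
Proof.
by have [//|/sqn_gt0 h] := eqVneq x 0 => h0; rewrite h0 ltxx in h.
Qed.

Lemma sqnD x y : sqn (x + y) = sqn x + sqn y + 2 * rd x y.
Proof. by rewrite /sqn !(rdDl, rdDr) (rdC y x); ring. Qed.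

Lemma sqnN x : sqn (- x) = sqn x.
Proof. by rewrite /sqn rdNl rdNr opprK. Qed.

Lemma sqnB x y : sqn (x - y) = sqn x + sqn y - 2 * rd x y.
Proof. by rewrite sqnD sqnN rdNr mulrN. Qed.

Lemma sqn_distC x y : sqn (x - y) = sqn (y - x).
Proof. by rewrite -sqnN opprB. Qed.

Lemma sqnZ a x : sqn (a *: x) = normc a ^+ 2 * sqn x.
Proof.
have: d (a *: x) (a *: x) = (normc a ^+ 2 * sqn x)%:C.
  by rewrite dtZl dtZr mulrA mul_conj dtxx -rmorphM.
by rewrite dtxx => /complexI.
Qed.

Lemma sqnD_le x y : sqn (x + y) <= 2 * sqn x + 2 * sqn y.
Proof.
by have := sqn_ge0 (x - y); rewrite sqnB sqnD; lra.
Qed.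

Lemma nm_ge0 x : 0 <= nm x.
Proof. exact: sqrtr_ge0. Qed.

Lemma nmsq x : nm x ^+ 2 = sqn x.
Proof. by rewrite sqr_sqrtr ?sqn_ge0. Qed.

Lemma nm0 : nm 0 = 0.
Proof. by rewrite /nm sqn0 sqrtr0. Qed.

Lemma nm_eq0 x : nm x = 0 -> x = 0.
Proof. by move=> h; apply: sqn_eq0; rewrite -nmsq h expr0n. Qed.

Lemma nm_le x (c : R) : 0 <= c -> (nm x <= c) = (sqn x <= c ^+ 2).
Proof. by move=> c0; rewrite -nmsq ler_pXn2r ?nnegrE ?nm_ge0. Qed.

Lemma nm_lt x (c : R) : 0 <= c -> (nm x < c) = (sqn x < c ^+ 2).
Proof. by move=> c0; rewrite -nmsq ltr_pXn2r ?nnegrE ?nm_ge0. Qed.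

Lemma nmN x : nm (- x) = nm x.
Proof. by rewrite /nm sqnN. Qed.

Lemma nm_distC x y : nm (x - y) = nm (y - x).
Proof. by rewrite /nm sqn_distC. Qed.

Lemma nmZ a x : nm (a *: x) = normc a * nm x.
Proof.
apply/eqP; rewrite -(@eqrXn2 _ 2) ?mulr_ge0 ?nm_ge0 ?normc_ge0 //.
by rewrite exprMn !nmsq sqnZ.
Qed.

Lemma rd_le x y : rd x y <= nm x * nm y.
Proof.
have [->|y0] := eqVneq y 0; first by rewrite /rd dt0r nm0 mulr0.
have yp := sqn_gt0 y0.
have h (t : R) : 0 <= sqn x + t ^+ 2 * sqn y - 2 * (t * rd x y).
  by have := sqn_ge0 (x - t%:C *: y); rewrite sqnB sqnZ normcC real_normK ?num_real // rdZr.
have h2 : rd x y ^+ 2 <= sqn x * sqn y.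
  have := h (rd x y / sqn y).
  have -> : sqn x + (rd x y / sqn y) ^+ 2 * sqn y - 2 * (rd x y / sqn y * rd x y)
     = (sqn x * sqn y - rd x y ^+ 2) / sqn y by field; rewrite gt_eqF.
  by rewrite pmulr_lge0 ?invr_gt0 // subr_ge0.
rewrite (le_trans (ler_norm _)) // -(@ler_pXn2r _ 2) ?nnegrE ?mulr_ge0 ?nm_ge0 //.
by rewrite exprMn !nmsq real_normK ?num_real.
Qed.

Lemma cauchy_schwarz x y : normc (d x y) <= nm x * nm y.
Proof.
have [h|h] := eqVneq (normc (d x y)) 0; first by rewrite h mulr_ge0 ?nm_ge0.
have hp : 0 < normc (d x y) by rewrite lt_def h normc_ge0.
have := rd_le x (d x y *: y).
rewrite /rd dtZr mulrC mul_conj /= nmZ mulrCA expr2.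
by rewrite ler_pM2l.
Qed.

Lemma cauchy_schwarz2 x y : normc (d x y) ^+ 2 <= sqn x * sqn y.
Proof.
rewrite -!nmsq -exprMn ler_pXn2r ?nnegrE ?mulr_ge0 ?nm_ge0 ?normc_ge0 //.
exact: cauchy_schwarz.
Qed.

Lemma nmD x y : nm (x + y) <= nm x + nm y.
Proof.
rewrite nm_le ?addr_ge0 ?nm_ge0 // sqnD sqrrD !nmsq.
by have := rd_le x y; lra.
Qed.

Lemma nmB x y : nm (x - y) <= nm x + nm y.
Proof. by rewrite -(nmN y) nmD. Qed.

Lemma nm_dist z x y : nm (x - y) <= nm (x - z) + nm (z - y).
Proof. by rewrite -[x - y](subrKA z) nmD. Qed.

Lemma nm_small x : (forall e : R, 0 < e -> nm x <= e) -> x = 0.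
Proof.
move=> h; apply: nm_eq0; apply/eqP; rewrite eq_le nm_ge0 andbT.
by apply: le_eps => e e0; rewrite add0r h.
Qed.

Lemma dt_ext x y : (forall z, d x z = d y z) -> x = y.
Proof.
move=> h; apply/eqP; rewrite -subr_eq0; apply/eqP/sqn_eq0.
by rewrite /sqn /rd dtBl h subrr.
Qed.

Definition lims u x := forall e : R, 0 < e ->
  exists n0, forall n, (n0 <= n)%N -> nm (u n - x) < e.

Definition cauchy_seq u := forall e : R, 0 < e ->
  exists n0, forall m n, (n0 <= m)%N -> (n0 <= n)%N -> nm (u m - u n) < e.

Definition complete_set E := forall u, (forall n, E (u n)) -> cauchy_seq u ->
  exists2 x, E x & lims u x.

Lemma lims_unique u x y : lims u x -> lims u y -> x = y.
Proof.
move=> hx hy; apply/eqP; rewrite -subr_eq0; apply/eqP/nm_small => e e0.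
have e2 : 0 < e / 2 by rewrite divr_gt0.
have [n1 h1] := hx _ e2; have [n2 h2] := hy _ e2.
have := h1 _ (leq_maxl n1 n2); have := h2 _ (leq_maxr n1 n2).
have := nm_dist (u (maxn n1 n2)) x y; rewrite (nm_distC x (u _)); lra.
Qed.

Lemma limsD u v x y : lims u x -> lims v y -> lims (fun n => u n + v n) (x + y).
Proof.
move=> hx hy e e0.
have e2 : 0 < e / 2 by rewrite divr_gt0.
have [n1 h1] := hx _ e2; have [n2 h2] := hy _ e2.
exists (maxn n1 n2) => n; rewrite geq_max => /andP[/h1 H1 /h2 H2].
rewrite opprD addrACA; apply: (le_lt_trans (nmD _ _)).
by move: H1 H2; lra.
Qed.

Lemma lims_cauchy u x : lims u x -> cauchy_seq u.
Proof.
move=> hx e e0; have e2 : 0 < e / 2 by rewrite divr_gt0.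
have [n1 h1] := hx _ e2; exists n1 => m n /h1 H1 /h1 H2.
by have := nm_dist x (u m) (u n); rewrite (nm_distC x (u _)); lra.
Qed.

Lemma lims_nm_le u x (c : R) : lims u x -> (forall n, nm (u n) <= c) -> nm x <= c.
Proof.
move=> hx h; apply: le_eps => e e0; have [n0 hn] := hx _ e0.
have := hn _ (leqnn n0); have := h n0; have := nmB (u n0) (u n0 - x).
by rewrite subKr; lra.
Qed.

Definition isucc (n : nat) : R := n.+1%:R^-1.

Lemma isucc_gt0 n : 0 < isucc n.
Proof. by rewrite invr_gt0. Qed.

Lemma isucc_small (e : R) : 0 < e ->
  exists n0, forall n, (n0 <= n)%N -> isucc n < e.
Proof.
move=> e0; have [n h] := ltr_add_invr e0; rewrite add0r in h.
exists n => m nm1; apply: le_lt_trans h.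
by rewrite /isucc lef_pV2 ?posrE ?ltr0n // ler_nat.
Qed.

Lemma geom_small (q e : R) : 0 <= q < 1 -> 0 < e ->
  exists n0, forall n, (n0 <= n)%N -> q ^+ n < e.
Proof.
move=> /andP[q0 q1] e0.
have: (fun n => q ^+ n : R) @ \oo --> (0 : R) by apply: cvg_expr; rewrite ger0_norm.
move=> /cvgrPdist_lt/(_ _ e0)[n0 _ h]; exists n0 => n nn.
by have := h _ nn; rewrite sub0r normrN ger0_norm ?exprn_ge0.
Qed.

Lemma geom_cauchy u (c q : R) : 0 <= q < 1 ->
  (forall n, nm (u n.+1 - u n) <= c * q ^+ n) -> cauchy_seq u.
Proof.
move=> q01 h e e0; have /andP[q0 q1] := q01.
have c0 : 0 <= c by have := h 0%N; rewrite expr0 mulr1; apply: le_trans (nm_ge0 _).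
have p1 : 0 < 1 - q by rewrite subr_gt0.
have step n m : nm (u (n + m)%N - u n) <= c * q ^+ n * (1 - q ^+ m) / (1 - q).
  elim: m => [|m IHm]; first by rewrite addn0 subrr nm0 expr0 subrr mulr0 mul0r.
  apply: (le_trans (nm_dist (u (n + m)%N) _ _)); rewrite addnS.
  apply: (le_trans (lerD (h _) IHm)); rewrite exprD exprS.
  have -> : c * q ^+ n * (1 - q * q ^+ m) / (1 - q) =
      c * (q ^+ n * q ^+ m) + c * q ^+ n * (1 - q ^+ m) / (1 - q); last by [].
  by field; rewrite gt_eqF.
have step2 n m : nm (u (n + m)%N - u n) <= c / (1 - q) * q ^+ n.
  apply: (le_trans (step n m)).
  have -> : c * q ^+ n * (1 - q ^+ m) / (1 - q) = c / (1 - q) * q ^+ n * (1 - q ^+ m).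
    by rewrite mulrAC [c * _ / _]mulrAC.
  rewrite ler_piMr //.
    by rewrite mulr_ge0 ?exprn_ge0 // divr_ge0 // ltW.
  by rewrite lerBlDr lerDl exprn_ge0.
have cc : 0 <= c / (1 - q) by rewrite divr_ge0 // ltW.
have [|n0 hn] := geom_small q01 (_ : 0 < e / 2 / (c / (1 - q) + 1)).
  by rewrite !divr_gt0 // ltr_wpDl.
have key : forall m, (n0 <= m)%N -> nm (u m - u n0) < e / 2.
  move=> m /subnKC <-; apply: (le_lt_trans (step2 _ _)).
  have := hn _ (leqnn n0); rewrite ltr_pdivlMr ?ltr_wpDl // => h1.
  apply: le_lt_trans h1; rewrite mulrC ler_wpM2l ?exprn_ge0 //.
  by rewrite lerDl.
exists n0 => m n /key h1 /key h2.
by have := nm_dist (u n0) (u m) (u n); rewrite (nm_distC (u n0)); lra.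
Qed.

End InnerProduct.

(** * Riesz, Lax-Milgram and uniform boundedness *)

Section HilbertTools.
Variables (R : realType) (V : lmodType R[i]) (d : ip V).
Implicit Types (x y z : V) (a : R[i]).
Variables (E : set V) (sE : lsub E) (cE : complete_set d E).

Lemma lims_dist_le (u : nat -> V) x y (c : R) n0 : lims d u x ->
  (forall n, (n0 <= n)%N -> nm d (u n - y) <= c) -> nm d (x - y) <= c.
Proof.
move=> hx h; apply: le_eps => e e0; have [n1 hn] := hx _ e0.
have := hn _ (leq_maxr n0 n1); have := h _ (leq_maxl n0 n1).
have := nm_dist d (u (maxn n0 n1)) x y; rewrite (nm_distC d x (u _)); lra.
Qed.

(** The representing vector is the minimiser of J x = |x|^2 - 2 Re (phi x), which is bounded below
    by - C^2. *)
Lemma riesz (phi : V -> R[i]) (C : R) :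
  (forall a x y, E x -> E y -> phi (a *: x + y) = a * phi x + phi y) ->
  (forall x, E x -> normc (phi x) <= C * nm d x) ->
  exists2 b, E b & forall x, E x -> phi x = d x b.
Proof.
move=> phil phib.
pose J x := sqn d x - 2 * complex.Re (phi x).
have phi0 : phi 0 = 0.
  have := phil (- 1) _ _ (sub0 sE) (sub0 sE).
  by rewrite scaler0 addr0 mulN1r addNr.
have phiZ a x : E x -> phi (a *: x) = a * phi x.
  by move=> Ex; rewrite -[a *: x]addr0 phil ?phi0 ?addr0 //; apply: sub0.
have Jlb x : E x -> - C ^+ 2 <= J x.
  move=> Ex; rewrite /J -nmsq.
  have h1 := phib _ Ex; have h2 := Re_le_normc (phi x).
  have h3 := ler_norm (complex.Re (phi x)); have := sqr_ge0 (nm d x - C).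
  by move: h1 h2 h3; rewrite sqrrB; lra.
pose S := [set J x | x in E].
have Sinf : has_inf S.
  split; first by exists (J 0); exists 0 => //; apply: sub0.
  by exists (- C ^+ 2) => _ [x Ex <-]; apply: Jlb.
pose I := inf S.
have JI x : E x -> I <= J x by move=> Ex; apply: ge_inf; [exact: Sinf.2 | exists x].
have ex n : exists x, E x /\ J x < I + isucc R n.
  by have [_ [x Ex <-] h] := inf_adherent (isucc_gt0 R n) Sinf; exists x.
have [u hu] := choice ex.
have Eu n : E (u n) by case: (hu n).
(* Parallelogram law, with J bounded below by I at the midpoint; it makes the minimising sequence
   Cauchy. *)
have par x y : E x -> E y -> sqn d (x - y) <= 2 * (J x - I) + 2 * (J y - I).
  move=> Ex Ey.
  have Em : E ((2^-1 : R)%:C *: (x + y)) by apply: subZ => //; apply: subD.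
  have := JI _ Em; rewrite /J phiZ; last exact: subD.
  rewrite ReZ -[x in phi (x + y)]scale1r phil //.
  rewrite mul1r ReD sqnZ normcC sqnB sqnD ger0_norm ?invr_ge0 //.
  by rewrite expr2; lra.
have cu : cauchy_seq d u.
  move=> e e0; have e2 : 0 < e ^+ 2 / 4 by rewrite divr_gt0 // exprn_gt0.
  have [n0 hn] := isucc_small e2; exists n0 => m n hm hn'.
  rewrite nm_lt ?ltW //; apply: (le_lt_trans (par _ _ (Eu m) (Eu n))).
  have := hn _ hm; have := hn _ hn'; have := (hu m).2; have := (hu n).2; lra.
have [b Eb ub] := cE Eu cu; exists b => //.
have Jb : J b <= I.
  apply: le_eps => e e0.
  (* K is a Lipschitz constant of J for steps of length at most 1 that end at b. *)
  pose K := 2 * nm d b + 3 + 2 * `|C|.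
  have K0 : 0 < K by rewrite /K; have := nm_ge0 d b; have := normr_ge0 C; lra.
  pose e' := Num.min 1 (e / 2 / K).
  have e'0 : 0 < e' by rewrite lt_min ltr01 !divr_gt0.
  have e2 : 0 < e / 2 by rewrite divr_gt0.
  have [n1 h1] := ub _ e'0; have [n2 h2] := isucc_small e2.
  pose n := maxn n1 n2; have hn1 := h1 n (leq_maxl _ _).
  have hn2 := h2 n (leq_maxr _ _); have hn3 := (hu n).2.
  set h := b - u n; have Eh : E h by apply: subB.
  have hb : nm d h < e' by rewrite nm_distC.
  move: hb; rewrite lt_min ltr_pdivlMr // => /andP[hb1 hb2].
  have -> : b = 1 *: h + u n by rewrite scale1r subrK.
  have := hn3; rewrite /J phil // mul1r scale1r ReD sqnD.
  have r1 := rd_le d h (u n); have r2 := phib _ Eh.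
  have r3 := Re_le_normc (phi h); have r4 := ler_norm (- complex.Re (phi h)).
  rewrite normrN in r4.
  have r5 : nm d (u n) <= nm d b + 1.
    by have := nmD d (- h) b; rewrite nmN /h opprB subrK; rewrite /h in hb1; lra.
  have r6 := nm_ge0 d h.
  have r7 : nm d h * nm d (u n) <= nm d h * (nm d b + 1) by rewrite ler_wpM2l.
  have r8 : C * nm d h <= `|C| * nm d h by rewrite ler_wpM2r // ler_norm.
  have r9 : sqn d h <= nm d h by rewrite -nmsq expr2 -subr_ge0 -{1}[nm d h]mulr1 -mulrBr mulr_ge0 // subr_ge0 ltW.
  by move: hb2; rewrite /K; lra.
have var x : E x -> rd d b x = complex.Re (phi x).
  move=> Ex.
  have h (t : R) : 0 <= t ^+ 2 * sqn d x + 2 * t * (rd d b x - complex.Re (phi x)).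
    have := JI _ (subD sE Eb (subZ sE t%:C Ex)).
    rewrite /J [b + _]addrC phil // sqnD sqnZ normcC real_normK ?num_real //.
    by rewrite rdZl ReD ReZ (rdC d x); move: Jb; rewrite /J; lra.
  set w := rd d b x - _ in h.
  suff : w = 0 by move/eqP; rewrite subr_eq0 => /eqP.
  (* The optimal t would be - w / |x|^2; the added 1 keeps the quotient meaningful when x = 0. *)
  have := h (- w / (sqn d x + 1)).
  have p : 0 < sqn d x + 1 by have := sqn_ge0 d x; lra.
  have -> : (- w / (sqn d x + 1)) ^+ 2 * sqn d x + 2 * (- w / (sqn d x + 1)) * w
    = - (w ^+ 2 * (sqn d x + 2) / (sqn d x + 1) ^+ 2) by field; rewrite gt_eqF.
  rewrite oppr_ge0 pmulr_lle0 ?invr_gt0 ?exprn_gt0 // pmulr_lle0; last by lra.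
  by move=> h2; apply/eqP; rewrite -sqrf_eq0 eq_le h2 sqr_ge0.
move=> x Ex; apply/eqP; rewrite eq_complex; apply/andP; split; apply/eqP.
  by rewrite -var // rdC.
(* The variation in the direction i x gives the imaginary parts. *)
have := var _ (subZ sE 'i%C Ex); rewrite rdC /rd dtZl phiZ // mulrC ReiNIm mulrC ReiNIm.
by move/oppr_inj.
Qed.

Lemma rd_ge_coercive (A : V -> V) (c : R) x : 0 < c -> c * sqn d x <= rd d (A x) x ->
  c * nm d x <= nm d (A x).
Proof.
move=> c0 h; have [->|x0] := eqVneq x 0; first by rewrite nm0 mulr0 nm_ge0.
have := le_trans h (rd_le d _ _); rewrite -nmsq expr2 mulrA ler_pM2r //.
by rewrite lt_def nm_ge0 andbT; apply: contra x0 => /eqP/nm_eq0->.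
Qed.

(** For t = c / K'^2 the map x |-> x - t (A x - m) contracts distances by sqrt (1 - (c / K')^2), and
    its fixed point solves the equation. *)
Lemma lax_milgram (A : V -> V) (c K : R) : 0 < c ->
  (forall x, E x -> E (A x)) ->
  (forall x y, E x -> E y -> A (x - y) = A x - A y) ->
  (forall x, E x -> nm d (A x) <= K * nm d x) ->
  (forall x, E x -> c * sqn d x <= rd d (A x) x) ->
  forall m, E m -> exists2 x, E x & A x = m.
Proof.
move=> c0 EA Al Ab Ac m Em.
(* Adding c makes K' positive and c / K' at most 1, so that the square root defining q is taken of a
   nonnegative number. *)
pose K' := `|K| + c.
have K'0 : 0 < K' by rewrite ltr_wpDl.
have Ab' x : E x -> sqn d (A x) <= K' ^+ 2 * sqn d x.
  move=> Ex; rewrite -!nmsq -exprMn ler_pXn2r ?nnegrE ?mulr_ge0 ?nm_ge0 ?(ltW K'0) //.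
  apply: (le_trans (Ab _ Ex)); rewrite ler_wpM2r ?nm_ge0 // (le_trans (ler_norm _)) //.
  by rewrite lerDl ltW.
pose t := c / K' ^+ 2.
pose q2 := 1 - (c / K') ^+ 2.
have q2b : 0 <= q2 < 1.
  rewrite /q2 subr_ge0 ltrBlDr ltrDl exprn_gt0 ?divr_gt0 // andbT.
  by rewrite expr_le1 ?divr_ge0 ?(ltW c0) ?(ltW K'0) // ler_pdivrMr // mul1r lerDr.
pose q := Num.sqrt q2; have qq : q ^+ 2 = q2 by rewrite sqr_sqrtr //; case/andP: q2b.
have qb : 0 <= q < 1.
  rewrite sqrtr_ge0 /= -(@ltr_pXn2r _ 2) ?nnegrE ?sqrtr_ge0 // qq expr1n.
  by case/andP: q2b.
have contr x : E x -> nm d (x - t%:C *: A x) <= q * nm d x.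
  move=> Ex; have q0 : 0 <= q by case/andP: qb.
  rewrite nm_le ?mulr_ge0 ?nm_ge0 // exprMn nmsq qq sqnB sqnZ normcC real_normK ?num_real //.
  rewrite rdZr (rdC d x); have h1 := Ab' _ Ex; have h2 := Ac _ Ex.
  have t0 : 0 <= t by rewrite divr_ge0 ?ltW // exprn_gt0.
  have h3 : t * (c * sqn d x) <= t * rd d (A x) x by rewrite ler_wpM2l.
  have h4 : t ^+ 2 * sqn d (A x) <= t ^+ 2 * (K' ^+ 2 * sqn d x) by rewrite ler_wpM2l ?sqr_ge0.
  have e1 : t * (c * sqn d x) = (c / K') ^+ 2 * sqn d x by rewrite /t; field; rewrite gt_eqF.
  have e2 : t ^+ 2 * (K' ^+ 2 * sqn d x) = (c / K') ^+ 2 * sqn d x.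
    by rewrite /t; field; rewrite gt_eqF.
  by rewrite /q2 mulrBl mul1r; move: h3 h4; rewrite e1 e2; lra.
pose F x := x - t%:C *: (A x - m).
have EF x : E x -> E (F x) by move=> Ex; apply: subB => //; apply: subZ => //; apply: subB => //; apply: EA.
pose u n := iter n F 0.
have Eu n : E (u n) by elim: n => [|n IHn]; [apply: sub0|apply: EF].
have FB x y : E x -> E y -> nm d (F x - F y) <= q * nm d (x - y).
  move=> Ex Ey; have -> : F x - F y = (x - y) - t%:C *: A (x - y).
    by rewrite Al // /F opprD addrACA -opprD -scalerBr opprB addrA subrK.
  by apply: contr; apply: subB.
have uB n : nm d (u n.+1 - u n) <= nm d (u 1%N) * q ^+ n.
  elim: n => [|n IHn]; first by rewrite expr0 mulr1 subr0.
  rewrite exprS mulrCA; apply: (le_trans (FB _ _ (Eu n.+1) (Eu n))).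
  by rewrite ler_wpM2l //; case/andP: qb.
have [x Ex ux] := cE Eu (geom_cauchy qb uB); exists x => //.
suff h : x - F x = 0.
  move: h; rewrite /F subKr => /eqP; rewrite scaler_eq0 subr_eq0 => /orP[|/eqP//].
  by rewrite -normc_eq0 normcC normr_eq0 gt_eqF // divr_gt0 // exprn_gt0.
have Fx : lims d (fun n => u n.+1) (F x).
  move=> e e0; have [n0 hn] := ux _ e0; exists n0 => n nn.
  apply: (le_lt_trans (FB _ _ (Eu n) Ex)); apply: le_lt_trans (hn _ nn).
  by rewrite ler_piMl ?nm_ge0 //; case/andP: qb => _ /ltW.
have Fx' : lims d (fun n => u n.+1) x.
  by move=> e /ux[n0 hn]; exists n0 => n nn; apply/hn/leqW.
by rewrite (lims_unique Fx Fx') subrr.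
Qed.

(** Gliding hump. If |y_n| > 2 * 3^(n+1) * n, add to the current sum a multiple of y_n of norm
    3^-(n+1), with the sign for which the pairing with y_n is at least 3^-(n+1) |y_n|. All later
    terms together change this pairing by at most half of that, so the limit x has |<x, y_n>| >= n
    for every n. *)
Lemma uniform_boundedness (Y : set V) : (forall y, Y y -> E y) ->
  (forall x, E x -> exists C : R, forall y, Y y -> normc (d x y) <= C) ->
  exists C : R, forall y, Y y -> nm d y <= C.
Proof.
move=> YE hx; apply: contrapT => hC.
have ex (n : nat) : exists y, Y y /\ 2 * 3 ^+ n.+1 * n%:R < nm d y.
  apply: contrapT => h; apply: hC; exists (2 * 3 ^+ n.+1 * n%:R) => y Yy.
  by rewrite leNgt; apply/negP => h2; apply: h; exists y.
have [y hy] := choice ex.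
pose h n := (3 ^- n.+1 / nm d (y n))%:C *: y n.
have ypos n : 0 < nm d (y n).
  by apply: le_lt_trans (hy n).2; rewrite !mulr_ge0 // exprn_ge0.
have hn n : nm d (h n) = 3 ^- n.+1.
  rewrite nmZ normcC ger0_norm ?divr_ge0 ?nm_ge0 ?invr_ge0 ?exprn_ge0 //.
  by rewrite divfK ?gt_eqF.
pose st n x := if 3 ^- n.+1 * nm d (y n) <= normc (d (x + h n) (y n)) then x + h n else x - h n.
have stP n x : 3 ^- n.+1 * nm d (y n) <= normc (d (st n x) (y n)).
  rewrite /st; case: ifPn => //; rewrite -ltNge => h1.
  have e1 : d (h n) (y n) = (3 ^- n.+1 * nm d (y n))%:C.
    rewrite dtZl dtxx -rmorphM -nmsq expr2 mulrA divfK ?gt_eqF //.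
  have e2 : (2 * (3 ^- n.+1 * nm d (y n)))%:C = d (x + h n) (y n) - d (x - h n) (y n).
    rewrite dtDl dtBl e1 (rmorphM _ 2) rmorph_nat; ring.
  have := normcB (d (x + h n) (y n)) (d (x - h n) (y n)).
  rewrite -e2 normcC ger0_norm ?mulr_ge0 ?nm_ge0 ?invr_ge0 ?exprn_ge0 //.
  by move: h1; lra.
have stB n x : nm d (st n x - x) = 3 ^- n.+1.
  by rewrite /st; case: ifP => _; rewrite addrC addKr ?nmN hn.
pose u := fix u n := if n is n'.+1 then st n' (u n') else 0.
have Eu n : E (u n).
  elim: n => [|n IHn]; first exact: sub0.
  have Eh : E (h n) by apply: subZ => //; apply: YE; case: (hy n).
  by rewrite /= /st; case: ifP => _; [apply: subD|apply: subB].
have uB n : nm d (u n.+1 - u n) <= 3^-1 * 3^-1 ^+ n by rewrite stB -exprS -exprVn.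
have q3 : 0 <= (3^-1 : R) < 1 by rewrite invr_ge0 ler0n /= invf_lt1 ?ltr1n.
have [x Ex ux] := cE Eu (geom_cauchy q3 uB).
have ud n m : nm d (u (n + m)%N - u n) <= 2^-1 * (3^-1 ^+ n - 3^-1 ^+ (n + m)).
  elim: m => [|m IHm]; first by rewrite addn0 !subrr nm0 mulr0.
  apply: (le_trans (nm_dist _ (u (n + m)%N) _ _)); rewrite addnS.
  apply: (le_trans (lerD (uB _) IHm)); rewrite exprS; lra.
have xd n : nm d (x - u n) <= 2^-1 * 3^-1 ^+ n.
  apply: (@lims_dist_le u _ _ _ n) => // m /subnKC <-.
  apply: (le_trans (ud _ _)); rewrite ler_pM2l ?invr_gt0 // gerBl.
  by rewrite exprn_ge0 // invr_ge0.
have [C CP] := hx _ Ex.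
have big n : n%:R <= C.
  have [Yn Bn] := hy n; apply: le_trans (CP _ Yn).
  have h1 : 3 ^- n.+1 * nm d (y n) <= normc (d (u n.+1) (y n)) by apply: stP.
  have h2 := cauchy_schwarz d (x - u n.+1) (y n).
  have h3 : nm d (x - u n.+1) * nm d (y n) <= 2^-1 * 3 ^- n.+1 * nm d (y n).
    by rewrite ler_wpM2r ?nm_ge0 // -exprVn.
  have h4 := normcB (d x (y n)) (d (x - u n.+1) (y n)).
  rewrite -dtBl subKr in h4.
  have h5 : n%:R <= 2^-1 * 3 ^- n.+1 * nm d (y n).
    have X0 : 0 < (3 : R) ^+ n.+1 by rewrite exprn_gt0.
    have -> : n%:R = 2^-1 * 3 ^- n.+1 * (2 * 3 ^+ n.+1 * n%:R) :> R.
      by field; rewrite gt_eqF.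
    by rewrite ler_wpM2l ?(ltW Bn) // mulr_ge0 ?invr_ge0 ?(ltW X0).
  by move: h1 h2 h3 h4 h5; lra.
have := big (Num.Def.archi_bound `|C|); rewrite leNgt => /negP[].
by apply: le_lt_trans (ler_norm C) _; apply: archi_boundP.
Qed.

End HilbertTools.

(** * Dimensions of quotients *)

Section QuotientDimensionTheory.
Variables (K : fieldType) (V : lmodType K) (E F : set V).
Hypotheses (sE : lsub E) (sF : lsub F).

(** Families are indexed by any finite type because the monomial families below live on sums and
    products of such types. *)
Definition spans_mod (T : finType) (u : T -> V) :=
  (forall t, E (u t)) /\
  forall x, E x -> exists c : T -> K, F (x - \sum_t c t *: u t).

Definition free_mod (T : finType) (u : T -> V) :=
  (forall t, E (u t)) /\
  forall c : T -> K, F (\sum_t c t *: u t) -> forall t, c t = 0.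

Lemma has_qdim_intro n (v : 'I_n -> V) :
  spans_mod v -> free_mod v -> has_qdim E F n.
Proof.
move=> [Ev sv] [_ fv]; exists v; split=> // x Ex.
have [c hc] := sv x Ex; exists (\row_i c i); split.
  by under eq_bigr do rewrite mxE.
move=> c' hc'; apply/rowP => i; rewrite mxE; apply/eqP; rewrite -subr_eq0; apply/eqP.
apply: (fv (fun i => c i - c' 0 i)).
under eq_bigr do rewrite scalerBl.
rewrite sumrB.
have -> : \sum_i c i *: v i - \sum_i c' 0 i *: v i =
  (x - \sum_i c' 0 i *: v i) - (x - \sum_i c i *: v i).
  by rewrite opprB [RHS]addrC addrA subrK.
exact: subB.
Qed.

Lemma has_qdim_elim n : has_qdim E F n ->
  exists v : 'I_n -> V, spans_mod v /\ free_mod v.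
Proof.
move=> [v [Ev hv]]; exists v; split; split=> //.
  by move=> x /hv[c [hc _]]; exists (fun i => c 0 i).
move=> c hc i; have [c0 [_ uc]] := hv 0 (sub0 sE).
have h1 : c0 = 0.
  by apply: uc; rewrite sub0r big1 ?oppr0 => [|j _]; [apply: sub0|rewrite mxE scale0r].
have h2 : c0 = - \row_i c i.
  apply: uc; rewrite sub0r -sumrN.
  by under eq_bigr do rewrite !mxE scaleNr opprK.
have := congr1 (fun r : 'rV_n => r 0 i) h2.
by rewrite h1 !mxE => /esym/eqP; rewrite oppr_eq0 => /eqP.
Qed.

(** A spanning family of least length is free: a relation with a nonzero coefficient would allow one
    vector to be dropped. *)
Lemma spans_mod_has_qdim (T : finType) (u : T -> V) : spans_mod u ->
  exists2 n, (n <= #|T|)%N & has_qdim E F n.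
Proof.
move=> [Eu su].
pose P n := `[< exists v : 'I_n -> V, spans_mod v >].
have PT : P #|T|.
  apply/asboolP; exists (u \o enum_val); split=> [i|x /su[c hc]]; first exact: Eu.
  exists (c \o enum_val); move: hc; rewrite (reindex _ (onW_bij _ (@enum_val_bij T))) //.
have [n /asboolP[v sv] nmin] := ex_minnP (ex_intro P _ PT).
exists n; first exact: nmin.
apply: (@has_qdim_intro n v) => //; split; first exact: sv.1.
move=> c hc i0; apply/eqP; apply/negPn/negP => ci0.
case: n v sv c nmin hc i0 ci0 => [|n] v [Ev sv] c nmin hc i0 ci0; first by case: i0 ci0.
suff /nmin : P n by rewrite ltnn.
apply/asboolP; exists (v \o lift i0); split=> [i|x /sv[b hb]]; first exact: Ev.
exists (fun j => b (lift i0 j) - b i0 / c i0 * c (lift i0 j)).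
have := subD sF hb (subZ sF (b i0 / c i0) hc); congr F.
rewrite !(bigD1_ord i0) //= scalerDr scalerA divfK // -addrA opprD addrACA addNr add0r.
congr (_ + _); rewrite scaler_sumr -!sumrN -big_split /=; apply: eq_bigr => j _.
by rewrite scalerA scalerBl opprB addrC.
Qed.

(** If T had more than n elements, the matrix of coordinates in a basis modulo F would have a
    nonzero left kernel vector, which is a relation. *)
Lemma free_mod_leq (T : finType) (u : T -> V) n : free_mod u ->
  has_qdim E F n -> (#|T| <= n)%N.
Proof.
move=> [Eu fu] /has_qdim_elim[v [[Ev sv] _]].
have [A hA] := choice (fun t => sv _ (Eu t)).
rewrite leqNgt; apply/negP => lt.
pose M : 'M[K]_(#|T|, n) := \matrix_(i, j) A (enum_val i) j.
have : kermx M != 0.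
  rewrite -mxrank_eq0 mxrank_ker -lt0n subn_gt0.
  exact: leq_ltn_trans (rank_leq_col _) lt.
case/rowV0Pn => r /sub_kermxP rM /eqP; apply.
apply/rowP => i; rewrite mxE.
have := fu (fun t => r 0 (enum_rank t)) _ (enum_val i).
rewrite enum_valK; apply.
have -> : \sum_t r 0 (enum_rank t) *: u t =
   \sum_t r 0 (enum_rank t) *: (u t - \sum_j A t j *: v j).
  under [RHS]eq_bigr do rewrite scalerBr.
  rewrite sumrB [X in _ - X](_ : _ = 0) ?subr0 //.
  under eq_bigr do rewrite scaler_sumr.
  rewrite exchange_big big1 //= => j _.
  under eq_bigr do rewrite scalerA.
  rewrite -scaler_suml (reindex _ (onW_bij _ (@enum_val_bij T))) /=.
  have := congr1 (fun r : 'rV_n => r 0 j) rM; rewrite !mxE => h.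
  rewrite [X in X *: _](_ : _ = 0) ?scale0r // -[RHS]h.
  by apply: eq_bigr => k _; rewrite !mxE enum_valK.
by apply: sub_sum => // t _; apply: subZ.
Qed.

Lemma has_qdim_inj m n : has_qdim E F m -> has_qdim E F n -> m = n.
Proof.
move=> hm hn; have [v [_ fv]] := has_qdim_elim hm; have [w [_ fw]] := has_qdim_elim hn.
apply/eqP; rewrite eqn_leq; apply/andP.
by have := free_mod_leq fv hn; have := free_mod_leq fw hm; rewrite !card_ord.
Qed.

Lemma qdimE n : has_qdim E F n -> qdim E F = n.
Proof.
rewrite /qdim => hn; case: xgetP => [m _ hm|/(_ n)//].
exact: has_qdim_inj hm hn.
Qed.

End QuotientDimensionTheory.

(** * Arrays of Taylor coefficients *)

Section DegreeSums.
Variable U : nmodType.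
Implicit Types (F G : nat -> nat -> U).

Definition sh1 (T : Type) (F : nat -> nat -> T) i j := F i.+1 j.
Definition sh2 (T : Type) (F : nat -> nat -> T) i j := F i j.+1.

(** One weight serves for values and for norms: the square norm of z^i w^j in H^2 is the inverse of
    ['C(i + j, i)], so a series with general term ['C(i + j, i) * b i j * z^i * w^j] has square norm
    the sum of ['C(i + j, i) * |b i j|^2]. *)
Definition dg F k := \sum_(i < k.+1) F i (k - i)%N *+ 'C(k, i).
Definition ts F n := \sum_(k < n) dg F k.

Lemma dg0 F : dg F 0 = F 0 0.
Proof. by rewrite /dg big_ord1 bin0 mulr1n. Qed.

Lemma dg_recl F k :
  dg F k.+1 = F 0 k.+1 + \sum_(i < k.+1) F i.+1 (k - i)%N *+ 'C(k.+1, i.+1).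
Proof. by rewrite /dg big_ord_recl bin0 subn0 mulr1n. Qed.

Lemma dg_recr F k :
  dg F k.+1 = \sum_(i < k.+1) F i (k - i).+1 *+ 'C(k.+1, i) + F k.+1 0.
Proof.
rewrite /dg big_ord_recr /= subnn binn mulr1n; congr (_ + _).
by apply: eq_bigr => i _; rewrite subSn // -ltnS.
Qed.

(** Pascal's rule. This recursion along the two shifts drives all later inductions on the degree. *)
Lemma dgS F k : dg F k.+1 = dg (sh1 F) k + dg (sh2 F) k.
Proof.
rewrite dg_recl; under eq_bigr do rewrite binS mulrnDr.
rewrite big_split /= addrA addrC; congr (_ + _).
rewrite big_ord_recr /= bin_small ?ltnSn // mulr0n addr0.
rewrite [RHS]big_ord_recl /= bin0 mulr1n subn0; congr (_ + _).
apply: eq_bigr => i _; rewrite /sh2.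
by have /subnSK -> := ltn_ord i.
Qed.

Lemma ts0 F : ts F 0 = 0.
Proof. by rewrite /ts big_ord0. Qed.

Lemma tsSr F n : ts F n.+1 = ts F n + dg F n.
Proof. by rewrite /ts big_ord_recr. Qed.

Lemma tsS F n : ts F n.+1 = F 0 0 + ts (sh1 F) n + ts (sh2 F) n.
Proof.
rewrite /ts big_ord_recl dg0 -addrA; congr (_ + _).
by rewrite -big_split /=; apply: eq_bigr => i _; rewrite dgS.
Qed.

Lemma eq_dg F G k : (forall i j, (i + j)%N = k -> F i j = G i j) -> dg F k = dg G k.
Proof. by move=> h; apply: eq_bigr => i _; rewrite h // subnKC // -ltnS. Qed.

Lemma eq_ts F G n : (forall i j, (i + j < n)%N -> F i j = G i j) -> ts F n = ts G n.
Proof. by move=> h; apply: eq_bigr => k _; apply: eq_dg => i j ijk; rewrite h ?ijk. Qed.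

Lemma tsD F G n : ts (fun i j => F i j + G i j) n = ts F n + ts G n.
Proof.
rewrite /ts -big_split /=; apply: eq_bigr => k _; rewrite /dg -big_split /=.
by apply: eq_bigr => i _; rewrite mulrnDl.
Qed.

Lemma ts_eq0 F n : (forall i j, (i + j < n)%N -> F i j = 0) -> ts F n = 0.
Proof.
by move=> h; rewrite (@eq_ts _ (fun=> fun=> 0)) // /ts big1 // => k _;
   rewrite /dg big1 // => i _; rewrite mul0rn.
Qed.

Definition tail m F i j := if (i + j < m)%N then 0 else F i j.

Lemma ts_tail m n F : ts F (m + n) = ts F m + ts (tail m F) (m + n).
Proof.
elim: n => [|n IHn].
  by rewrite addn0 (ts_eq0 (F := tail m F)) ?addr0 // /tail => i j ->.
rewrite addnS !tsSr IHn -addrA; congr (_ + (_ + _)); apply: eq_dg => i j ijk.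
by rewrite /tail ijk ltnNge leq_addr.
Qed.

End DegreeSums.

Lemma ts_morph (U U' : nmodType) (f : U -> U') (F : nat -> nat -> U) n :
  f 0 = 0 -> (forall x y, f (x + y) = f x + f y) ->
  f (ts F n) = ts (fun i j => f (F i j)) n.
Proof.
move=> f0 fD; rewrite /ts (big_morph f fD f0); apply: eq_bigr => k _.
rewrite /dg (big_morph f fD f0); apply: eq_bigr => i _.
by elim: ('C(k, i)) => [|c IHc]; rewrite ?mulr0n // !mulrS fD IHc.
Qed.

Section WeightedArrays.
Variable R : realType.
Implicit Types (F : nat -> nat -> R).

Lemma dg_ge0 F k : (forall i j, 0 <= F i j) -> 0 <= dg F k.
Proof. by move=> h; apply: sumr_ge0 => i _; rewrite mulrn_wge0. Qed.

Lemma ts_ge0 F n : (forall i j, 0 <= F i j) -> 0 <= ts F n.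
Proof. by move=> h; apply: sumr_ge0 => i _; apply: dg_ge0. Qed.

Lemma dg_le F G k : (forall i j, (i + j)%N = k -> F i j <= G i j) -> dg F k <= dg G k.
Proof. by move=> h; apply: ler_sum => i _; rewrite lerMn2r h ?orbT // subnKC // -ltnS. Qed.

Lemma ts_le F G n : (forall i j, F i j <= G i j) -> ts F n <= ts G n.
Proof. by move=> h; apply: ler_sum => k _; apply: dg_le. Qed.

Lemma ts_mono F m n : (forall i j, 0 <= F i j) -> (m <= n)%N -> ts F m <= ts F n.
Proof. by move=> h /subnKC <-; rewrite ts_tail lerDl ts_ge0 // => i j; rewrite /tail; case: ifP. Qed.

Lemma tsZ (c : R) F n : ts (fun i j => c * F i j) n = c * ts F n.
Proof. by rewrite (ts_morph (f := *%R c)) ?mulr0 // => x y; rewrite mulrDr. Qed.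

End WeightedArrays.

Lemma bin_ratio (K : numFieldType) k i :
  'C(k.+1, i.+1)%:R * (i.+1%:R / k.+1%:R) = 'C(k, i)%:R :> K.
Proof.
have h : k.+1%:R != 0 :> K by rewrite pnatr_eq0.
apply: (mulIf h); rewrite -mulrA divfK // -!natrM; congr _%:R.
by rewrite mulnC -mul_bin_diag mulnC.
Qed.

(* An array [b] is a normalised sequence of Taylor coefficients: it stands for
   the power series of general term ['C(i + j, i) * b i j * z ^ i * w ^ j].
   In this normalisation [sh1] and [sh2] are the adjoints of the
   multiplications [mz] and [mw] by z and w on the Fock space. *)
Section Arrays.
Variable R : realType.
Local Notation K := R[i].
Implicit Types (b p q : nat -> nat -> K) (x : K * K).

Definition asq n b : R := ts (fun i j => normc (b i j) ^+ 2) n.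
Definition aev n b x : K := ts (fun i j => b i j * (x.1 ^+ i * x.2 ^+ j)) n.
Definition abounded b := exists C : R, forall n, asq n b <= C.
(** The factor is the ratio of ['C(i + j - 1, i - 1)] to ['C(i + j, i)]: unnormalised Taylor
    coefficients are merely shifted. *)
Definition mz b i j : K := if i is i'.+1 then (i%:R / (i + j)%:R) * b i' j else 0.
Definition mw b i j : K := if j is j'.+1 then (j%:R / (i + j)%:R) * b i j' else 0.
Definition arr_add p q i j : K := p i j + q i j.
Definition arr_scl (c : K) p i j : K := c * p i j.
Definition rho x : R := normc x.1 ^+ 2 + normc x.2 ^+ 2.

Lemma rho_ge0 x : 0 <= rho x.
Proof. by rewrite addr_ge0 ?sqr_ge0. Qed.

Lemma asq_ge0 n b : 0 <= asq n b.
Proof. by apply: ts_ge0 => i j; apply: sqr_ge0. Qed.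

Lemma asqS n b : asq n.+1 b = normc (b 0 0)%N ^+ 2 + asq n (sh1 b) + asq n (sh2 b).
Proof. exact: tsS. Qed.

Lemma asq_mono m n b : (m <= n)%N -> asq m b <= asq n b.
Proof. by apply: ts_mono => i j; apply: sqr_ge0. Qed.

Lemma asq_add n p q : asq n (arr_add p q) <= 2 * asq n p + 2 * asq n q.
Proof.
rewrite /asq -!tsZ -tsD; apply: ts_le => i j; apply: normc_sqD.
Qed.

Lemma asq_scl n c b : asq n (arr_scl c b) = normc c ^+ 2 * asq n b.
Proof.
by rewrite /asq -tsZ; apply: eq_ts => i j _; rewrite /arr_scl normcM exprMn.
Qed.

Lemma asq_sh n b : asq n (sh1 b) + asq n (sh2 b) <= asq n.+1 b.
Proof. by rewrite asqS -addrA lerDr sqr_ge0. Qed.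

Lemma asq_sh1 n b : asq n (sh1 b) <= asq n.+1 b.
Proof. by apply: le_trans (asq_sh n b); rewrite lerDl asq_ge0. Qed.

Lemma asq_sh2 n b : asq n (sh2 b) <= asq n.+1 b.
Proof. by apply: le_trans (asq_sh n b); rewrite lerDr asq_ge0. Qed.

Lemma asq_tail m n b : asq (m + n) (tail m b) = asq (m + n) b - asq m b.
Proof.
rewrite /asq [in RHS]ts_tail [RHS]addrC addKr; apply: eq_ts => i j _.
by rewrite /tail; case: ifP => _ //; rewrite normc0 expr0n.
Qed.

Lemma abounded_add p q : abounded p -> abounded q -> abounded (arr_add p q).
Proof.
move=> [C hC] [D hD]; exists (2 * C + 2 * D) => n; apply: (le_trans (asq_add _ _ _)).
by rewrite lerD // ler_pM2l.
Qed.

Lemma abounded_scl c p : abounded p -> abounded (arr_scl c p).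
Proof.
move=> [C hC]; exists (normc c ^+ 2 * C) => n.
by rewrite asq_scl ler_wpM2l // sqr_ge0.
Qed.

Lemma abounded_sh1 p : abounded p -> abounded (sh1 p).
Proof. by move=> [C hC]; exists C => n; apply: le_trans (asq_sh1 _ _) (hC _). Qed.

Lemma abounded_sh2 p : abounded p -> abounded (sh2 p).
Proof. by move=> [C hC]; exists C => n; apply: le_trans (asq_sh2 _ _) (hC _). Qed.

Lemma dg_mz (F : nat -> nat -> R) k :
  dg (fun i j => if i is i'.+1 then (i%:R / (i + j)%:R) ^+ 2 * F i' j else 0) k.+1 =
  dg (fun i j => i.+1%:R / (i + j).+1%:R * F i j) k.
Proof.
rewrite dg_recl add0r; apply: eq_bigr => i _.
rewrite addSn subnKC; last by rewrite -ltnS.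
by rewrite -[_ *+ 'C(_, _)]mulr_natl -[RHS]mulr_natl expr2 -mulrA mulrA bin_ratio.
Qed.

Lemma dg_mw (F : nat -> nat -> R) k :
  dg (fun i j => if j is j'.+1 then (j%:R / (i + j)%:R) ^+ 2 * F i j' else 0) k.+1 =
  dg (fun i j => j.+1%:R / (i + j).+1%:R * F i j) k.
Proof.
rewrite dg_recr addr0; apply: eq_bigr => i _.
have ik : (i <= k)%N by rewrite -ltnS.
rewrite addnS subnKC // -(bin_sub ik) -(bin_sub (leqW ik)) subSn //.
by rewrite -[_ *+ 'C(_, _)]mulr_natl -[RHS]mulr_natl expr2 -mulrA mulrA bin_ratio.
Qed.

Lemma asq_mzE n b : asq n.+1 (mz b) =
  ts (fun i j => i.+1%:R / (i + j).+1%:R * normc (b i j) ^+ 2) n.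
Proof.
rewrite /asq /ts big_ord_recl dg0 [mz b _ _]/= normc0 expr0n add0r; apply: eq_bigr => k _.
rewrite -dg_mz; apply: eq_dg => -[|i] j _; first by rewrite normc0 expr0n.
by rewrite normcM exprMn normcM normcV !normc_nat.
Qed.

Lemma asq_mwE n b : asq n.+1 (mw b) =
  ts (fun i j => j.+1%:R / (i + j).+1%:R * normc (b i j) ^+ 2) n.
Proof.
rewrite /asq /ts big_ord_recl dg0 [mw b _ _]/= normc0 expr0n add0r; apply: eq_bigr => k _.
rewrite -dg_mw; apply: eq_dg => i [|j] _; first by rewrite normc0 expr0n.
by rewrite normcM exprMn normcM normcV !normc_nat.
Qed.

Lemma asq_mz n b : asq n (mz b) <= asq n b.
Proof.
apply: (le_trans (asq_mono _ (leqnSn _))); rewrite asq_mzE; apply: ts_le => i j.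
rewrite ler_piMl ?sqr_ge0 // ler_pdivrMr ?ltr0n // mul1r ler_nat.
by rewrite ltnS leq_addr.
Qed.

Lemma asq_mw n b : asq n (mw b) <= asq n b.
Proof.
apply: (le_trans (asq_mono _ (leqnSn _))); rewrite asq_mwE; apply: ts_le => i j.
rewrite ler_piMl ?sqr_ge0 // ler_pdivrMr ?ltr0n // mul1r ler_nat.
by rewrite ltnS leq_addl.
Qed.

Lemma abounded_mz p : abounded p -> abounded (mz p).
Proof. by move=> [C hC]; exists C => n; apply: le_trans (asq_mz _ _) (hC _). Qed.

Lemma abounded_mw p : abounded p -> abounded (mw p).
Proof. by move=> [C hC]; exists C => n; apply: le_trans (asq_mw _ _) (hC _). Qed.

Lemma aevS n b x : aev n.+1 b x =
  b 0%N 0%N + x.1 * aev n (sh1 b) x + x.2 * aev n (sh2 b) x.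
Proof.
rewrite /aev tsS !expr0 !mulr1; congr (_ + _ + _).
  rewrite (ts_morph (f := *%R x.1)) ?mulr0 //; last exact: mulrDr.
  by apply: eq_ts => i j _; rewrite /sh1 exprS; ring.
rewrite (ts_morph (f := *%R x.2)) ?mulr0 //; last exact: mulrDr.
by apply: eq_ts => i j _; rewrite /sh2 exprS; ring.
Qed.

Lemma aevD n p q x : aev n (arr_add p q) x = aev n p x + aev n q x.
Proof. by rewrite /aev -tsD; apply: eq_ts => i j _; rewrite mulrDl. Qed.

Lemma aevZ n c p x : aev n (arr_scl c p) x = c * aev n p x.
Proof.
rewrite /aev (ts_morph (f := *%R c)) ?mulr0 //; last exact: mulrDr.
by apply: eq_ts => i j _; rewrite /arr_scl -!mulrA.
Qed.

Lemma aev_mz n b x : aev n.+1 (mz b) x = x.1 * aev n b x.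
Proof.
rewrite /aev (ts_morph (f := *%R x.1)) ?mulr0 //; last exact: mulrDr.
rewrite /ts big_ord_recl dg0 /= mul0r add0r; apply: eq_bigr => k _.
rewrite dg_recl mul0r add0r; apply: eq_bigr => i _.
rewrite [mz _ _ _]/= addSn subnKC; last by rewrite -ltnS.
rewrite -[LHS]mulr_natl -[RHS]mulr_natl -(bin_ratio _ k i) exprS; ring.
Qed.

Lemma aev_mw n b x : aev n.+1 (mw b) x = x.2 * aev n b x.
Proof.
rewrite /aev (ts_morph (f := *%R x.2)) ?mulr0 //; last exact: mulrDr.
rewrite /ts big_ord_recl dg0 /= mul0r add0r; apply: eq_bigr => k _.
rewrite dg_recr mul0r addr0; apply: eq_bigr => i _.
have ik : (i <= k)%N by rewrite -ltnS.
rewrite [mw _ _ _]/= addnS subnKC // -(bin_sub ik) -(bin_sub (leqW ik)) subSn //.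
rewrite -[LHS]mulr_natl -[RHS]mulr_natl -(bin_ratio _ k (k - i)) exprS; ring.
Qed.

End Arrays.

(** * Evaluation of square summable series in the ball *)

Section PowerSeries.
Variable R : realType.
Local Notation K := R[i].
Implicit Types (b p q : nat -> nat -> K) (x : K * K) (y : K).

Lemma row_cauchy_schwarz x (c1 c2 : K) :
  normc (x.1 * c1 + x.2 * c2) ^+ 2 <= rho x * (normc c1 ^+ 2 + normc c2 ^+ 2).
Proof.
have h := le_normcD (x.1 * c1) (x.2 * c2); rewrite !normcM in h.
have : normc (x.1 * c1 + x.2 * c2) ^+ 2 <=
    (normc x.1 * normc c1 + normc x.2 * normc c2) ^+ 2.
  by rewrite ler_pXn2r ?nnegrE ?normc_ge0 ?addr_ge0 ?mulr_ge0 ?normc_ge0.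
move/le_trans; apply; rewrite /rho.
move: (normc x.1) (normc x.2) (normc c1) (normc c2) => a1 a2 d1 d2.
have := sqr_ge0 (a1 * d2 - a2 * d1); rewrite !expr2; lra.
Qed.

Lemma normc_sq_add_le (c0 y : K) (s t : R) : 0 <= t ->
  normc y ^+ 2 <= t * s -> 0 <= s ->
  normc (c0 + y) ^+ 2 <= (1 + t) * (normc c0 ^+ 2 + s).
Proof.
move=> t0 ys s0.
have h := le_normcD c0 y.
have : normc (c0 + y) ^+ 2 <= (normc c0 + normc y) ^+ 2.
  by rewrite ler_pXn2r ?nnegrE ?addr_ge0 ?normc_ge0.
move/le_trans; apply.
have := normc_ge0 c0; have := normc_ge0 y; move: ys.
move: (normc c0) (normc y) => a d ys d0 a0.
have h1 : (2 * a * d) ^+ 2 <= (t * a ^+ 2 + s) ^+ 2.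
  have h2 : a ^+ 2 * d ^+ 2 <= a ^+ 2 * (t * s) by rewrite ler_wpM2l ?sqr_ge0.
  have := sqr_ge0 (t * a ^+ 2 - s); move: h2; rewrite !expr2; lra.
have h3 : 2 * a * d <= t * a ^+ 2 + s.
  rewrite -(@ler_pXn2r _ 2) // nnegrE ?mulr_ge0 //.
  by rewrite addr_ge0 // mulr_ge0 // sqr_ge0.
by rewrite sqrrD; move: h3 ys; lra.
Qed.

(** The reproducing kernel estimate |f(x)|^2 <= k(x, x) |f|^2. The constant k = 1 / (1 - rho x) is
    the solution of k = 1 + rho x * k, which is what one step of the recursion requires. *)
Lemma aev_bound n b x : rho x < 1 ->
  normc (aev n b x) ^+ 2 <= (1 - rho x)^-1 * asq n b.
Proof.
move=> rx; have r0 := rho_ge0 x.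
have k0 : 0 < 1 - rho x by rewrite subr_gt0.
elim: n b => [|n IHn] b; first by rewrite /aev /asq !ts0 normc0 expr0n mulr0.
rewrite aevS asqS -!addrA.
have -> : (1 - rho x)^-1 = 1 + rho x * (1 - rho x)^-1 by field; rewrite gt_eqF.
apply: normc_sq_add_le.
- by rewrite mulr_ge0 // invr_ge0 ltW.
- apply: (le_trans (row_cauchy_schwarz _ _ _)); rewrite -mulrA ler_wpM2l // mulrDr.
  by rewrite lerD.
- by rewrite addr_ge0 ?asq_ge0.
Qed.

(** Every degree removed from the front passes to the two shifts and gains a factor rho x. *)
Lemma aev_tail_bound m n b x : rho x < 1 ->
  normc (aev (m + n) b x - aev m b x) ^+ 2 <=
    rho x ^+ m * ((1 - rho x)^-1 * asq (m + n) b).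
Proof.
move=> rx; have r0 := rho_ge0 x.
have k0 : 0 < 1 - rho x by rewrite subr_gt0.
elim: m b => [|m IHm] b.
  by rewrite add0n {2}/aev ts0 subr0 expr0 mul1r aev_bound.
rewrite addSn !aevS.
have -> : b 0%N 0%N + x.1 * aev (m + n) (sh1 b) x + x.2 * aev (m + n) (sh2 b) x -
   (b 0%N 0%N + x.1 * aev m (sh1 b) x + x.2 * aev m (sh2 b) x) =
   x.1 * (aev (m + n) (sh1 b) x - aev m (sh1 b) x) +
   x.2 * (aev (m + n) (sh2 b) x - aev m (sh2 b) x) by ring.
apply: (le_trans (row_cauchy_schwarz _ _ _)); rewrite [rho x ^+ m.+1]exprS -mulrA ler_wpM2l //.
apply: (le_trans (lerD (IHm _) (IHm _))).
rewrite -!mulrDr ler_wpM2l ?exprn_ge0 // ler_wpM2l ?invr_ge0 ?(ltW k0) //.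
exact: asq_sh.
Qed.

Definition sums_to b x y := forall e : R, 0 < e ->
  exists n0, forall n, (n0 <= n)%N -> normc (aev n b x - y) < e.

Lemma sums_tail (C : R) b x y m : rho x < 1 -> (forall n, asq n b <= C) ->
  sums_to b x y ->
  normc (y - aev m b x) ^+ 2 <= rho x ^+ m * ((1 - rho x)^-1 * C).
Proof.
move=> rx bC by_; have r0 := rho_ge0 x.
have k0 : 0 < 1 - rho x by rewrite subr_gt0.
have C0 : 0 <= C by apply: le_trans (bC 0%N); apply: asq_ge0.
have B0 : 0 <= rho x ^+ m * ((1 - rho x)^-1 * C).
  by rewrite !mulr_ge0 ?exprn_ge0 ?invr_ge0 ?(ltW k0).
rewrite -[leRHS](sqr_sqrtr B0) ler_pXn2r ?nnegrE ?normc_ge0 ?sqrtr_ge0 //.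
apply: le_eps => e e0; have [n0 hn] := by_ _ e0.
have h1 := hn (m + n0)%N (leq_addl _ _).
have h2 := le_normcD (aev (m + n0) b x - aev m b x) (y - aev (m + n0) b x).
rewrite [X in normc X <= _]addrC subrKA in h2; rewrite (normc_distC y (aev (m + _) _ _)) in h2.
suff h3 : normc (aev (m + n0) b x - aev m b x) <=
   Num.sqrt (rho x ^+ m * ((1 - rho x)^-1 * C)) by lra.
rewrite -(@ler_pXn2r _ 2) ?nnegrE ?normc_ge0 ?sqrtr_ge0 // sqr_sqrtr //.
apply: (le_trans (aev_tail_bound _ _ _ rx)).
by rewrite ler_wpM2l ?exprn_ge0 // ler_wpM2l ?invr_ge0 ?(ltW k0).
Qed.

Lemma sums_unique b x y y' : sums_to b x y -> sums_to b x y' -> y = y'.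
Proof.
move=> h h'; apply/eqP; rewrite -subr_eq0; apply/eqP/normc_small => e e0.
have e2 : 0 < e / 2 by rewrite divr_gt0.
have [n hn] := h _ e2; have [n' hn'] := h' _ e2.
have h1 := hn _ (leq_maxl n n'); have h2 := hn' _ (leq_maxr n n').
have := le_normcD (y - aev (maxn n n') b x) (aev (maxn n n') b x - y').
by rewrite subrKA (normc_distC y (aev _ _ _)); lra.
Qed.

Lemma sums_add p q x y y' : sums_to p x y -> sums_to q x y' ->
  sums_to (arr_add p q) x (y + y').
Proof.
move=> h h' e e0; have e2 : 0 < e / 2 by rewrite divr_gt0.
have [n hn] := h _ e2; have [n' hn'] := h' _ e2.
exists (maxn n n') => k; rewrite geq_max => /andP[/hn h1 /hn' h2].
rewrite aevD opprD addrACA; apply: (le_lt_trans (le_normcD _ _)); lra.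
Qed.

Lemma sums_scl c p x y : sums_to p x y -> sums_to (arr_scl c p) x (c * y).
Proof.
move=> h e e0; have k0 : 0 < normc c + 1 by have := normc_ge0 c; lra.
have [n hn] := h _ (divr_gt0 e0 k0); exists n => k /hn.
rewrite ltr_pdivlMr // aevZ -mulrBr normcM; apply: le_lt_trans.
by rewrite mulrC ler_wpM2l ?normc_ge0 // lerDl.
Qed.

Lemma sums_mz p x y : sums_to p x y -> sums_to (mz p) x (x.1 * y).
Proof.
move=> /(sums_scl x.1) h e /h[n hn]; exists n.+1 => -[//|k] nk.
by have := hn k nk; rewrite aev_mz aevZ.
Qed.

Lemma sums_mw p x y : sums_to p x y -> sums_to (mw p) x (x.2 * y).
Proof.
move=> /(sums_scl x.2) h e /h[n hn]; exists n.+1 => -[//|k] nk.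
by have := hn k nk; rewrite aev_mw aevZ.
Qed.

Definition hpart b k x := dg (fun i j => b i j * (x.1 ^+ i * x.2 ^+ j)) k.

Lemma hpart_scale b k (t : K) x :
  hpart b k (t * x.1, t * x.2) = t ^+ k * hpart b k x.
Proof.
rewrite /hpart /dg mulr_sumr; apply: eq_bigr => i _ /=.
rewrite mulrnAr; congr (_ *+ _); rewrite !exprMn.
have -> : t ^+ k = t ^+ i * t ^+ (k - i) by rewrite -exprD subnKC // -ltnS.
ring.
Qed.

Lemma hpart_eq0 b k (e : R) : 0 < e ->
  (forall x, normc x.1 < e -> normc x.2 < e -> hpart b k x = 0) ->
  forall i j, (i + j)%N = k -> b i j = 0.
Proof.
move=> e0 h i j ijk; pose s : K := (e / 2)%:C.
have s0 : s != 0 by rewrite -normc_eq0 normcC normr_eq0 gt_eqF // divr_gt0.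
(* With w = s fixed, the homogeneous part is a polynomial in z of degree at most k that vanishes at
   the k + 1 points s / (m + 1). *)
pose P : {poly K} := \poly_(l < k.+1) (b l (k - l)%N * s ^+ (k - l) *+ 'C(k, l)).
have P0 : P = 0.
  apply: (@roots_geq_poly_eq0 _ _ [seq s / m.+1%:R | m <- iota 0 k.+1]).
  - apply/allP => _ /mapP[m _ ->]; apply/rootP.
    rewrite horner_poly -[RHS](h (s / m.+1%:R, s)) /=.
    + by apply: eq_bigr => l _; rewrite mulrnAl -mulrA [_ * s ^+ _]mulrC.
    + rewrite normcM normcV normc_nat normcC ger0_norm ?divr_ge0 ?ltW //.
      apply: (@le_lt_trans _ _ (e / 2)); last by lra.
      by rewrite ler_piMr ?divr_ge0 ?(ltW e0) // invf_le1 ?ltr0n // ler1n.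
    + change (normc (e / 2)%:C < e); rewrite normcC ger0_norm ?divr_ge0 ?ltW //; lra.
  - rewrite map_inj_uniq ?iota_uniq // => m n.
    by move=> /(mulfI s0)/invr_inj/eqP; rewrite eqr_nat => /eqP[].
  - by rewrite size_map size_iota size_poly.
have := congr1 (fun q : {poly K} => q`_i) P0.
rewrite coef0 coef_poly ltnS -ijk leq_addr addKn => /eqP.
rewrite -mulr_natr !mulf_eq0 expf_eq0 (negPf s0) andbF orbF pnatr_eq0.
by rewrite -leqn0 leqNgt bin_gt0 leq_addr orbF => /eqP.
Qed.

(** Identity theorem. Once the parts of degree below k vanish, evaluation at t x gives t^k times the
    part of degree k, while the tail bound makes it O(t^(k+1)); letting t tend to 0 kills this
    part. *)
Lemma array_unique b : abounded b ->
  (exists2 e : R, 0 < e &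
     forall x, normc x.1 < e -> normc x.2 < e -> sums_to b x 0) ->
  forall i j, b i j = 0.
Proof.
move=> [C bC] [e0 e0p h0].
(* The bound 1/2 on the coordinates keeps rho at most 1/2, hence 1 / (1 - rho) at most 2. *)
pose e := Num.min e0 2^-1.
have ep : 0 < e by rewrite lt_min e0p invr_gt0 ltr0n.
have eh : e <= 2^-1 by rewrite ge_min lexx orbT.
have h x : normc x.1 < e -> normc x.2 < e -> sums_to b x 0.
  by rewrite !lt_min => /andP[h1 _] /andP[h2 _]; apply: h0.
have C0 : 0 <= C by apply: le_trans (bC 0%N); apply: asq_ge0.
suff key k x : normc x.1 < e -> normc x.2 < e -> hpart b k x = 0.
  by move=> i j; apply: (hpart_eq0 ep (key (i + j)%N)).
move: x; have [m] := ubnP k; elim: m k => // m IHm k; rewrite ltnS => km x x1 x2.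
apply/normc_small => u u0.
pose t := Num.min 1 (u / (C + 1)).
have t0 : 0 < t by rewrite lt_min ltr01 divr_gt0 // ltr_wpDl.
have t1 : t <= 1 by rewrite ge_min lexx.
pose y : K * K := (t%:C * x.1, t%:C * x.2).
have yx1 : normc y.1 = t * normc x.1 by rewrite normcM normcC ger0_norm // ltW.
have yx2 : normc y.2 = t * normc x.2 by rewrite normcM normcC ger0_norm // ltW.
have y1 : normc y.1 < e.
  by rewrite yx1; apply: le_lt_trans x1; rewrite ler_piMl ?normc_ge0.
have y2 : normc y.2 < e.
  by rewrite yx2; apply: le_lt_trans x2; rewrite ler_piMl ?normc_ge0.
have rx : rho x <= 2^-1.
  rewrite /rho; have e22 : 2^-1 = 2^-1 ^+ 2 + 2^-1 ^+ 2 :> R by rewrite !expr2; lra.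
  rewrite [leRHS]e22 lerD // ler_pXn2r ?nnegrE ?normc_ge0 ?invr_ge0 //;
  exact: ltW (lt_le_trans _ eh).
have ry : rho y = t ^+ 2 * rho x by rewrite /rho yx1 yx2 !exprMn mulrDr.
have ryt : rho y <= t ^+ 2 * 2^-1 by rewrite ry ler_wpM2l ?sqr_ge0.
have ry2 : rho y <= 2^-1.
  apply: (le_trans ryt); rewrite ler_piMl ?invr_ge0 //.
  by rewrite exprn_ile1 // ltW.
have ry1 : rho y < 1 by apply: le_lt_trans ry2 _; rewrite invf_lt1 ?ltr1n.
have := sums_tail k.+1 ry1 bC (h y y1 y2).
have -> : aev k.+1 b y = t%:C ^+ k * hpart b k x.
  rewrite -hpart_scale /aev tsSr /ts big1 ?add0r // => l _.
  apply: IHm => //; exact: leq_trans (ltn_ord l) km.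
rewrite sub0r normcN normcM normcX normcC ger0_norm ?(ltW t0) // => H.
have tk : 0 < (t ^+ k) ^+ 2 by rewrite !exprn_gt0.
have H2 : normc (hpart b k x) ^+ 2 <= (t * (C + 1)) ^+ 2.
  rewrite -(ler_pM2l tk) -exprMn; apply: (le_trans H).
  have a1 : rho y ^+ k.+1 <= (t ^+ 2 * 2^-1) ^+ k.+1.
    by apply: lerXn2r; rewrite // nnegrE ?rho_ge0 // mulr_ge0 ?sqr_ge0 // invr_ge0.
  have a2 : (1 - rho y)^-1 <= 2.
    by rewrite invf_ple ?posrE ?ltr0n //; lra.
  have a3 : (1 - rho y)^-1 * C <= 2 * C by rewrite ler_wpM2r.
  have a4 : rho y ^+ k.+1 * ((1 - rho y)^-1 * C) <=
      (t ^+ 2 * 2^-1) ^+ k.+1 * (2 * C).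
    apply: ler_pM => //; first by rewrite exprn_ge0 ?rho_ge0.
    by rewrite mulr_ge0 // invr_ge0; lra.
  apply: (le_trans a4).
  have -> : (t ^+ 2 * 2^-1) ^+ k.+1 * (2 * C) = (t ^+ k) ^+ 2 * (t ^+ 2 * (C * 2^-1 ^+ k)).
    rewrite exprMn [2^-1 ^+ k.+1]exprS -[(t ^+ k) ^+ 2]exprM mulnC exprM.
    rewrite [(t ^+ 2) ^+ k.+1]exprS.
    by move: (2^-1 ^+ k) ((t ^+ 2) ^+ k) => s s'; field.
  rewrite ler_pM2l // exprMn ler_pM2l ?exprn_gt0 //.
  apply: (@le_trans _ _ C).
    by rewrite ler_piMr // exprn_ile1 ?invr_ge0 // invf_le1 ?ltr0n // ler1n.
  by rewrite expr2; have := mulr_ge0 C0 C0; lra.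
have H3 : normc (hpart b k x) <= t * (C + 1).
  rewrite -(@ler_pXn2r _ 2) ?nnegrE ?normc_ge0 // mulr_ge0 ?(ltW t0) //; lra.
apply: (le_trans H3); rewrite -ler_pdivlMr; last lra.
by rewrite ge_min lexx orbT.
Qed.

End PowerSeries.

(** * The Fock space and its backward shifts *)

Section IpOfDot.
Variables (R : realType) (V : lmodType R[i]) (f : {dot V for @Num.conj R[i]}).

Lemma ip_of_dot_lin (a : R[i]) (x y z : V) : f (a *: x + y) z = a * f x z + f y z.
Proof. exact: linearPl. Qed.

Lemma ip_of_dot_sym (x y : V) : f y x = Num.conj (f x y).
Proof. by rewrite [LHS]hermC expr0 mul1r. Qed.

Lemma ip_of_dot_pos (x : V) : x != 0 -> 0 < f x x.
Proof. by move=> x0; rewrite dnorm_gt0. Qed.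

Definition ip_of_dot : ip V := Ip ip_of_dot_lin ip_of_dot_sym ip_of_dot_pos.

Lemma ip_of_dotE x y : ip_of_dot x y = f x y.
Proof. by []. Qed.

End IpOfDot.

Section HilbertDot.
Variables (R : realType) (V : completeNormedModType R[i]).
Variables (f : {dot V for @Num.conj R[i]}) (hf : hilbert_dot f).
Local Notation d := (ip_of_dot f).

Lemma norm_nm (x : V) : `|x| = (nm d x)%:C.
Proof.
apply/eqP; rewrite -(@eqrXn2 _ 2) ?normr_ge0 ?ler0c ?nm_ge0 //.
by rewrite hf -rmorphXn nmsq -ip_of_dotE dtxx.
Qed.

Lemma closed_complete (E : set V) : closed E -> complete_set d E.
Proof.
move=> cE u Eu cu.
have epos (e : R[i]) : 0 < e -> exists2 r : R, 0 < r & e = r%:C.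
  move=> e0; exists (complex.Re e); last by rewrite RRe_real // realE ltW.
  by move: e0; rewrite ltcE => /andP[].
have : cvg (u @ \oo).
  apply: cauchy_cvg; apply: cauchy_exP => e /epos[r r0 ->].
  have [n0 hn] := cu _ r0; exists (u n0); exists n0 => // n /= nn.
  by rewrite -ball_normE /= norm_nm ltcR; apply: hn.
move=> /cvg_ex[x ux]; exists x.
  apply: (closed_cvg _ cE _ _ ux) => //; exact: nearW.
move=> e e0; have ec : 0 < e%:C :> R[i] by rewrite ltcR.
have /cvgrPdist_lt/(_ _ ec)[n0 _ hn] := ux.
by exists n0 => n /hn /=; rewrite norm_nm ltcR nm_distC.
Qed.

End HilbertDot.

(* Linear combinations of kernel functions [k_(y, l)], paired with the images
   of the combination under the two backward shifts, which act on a kernel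
   function by [k_(y, l) |-> conj y_i *: k_(y, l)]. *)
Inductive kernel_comb (R : realType) (L H : completeNormedModType R[i])
    (ker : C2 R -> L -> H) : H -> H -> H -> Prop :=
| KernelComb0 : kernel_comb ker 0 0 0
| KernelCombS a y l f g1 g2 : ball2 y -> kernel_comb ker f g1 g2 ->
    kernel_comb ker (a *: ker y l + f) (a * Num.conj (y.1 : R[i]) *: ker y l + g1)
      (a * Num.conj (y.2 : R[i]) *: ker y l + g2).

Section Fock.
Variables (R : realType) (L H : completeNormedModType R[i]).
Local Notation K := R[i].
Variables (dotL : {dot L for @Num.conj K}) (dotH : {dot H for @Num.conj K}).
Variables (ev : H -> C2 R -> L).
Hypothesis hH : hilbert_dot dotH.
Hypothesis fockH : is_fock_space dotL dotH ev.
Local Notation dL := (ip_of_dot dotL).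
Local Notation dH := (ip_of_dot dotH).
Local Notation ball := (@ball2 R).
Implicit Types (f g h : H) (x y : C2 R) (l : L) (a : K).

Lemma ball_rho x : ball x <-> rho x < 1.
Proof.
rewrite /ball2 /= /rho.
have -> : `|x.1| ^+ 2 + `|x.2| ^+ 2 = (normc x.1 ^+ 2 + normc x.2 ^+ 2)%:C.
  by rewrite rmorphD !rmorphXn /= -!norm_normc.
by rewrite (ltcR _ 1).
Qed.

Lemma ball2_0 : ball 0.
Proof.
apply/ball_rho; suff -> : rho (0 : C2 R) = 0 by exact: ltr01.
by rewrite /rho [fst _](_ : _ = 0) // [snd _](_ : _ = 0) // normc0 expr0n /= addr0.
Qed.

Lemma ev_lin a f g x : ball x -> ev (a *: f + g) x = a *: ev f x + ev g x.
Proof. by case: fockH => lin _ _ _ /lin ->. Qed.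

Lemma evD f g x : ball x -> ev (f + g) x = ev f x + ev g x.
Proof. by move=> bx; have := ev_lin 1 f g bx; rewrite !scale1r. Qed.

Lemma ev0 x : ball x -> ev 0 x = 0.
Proof.
by move=> bx; have := ev_lin (- 1) 0 0 bx; rewrite scaler0 addr0 scaleN1r addNr.
Qed.

Lemma evZ a f x : ball x -> ev (a *: f) x = a *: ev f x.
Proof. by move=> bx; have := ev_lin a f 0 bx; rewrite ev0 // !addr0. Qed.

Lemma evN f x : ball x -> ev (- f) x = - ev f x.
Proof. by move=> bx; rewrite -scaleN1r evZ // scaleN1r. Qed.

Lemma evB f g x : ball x -> ev (f - g) x = ev f x - ev g x.
Proof. by move=> bx; rewrite evD // evN. Qed.

Lemma ev_inj f g : (forall x, ball x -> ev f x = ev g x) -> f = g.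
Proof.
move=> h; apply/eqP; rewrite -subr_eq0; apply/eqP.
by case: fockH => _ inj _ _; apply: inj => x bx; rewrite evB // h // subrr.
Qed.

Lemma ker_ex : exists ker : C2 R -> L -> H, forall y l, ball y ->
  (forall x, ball x -> ev (ker y l) x = fock_kernel x y *: l) /\
  (forall f, dH f (ker y l) = dL (ev f y) l).
Proof.
case: fockH => _ _ _ kr.
have hk (p : C2 R * L) : exists g : H, ball p.1 ->
    (forall x, ball x -> ev g x = fock_kernel x p.1 *: p.2) /\
    (forall f, dH f g = dL (ev f p.1) p.2).
  have [bp|bp] := pselect (ball p.1); last by exists 0.
  by have [g h1 h2] := kr p.1 p.2 bp; exists g.
by have [k hk'] := choice hk; exists (fun y l => k (y, l)) => y l; apply: (hk' (y, l)).
Qed.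

Definition fker := sval (cid ker_ex).

Lemma ev_fker y l x : ball y -> ball x -> ev (fker y l) x = fock_kernel x y *: l.
Proof. by move=> yb; have [h _] := svalP (cid ker_ex) y l yb; apply: h. Qed.

Lemma dH_fker y l f : ball y -> dH f (fker y l) = dL (ev f y) l.
Proof. by move=> yb; have [_ h] := svalP (cid ker_ex) y l yb; apply: h. Qed.

Lemma normc_conj_mul_lt x y : ball x -> ball y ->
  normc (x.1 * Num.conj (y.1 : K) + x.2 * Num.conj (y.2 : K)) < 1.
Proof.
move=> /ball_rho bx /ball_rho by'.
rewrite -(@ltr_pXn2r _ 2) ?nnegrE ?normc_ge0 // expr1n.
apply: (le_lt_trans (row_cauchy_schwarz _ _ _)).
rewrite !normc_conj -/(rho y); have := rho_ge0 y; have := rho_ge0 x => x0 y0.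
apply: (@le_lt_trans _ _ (rho x)) => //; rewrite ler_piMr //; exact: ltW.
Qed.

(** The equation k = 1 + <x, y> k is the source of the backward shifts: it splits a kernel function
    into its value at 0 and its two shifted parts. *)
Lemma fock_kernel_eq x y : ball x -> ball y ->
  fock_kernel x y = 1 + x.1 * (Num.conj (y.1 : K) * fock_kernel x y)
     + x.2 * (Num.conj (y.2 : K) * fock_kernel x y).
Proof.
move=> bx by'; have := normc_conj_mul_lt bx by'; rewrite /fock_kernel => h.
have h0 : 1 - x.1 * Num.conj (y.1 : K) - x.2 * Num.conj (y.2 : K) != 0.
  apply: contraTneq h => h0; rewrite -leNgt.
  have -> : x.1 * Num.conj (y.1 : K) + x.2 * Num.conj (y.2 : K) = 1 :> K.
    by apply/esym/eqP; rewrite -subr_eq0 opprD addrA h0.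
  by rewrite normc1.
by field.
Qed.

Lemma fock_kernel0 x : fock_kernel 0 x = 1 :> K.
Proof. by rewrite /fock_kernel !mul0r !subr0 invr1. Qed.

Local Notation comb := (kernel_comb fker).

Lemma kernel_comb_ev f g1 g2 x : comb f g1 g2 -> ball x ->
  ev f x = ev f 0 + (x.1 *: ev g1 x + x.2 *: ev g2 x).
Proof.
move=> c bx; elim: c => [|a y l {}f {}g1 {}g2 by' _ IH].
  by rewrite !ev0 ?scaler0 ?addr0 //; apply: ball2_0.
rewrite !ev_lin //; last exact: ball2_0.
rewrite !ev_fker //; last exact: ball2_0.
rewrite IH fock_kernel0 !scalerA !scalerDr !scalerA mulr1.
rewrite [X in (a * X) *: l](fock_kernel_eq bx by').
rewrite [X in _ = _ + X]addrACA [RHS]addrACA; congr (_ + _).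
rewrite -!scalerDl; congr (_ *: _); ring.
Qed.

(** Operator identity: the two backward shifts and evaluation at 0 together form an isometric
    column. It implies that the shifts do not depend on the chosen combination and are bounded. *)
Lemma kernel_comb_dot f g1 g2 f' g1' g2' : comb f g1 g2 -> comb f' g1' g2' ->
  dH f f' = dL (ev f 0) (ev f' 0) + dH g1 g1' + dH g2 g2'.
Proof.
move=> c; elim=> [|a y l {}f' {}g1' {}g2' by' _ IH].
  by rewrite ev0 ?dt0r ?addr0 //; apply: ball2_0.
rewrite ev_lin ?ev_fker //; try exact: ball2_0.
rewrite fock_kernel0 scale1r !dtDr !dtZr !dH_fker // (kernel_comb_ev c by') IH.
by rewrite !dtDl !dtZl !rmorphM /= !conjCK; ring.
Qed.

Lemma kernel_comb_lin a f g1 g2 f' g1' g2' : comb f g1 g2 -> comb f' g1' g2' ->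
  comb (a *: f + f') (a *: g1 + g1') (a *: g2 + g2').
Proof.
move=> c c'; elim: c => [|b y l {}f {}g1 {}g2 by' _ IH]; first by rewrite !scaler0 !add0r.
by rewrite !scalerDr -!addrA !scalerA !mulrA; apply: KernelCombS.
Qed.

Lemma kernel_comb_sqn f g1 g2 : comb f g1 g2 ->
  sqn dH f = sqn dL (ev f 0) + sqn dH g1 + sqn dH g2.
Proof. by move=> c; rewrite /sqn /rd (kernel_comb_dot c c) !ReD. Qed.

Lemma dL_small l : (forall l', dL l l' = 0) -> l = 0.
Proof. by move=> h; apply: (dt_ext (d := dL)) => l'; rewrite h dt0l. Qed.

(** The shifts are given on presentations of kernel combinations only, so they are extended as a
    closed relation; density makes it total ([bgr_total]) and the norm identity single valued
    ([bgr_unique]). *)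
Definition graph_closure (P : H -> H -> H -> Prop) f g1 g2 := forall e : R, 0 < e ->
  exists f' g1' g2', [/\ P f' g1' g2', nm dH (f - f') < e,
    nm dH (g1 - g1') < e & nm dH (g2 - g2') < e].

(** The closure of the combinations is complete, so f has a Riesz representative f0 in it; f - f0 is
    orthogonal to every kernel function, hence vanishes at every point. *)
Lemma kernel_comb_dense f (e : R) : 0 < e ->
  exists f' g1' g2', comb f' g1' g2' /\ nm dH (f - f') < e.
Proof.
move=> e0.
pose E := [set f | forall e : R, 0 < e ->
   exists f' g1' g2', comb f' g1' g2' /\ nm dH (f - f') < e].
have sE : lsub E.
  split=> [u u0|a g h Eg Eh u u0].
    by exists 0, 0, 0; split; [apply: KernelComb0|rewrite subr0 nm0].
  have k0 : 0 < normc a + 1 by have := normc_ge0 a; lra.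
  have u2 : 0 < u / 2 by rewrite divr_gt0.
  have [g' [g1 [g2 [cg ng]]]] := Eg _ (divr_gt0 u2 k0).
  have [h' [h1 [h2 [ch nh]]]] := Eh _ u2.
  exists (a *: g' + h'), (a *: g1 + h1), (a *: g2 + h2); split.
    exact: kernel_comb_lin.
  rewrite opprD addrACA -scalerBr; apply: (le_lt_trans (nmD _ _ _)).
  rewrite nmZ; move: ng; rewrite ltr_pdivlMr //.
  have := nm_ge0 dH (g - g'); nra.
have cE : complete_set dH E.
  move=> u Eu cu.
  have [x _ ux] := closed_complete hH closedT (fun _ => I) cu.
  exists x => // r r0; have r2 : 0 < r / 2 by rewrite divr_gt0.
  have [n hn] := ux _ r2; have [f' [g1 [g2 [c nf]]]] := Eu n _ r2.
  exists f', g1, g2; split=> //.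
  have := nm_dist dH (u n) x f'; rewrite (nm_distC _ x (u n)).
  by have := hn n (leqnn n); lra.
have [| |f0 Ef0 h0] := @riesz _ _ dH E sE cE (fun g => dH g f) (nm dH f).
- by move=> a g h _ _; rewrite dtDl dtZl.
- by move=> g _; rewrite mulrC; apply: cauchy_schwarz.
suff -> : f = f0 by apply: Ef0.
apply: ev_inj => y yb; apply/eqP; rewrite -subr_eq0; apply/eqP/dL_small => l.
rewrite -evB // -dH_fker // ip_sym.
have Ek : E (fker y l).
  move=> u u0; exists (1 *: fker y l + 0), (1 * Num.conj (y.1 : K) *: fker y l + 0),
    (1 * Num.conj (y.2 : K) *: fker y l + 0); split.
    by apply: KernelCombS => //; apply: KernelComb0.
  by rewrite scale1r addr0 subrr nm0.
by rewrite dtBr h0 // subrr rmorph0.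
Qed.

Local Notation bgr := (graph_closure comb).

Lemma bgr_lin a f g1 g2 f' g1' g2' : bgr f g1 g2 -> bgr f' g1' g2' ->
  bgr (a *: f + f') (a *: g1 + g1') (a *: g2 + g2').
Proof.
move=> b b' u u0.
have k0 : 0 < normc a + 1 by have := normc_ge0 a; lra.
have u2 : 0 < u / 2 by rewrite divr_gt0.
have [h [h1 [h2 [c n0 n1 n2]]]] := b _ (divr_gt0 u2 k0).
have [h' [h1' [h2' [c' n0' n1' n2']]]] := b' _ u2.
exists (a *: h + h'), (a *: h1 + h1'), (a *: h2 + h2'); split; first exact: kernel_comb_lin.
all: rewrite opprD addrACA -scalerBr; apply: (le_lt_trans (nmD _ _ _)); rewrite nmZ.
- by move: n0; rewrite ltr_pdivlMr //; have := nm_ge0 dH (f - h); nra.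
- by move: n1; rewrite ltr_pdivlMr //; have := nm_ge0 dH (g1 - h1); nra.
- by move: n2; rewrite ltr_pdivlMr //; have := nm_ge0 dH (g2 - h2); nra.
Qed.

(** Pair f with the kernel function at x in the direction l = f(x), whose square norm is k(x, x)
    |l|^2. *)
Lemma nm_ev x : ball x -> exists2 C : R, 0 <= C &
  forall f, nm dL (ev f x) <= C * nm dH f.
Proof.
move=> bx; exists (Num.sqrt (normc (fock_kernel x x))); first exact: sqrtr_ge0.
move=> f; set l := ev f x.
have [->|l0] := eqVneq l 0; first by rewrite nm0 mulr_ge0 ?sqrtr_ge0 ?nm_ge0.
have lp : 0 < nm dL l.
  by rewrite lt_def nm_ge0 andbT; apply: contra l0 => /eqP/nm_eq0->.
have h1 : sqn dL l <= nm dH f * nm dH (fker x l).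
  apply: le_trans (rd_le _ _ _); rewrite /rd dH_fker //.
have h2 : nm dH (fker x l) <= Num.sqrt (normc (fock_kernel x x)) * nm dL l.
  rewrite nm_le ?mulr_ge0 ?sqrtr_ge0 ?nm_ge0 // exprMn sqr_sqrtr ?normc_ge0 // nmsq.
  rewrite /sqn /rd dH_fker // ev_fker // dtZl dtxx mulrC ReZ mulrC ler_wpM2r ?sqn_ge0 //.
  exact: le_trans (ler_norm _) (Re_le_normc _).
rewrite -(ler_pM2r lp) -expr2 nmsq; apply: (le_trans h1).
by rewrite mulrAC mulrC ler_wpM2r ?nm_ge0.
Qed.

Lemma bgr_ev f g1 g2 x : bgr f g1 g2 -> ball x ->
  ev f x = ev f 0 + (x.1 *: ev g1 x + x.2 *: ev g2 x).
Proof.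
move=> b bx; apply/eqP; rewrite -subr_eq0; apply/eqP/(nm_small (d := dL)) => e e0.
have [C C0 hC] := nm_ev bx; have [D D0 hD] := nm_ev ball2_0.
pose k := C + D + normc x.1 * C + normc x.2 * C + 1.
have x10 := normc_ge0 x.1; have x20 := normc_ge0 x.2.
have k0 : 0 < k.
  by rewrite /k; have := mulr_ge0 x10 C0; have := mulr_ge0 x20 C0; lra.
have [f' [g1' [g2' [c n0 n1 n2]]]] := b _ (divr_gt0 e0 k0).
have -> : ev f x - (ev f 0 + (x.1 *: ev g1 x + x.2 *: ev g2 x)) =
   ev (f - f') x - (ev (f - f') 0 + (x.1 *: ev (g1 - g1') x + x.2 *: ev (g2 - g2') x)).
  have c0 := kernel_comb_ev c bx.
  rewrite !evB //; last exact: ball2_0.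
  rewrite c0 !scalerBr; set A := x.1 *: _; set B := x.2 *: _.
  set A' := x.1 *: _; set B' := x.2 *: _.
  have -> : A - A' + (B - B') = A + B - (A' + B') by rewrite opprD addrACA.
  move: (A + B) (A' + B') => U U'.
  have -> : ev f 0 - ev f' 0 + (U - U') = ev f 0 + U - (ev f' 0 + U').
    by rewrite opprD addrACA.
  by rewrite opprB addrA subrK.
apply: (le_trans (nmB _ _ _)).
have t1 := nmD dL (ev (f - f') 0) (x.1 *: ev (g1 - g1') x + x.2 *: ev (g2 - g2') x).
have t2 := nmD dL (x.1 *: ev (g1 - g1') x) (x.2 *: ev (g2 - g2') x).
rewrite !nmZ in t2.
have b1 (M : R) h : 0 <= M -> nm dH h < e / k -> M * nm dH h <= M * (e / k).
  by move=> M0 /ltW h1; rewrite ler_wpM2l.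
have s1 := le_trans (hC (f - f')) (b1 _ _ C0 n0).
have s2 := le_trans (hD (f - f')) (b1 _ _ D0 n0).
have s3 := le_trans (hC (g1 - g1')) (b1 _ _ C0 n1).
have s4 := le_trans (hC (g2 - g2')) (b1 _ _ C0 n2).
have s5 := ler_wpM2l x10 s3; have s6 := ler_wpM2l x20 s4.
have ek : e = k * (e / k) by field; rewrite gt_eqF.
have ek0 : 0 < e / k by rewrite divr_gt0.
by rewrite [X in _ <= X]ek /k; move: (e / k) ek0 s1 s2 s5 s6 t1 t2 => ee; rewrite !mulrA; lra.
Qed.

Lemma sqn_near (V : lmodType K) (d : ip V) (u v : V) (e : R) : e <= 1 ->
  nm d (u - v) < e -> `|sqn d u - sqn d v| <= e * (2 * nm d u + 1).
Proof.
move=> e1 h.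
have -> : sqn d u - sqn d v = 2 * rd d u (u - v) - sqn d (u - v).
  by rewrite rdBr sqnB; rewrite /sqn; ring.
have h1 := rd_le d u (u - v); have h2 := rd_le d (- u) (u - v).
rewrite rdNl nmN in h2; have h3 := nm_ge0 d (u - v); have h4 := nm_ge0 d u.
have h5 : sqn d (u - v) <= e by rewrite -nmsq; move: (nm d (u - v)) h h3 => m; rewrite expr2; nra.
have h6 : nm d u * nm d (u - v) <= nm d u * e by rewrite ler_wpM2l ?(ltW h).
have h7 := sqn_ge0 d (u - v).
by rewrite ler_norml; apply/andP; split; move: h1 h2 h5 h6 h7; lra.
Qed.

Lemma bgr_sqn f g1 g2 : bgr f g1 g2 ->
  sqn dH f = sqn dL (ev f 0) + sqn dH g1 + sqn dH g2.
Proof.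
move=> b; apply/eqP; rewrite -subr_eq0 -normr_eq0 eq_le normr_ge0 andbT.
apply: le_eps => e e0; rewrite add0r.
have [D D0 hD] := nm_ev ball2_0.
pose k := (2 * nm dH f + 1) + (D + 1) * (2 * nm dL (ev f 0) + 1)
   + (2 * nm dH g1 + 1) + (2 * nm dH g2 + 1).
have p1 := nm_ge0 dH f; have p2 := nm_ge0 dL (ev f 0).
have p3 := nm_ge0 dH g1; have p4 := nm_ge0 dH g2.
have k0 : 0 < k by rewrite /k; nra.
pose u := Num.min ((D + 1)^-1) (e / k).
have D1 : 0 < D + 1 by lra.
have u0 : 0 < u by rewrite lt_min invr_gt0 D1 divr_gt0.
have uD : u * (D + 1) <= 1 by rewrite -ler_pdivlMr // mul1r ge_min lexx.
have u1 : u <= 1 by nra.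
have ue : k * u <= e by rewrite mulrC -ler_pdivlMr // ge_min lexx orbT.
have [f' [g1' [g2' [c n0 n1 n2]]]] := b _ u0.
have n3 : nm dL (ev f 0 - ev f' 0) < u * (D + 1).
  rewrite -evB; last exact: ball2_0.
  by apply: (le_lt_trans (hD _)); have := nm_ge0 dH (f - f'); nra.
have := sqn_near u1 n0; have := sqn_near u1 n1; have := sqn_near u1 n2.
have := sqn_near uD n3; have := kernel_comb_sqn c; rewrite !ler_norml.
move: ue; rewrite /k; lra.
Qed.

Lemma bgr_unique f g1 g2 h1 h2 : bgr f g1 g2 -> bgr f h1 h2 -> g1 = h1 /\ g2 = h2.
Proof.
move=> bg bh; have := bgr_sqn (bgr_lin (- 1) bg bh).
rewrite !scaleN1r addNr sqn0 ev0 ?sqn0; last exact: ball2_0.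
have := sqn_ge0 dH (- g1 + h1); have := sqn_ge0 dH (- g2 + h2) => p q r.
have aux (g h : H) : sqn dH (- g + h) = 0 -> g = h.
  by move=> /sqn_eq0/eqP; rewrite addrC subr_eq0 => /eqP.
by split; apply: aux; lra.
Qed.

(** By the norm identity the shifts of a Cauchy sequence of kernel combinations are again Cauchy. *)
Lemma bgr_total f : exists p : H * H, bgr f p.1 p.2.
Proof.
have hc n := kernel_comb_dense f (isucc_gt0 R n).
have [u hu] := choice (fun n => let: ex_intro f' (ex_intro g1 (ex_intro g2 h)) := hc n in
  ex_intro (fun p : H * H * H => comb p.1.1 p.1.2 p.2 /\ nm dH (f - p.1.1) < isucc R n)
   (f', g1, g2) h).
have uf : lims dH (fun n => (u n).1.1) f.
  move=> e e0; have [n0 hn] := isucc_small e0; exists n0 => n /hn.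
  by apply: lt_trans; rewrite nm_distC; case: (hu n).
have dec m n : sqn dH ((u m).1.2 - (u n).1.2) <= sqn dH ((u m).1.1 - (u n).1.1) /\
    sqn dH ((u m).2 - (u n).2) <= sqn dH ((u m).1.1 - (u n).1.1).
  have := kernel_comb_sqn (kernel_comb_lin (- 1) (hu n).1 (hu m).1).
  rewrite !scaleN1r ![- _ + _]addrC => ->.
  have := sqn_ge0 dL (ev ((u m).1.1 - (u n).1.1) 0).
  have := sqn_ge0 dH ((u m).1.2 - (u n).1.2).
  have := sqn_ge0 dH ((u m).2 - (u n).2); lra.
have cf := lims_cauchy uf.
have c1 : cauchy_seq dH (fun n => (u n).1.2).
  move=> e e0; have [n0 hn] := cf e e0; exists n0 => m n hm hn'.
  have := hn m n hm hn'; rewrite !nm_lt ?ltW //; apply: le_lt_trans.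
  by case: (dec m n).
have c2 : cauchy_seq dH (fun n => (u n).2).
  move=> e e0; have [n0 hn] := cf e e0; exists n0 => m n hm hn'.
  have := hn m n hm hn'; rewrite !nm_lt ?ltW //; apply: le_lt_trans.
  by case: (dec m n).
have [g1 _ h1] := closed_complete hH closedT (fun=> I) c1.
have [g2 _ h2] := closed_complete hH closedT (fun=> I) c2.
exists (g1, g2) => e e0 /=.
have [n0 k0] := uf e e0; have [n1 k1] := h1 e e0; have [n2 k2] := h2 e e0.
pose n := maxn n0 (maxn n1 n2).
exists (u n).1.1, (u n).1.2, (u n).2; split; first exact: (hu n).1.
- by rewrite nm_distC; apply: k0; rewrite leq_maxl.
- by rewrite nm_distC; apply: k1; rewrite leq_max leq_maxl orbT.
- by rewrite nm_distC; apply: k2; rewrite !leq_max leqnn !orbT.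
Qed.

Lemma kernel_comb_shift f g1 g2 : comb f g1 g2 ->
  exists h11 h12 h22, comb g1 h11 h12 /\ comb g2 h12 h22.
Proof.
elim=> [|a y l {}f {}g1 {}g2 by' _ [h11 [h12 [h22 [c1 c2]]]]].
  by exists 0, 0, 0; split; apply: KernelComb0.
do 3 eexists; split; first exact: (KernelCombS _ l by' c1).
by rewrite [a * _ * _]mulrAC; apply: (KernelCombS _ l by' c2).
Qed.

(** On kernel combinations both mixed shifts multiply a kernel function at y by the conjugate of y_1
    y_2; contractivity carries this to limits. *)
Lemma bgr_commute f g1 g2 h11 h12 h21 h22 :
  bgr f g1 g2 -> bgr g1 h11 h12 -> bgr g2 h21 h22 -> h12 = h21.
Proof.
move=> b b1 b2; apply/eqP; rewrite -subr_eq0; apply/eqP/(nm_small (d := dH)) => e e0.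
have [f' [g1' [g2' [c n0 n1 n2]]]] := b _ (divr_gt0 e0 (ltr0n R 2)).
have [k11 [k12 [k22 [c1 c2]]]] := kernel_comb_shift c.
have self p q r : comb p q r -> bgr p q r.
  by move=> c' u u0; exists p, q, r; split=> //; rewrite subrr nm0.
have := bgr_sqn (bgr_lin (- 1) (self _ _ _ c1) b1).
have := bgr_sqn (bgr_lin (- 1) (self _ _ _ c2) b2).
rewrite !scaleN1r ![- _ + _]addrC => e2 e1.
have m1 : nm dH (h12 - k12) <= nm dH (g1 - g1').
  rewrite nm_le ?nm_ge0 // nmsq e1.
  have := sqn_ge0 dL (ev (g1 - g1') 0); have := sqn_ge0 dH (h11 - k11); lra.
have m2 : nm dH (h21 - k12) <= nm dH (g2 - g2').
  rewrite nm_le ?nm_ge0 // nmsq e2.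
  have := sqn_ge0 dL (ev (g2 - g2') 0); have := sqn_ge0 dH (h22 - k22); lra.
by have := nm_dist dH k12 h12 h21; rewrite (nm_distC dH k12); lra.
Qed.

(** The backward shifts are adjoint to multiplication. It is stated for an F with the prescribed
    values because H is not known to be stable under multiplication by z and w. *)
Lemma bgr_adj F f g h g1 g2 :
  (forall x, ball x -> ev F x = x.1 *: ev f x + x.2 *: ev g x) ->
  bgr h g1 g2 -> dH F h = dH f g1 + dH g g2.
Proof.
move=> hF b; apply/eqP; rewrite -subr_eq0; apply/eqP/normc_small => e e0.
pose k := nm dH F + nm dH f + nm dH g + 1.
have p1 := nm_ge0 dH F; have p2 := nm_ge0 dH f; have p3 := nm_ge0 dH g.
have k0 : 0 < k by rewrite /k; lra.
have [f' [g1' [g2' [c n0 n1 n2]]]] := b _ (divr_gt0 e0 k0).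
have hc : dH F f' = dH f g1' + dH g g2'.
  elim: {b n0 n1 n2} c => [|a y l {}f' {}g1' {}g2' by' _ IH]; first by rewrite !dt0r addr0.
  rewrite !dtDr !dtZr !dH_fker // hF // dtDl !dtZl IH !rmorphM /= !conjCK; ring.
have -> : dH F h - (dH f g1 + dH g g2) =
    dH F (h - f') - dH f (g1 - g1') - dH g (g2 - g2').
  by rewrite !dtBr hc; ring.
apply: (le_trans (normcB _ _)); have t := normcB (dH F (h - f')) (dH f (g1 - g1')).
have s0 := cauchy_schwarz dH F (h - f'); have s1 := cauchy_schwarz dH f (g1 - g1').
have s2 := cauchy_schwarz dH g (g2 - g2').
have r0 := ler_wpM2l p1 (ltW n0); have r1 := ler_wpM2l p2 (ltW n1).
have r2 := ler_wpM2l p3 (ltW n2).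
have ek : e = k * (e / k) by field; rewrite gt_eqF.
have ek0 : 0 < e / k by rewrite divr_gt0.
by rewrite [leRHS]ek /k; move: (e / k) ek0 r0 r1 r2 s0 s1 s2 t => ee; lra.
Qed.

End Fock.

(** * Taylor coefficients of elements of the Fock space *)

Section Represented.
Variable R : realType.
Local Notation K := R[i].

(** Membership in the scalar space H^2, through Taylor arrays: only the values in the ball
    matter. *)
Definition inP (phi : C2 R -> K) := exists b : nat -> nat -> K,
  abounded b /\ forall x, ball2 x -> sums_to b x (phi x).

End Represented.

Section FockCoefficients.
Variables (R : realType) (L H : completeNormedModType R[i]).
Local Notation K := R[i].
Variables (dotL : {dot L for @Num.conj K}) (dotH : {dot H for @Num.conj K}).
Variables (ev : H -> C2 R -> L).
Hypothesis hH : hilbert_dot dotH.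
Hypothesis fockH : is_fock_space dotL dotH ev.
Local Notation dL := (ip_of_dot dotL).
Local Notation dH := (ip_of_dot dotH).
Local Notation ball := (@ball2 R).
Local Notation bgr := (graph_closure dotH (kernel_comb (fker fockH))).
Implicit Types (f g h : H) (x y : C2 R) (l : L) (a : K).

Lemma Bf_ex : exists B : H -> H * H, forall f, bgr f (B f).1 (B f).2.
Proof. by have [B hB] := choice (bgr_total hH fockH); exists B. Qed.

Definition B1 f := (sval (cid Bf_ex) f).1.
Definition B2 f := (sval (cid Bf_ex) f).2.

Lemma bgrB f : bgr f (B1 f) (B2 f).
Proof. exact: (svalP (cid Bf_ex) f). Qed.

Lemma B_commute f : B2 (B1 f) = B1 (B2 f).
Proof. exact: bgr_commute fockH _ _ _ _ _ _ _ (bgrB f) (bgrB (B1 f)) (bgrB (B2 f)). Qed.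

Lemma B_lin a f g : B1 (a *: f + g) = a *: B1 f + B1 g /\ B2 (a *: f + g) = a *: B2 f + B2 g.
Proof. exact: bgr_unique (bgrB _) (bgr_lin a (bgrB f) (bgrB g)). Qed.

Lemma B_sqn f : sqn dH f = sqn dL (ev f 0) + sqn dH (B1 f) + sqn dH (B2 f).
Proof. exact: bgr_sqn (bgrB f). Qed.

Lemma B_ev f x : ball x -> ev f x = ev f 0 + (x.1 *: ev (B1 f) x + x.2 *: ev (B2 f) x).
Proof. exact: bgr_ev (bgrB f). Qed.

(** The normalised coefficient: the coefficient of z^i w^j divided by ['C(i + j, i)]. *)
Definition cf f i j : L := ev (iter i B1 (iter j B2 f)) 0.

Lemma sh1_cf f : sh1 (cf f) = cf (B1 f).
Proof.
apply/funext => i; apply/funext => j; rewrite /sh1 /cf iterSr; congr (ev (iter i B1 _) 0).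
by elim: j => //= j IHj; rewrite -IHj B_commute.
Qed.

Lemma sh2_cf f : sh2 (cf f) = cf (B2 f).
Proof. by apply/funext => i; apply/funext => j; rewrite /sh2 /cf iterSr. Qed.

Definition SL n f : R := ts (fun i j => sqn dL (cf f i j)) n.

Lemma SLS n f : SL n.+1 f = sqn dL (ev f 0) + SL n (B1 f) + SL n (B2 f).
Proof. by rewrite /SL tsS -sh1_cf -sh2_cf. Qed.

(** By [remn0] and [remnS] this is the sum of the square norms of f under all words of length n in
    the two shifts, hence nonnegative and quadratic in f. *)
Definition remn n f : R := sqn dH f - SL n f.

Lemma remn0 f : remn 0 f = sqn dH f.
Proof. by rewrite /remn /SL ts0 subr0. Qed.

Lemma remnS n f : remn n.+1 f = remn n (B1 f) + remn n (B2 f).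
Proof. by rewrite /remn SLS B_sqn; ring. Qed.

Lemma remn_ge0 n f : 0 <= remn n f.
Proof.
elim: n f => [|n IHn] f; first by rewrite remn0 sqn_ge0.
by rewrite remnS addr_ge0.
Qed.

Lemma remn_le n f : remn n f <= sqn dH f.
Proof. by rewrite gerBl; apply: ts_ge0 => i j; apply: sqn_ge0. Qed.

Lemma SL_le n f : SL n f <= sqn dH f.
Proof. by have := remn_ge0 n f; rewrite subr_ge0. Qed.

Lemma remn_mono m n f : (m <= n)%N -> remn n f <= remn m f.
Proof. by move=> mn; rewrite lerB // ts_mono // => i j; apply: sqn_ge0. Qed.

Lemma remn_lin n a f g : remn n (a *: f + g) <= 2 * (normc a ^+ 2 * remn n f) + 2 * remn n g.
Proof.
elim: n f g => [|n IHn] f g; first by rewrite !remn0 (le_trans (sqnD_le _ _ _)) // sqnZ.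
rewrite !remnS (B_lin a f g).1 (B_lin a f g).2.
by have := IHn (B1 f) (B1 g); have := IHn (B2 f) (B2 g); lra.
Qed.

Lemma remn_ker n y l : ball y -> remn n (fker fockH y l) = rho y ^+ n * sqn dH (fker fockH y l).
Proof.
move=> by'; have hB : bgr (fker fockH y l) (Num.conj (y.1 : K) *: fker fockH y l)
    (Num.conj (y.2 : K) *: fker fockH y l).
  move=> e e0; exists (1 *: fker fockH y l + 0),
    (1 * Num.conj (y.1 : K) *: fker fockH y l + 0),
    (1 * Num.conj (y.2 : K) *: fker fockH y l + 0).
  split; first by apply: KernelCombS => //; apply: KernelComb0.
  - by rewrite scale1r addr0 subrr nm0.
  - by rewrite mul1r addr0 subrr nm0.
  - by rewrite mul1r addr0 subrr nm0.
have [h1 h2] := bgr_unique (bgrB _) hB.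
have hZ (a : K) m f : remn m (a *: f) = normc a ^+ 2 * remn m f.
  elim: m f => [|m IHm] f; first by rewrite !remn0 sqnZ.
  have [e1 e2] := B_lin a f 0.
  have B10 : B1 0 = 0 /\ B2 0 = 0.
    by have [] := B_lin (- 1) 0 0; rewrite !scaler0 !addr0 !scaleN1r !addNr.
  rewrite !remnS -[a *: f]addr0 e1 e2 B10.1 B10.2 !addr0 !IHm; ring.
elim: n => [|n IHn]; first by rewrite remn0 mul1r.
by rewrite remnS h1 h2 !hZ IHn !normc_conj [rho y ^+ n.+1]exprS ; move: (rho y ^+ n) => r; rewrite /rho; ring.
Qed.

(** Parseval's identity for the coefficients. On a kernel function at y the remainder is a multiple
    of rho(y)^n; density and the quadratic bound [remn_lin] do the rest. *)
Lemma remn_small f (e : R) : 0 < e -> exists n, remn n f <= e.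
Proof.
move=> e0; pose e4 := Num.min 1 (e / 4).
have e40 : 0 < e4 by rewrite lt_min ltr01 divr_gt0.
have [f' [g1 [g2 [c nf]]]] := kernel_comb_dense hH fockH f e40.
have [n hn] : exists n, remn n f' <= e / 4.
  have : 0 < e / 4 by rewrite divr_gt0.
  move: (e / 4); elim: {nf} c => [|a y l {}f' {}g1 {}g2 by' _ IH] u u0.
    by exists 0%N; rewrite remn0 sqn0 ltW.
  have [n1 h1] := IH _ (divr_gt0 u0 (ltr0n R 4)).
  have k0 : 0 < 4 * (normc a ^+ 2 * sqn dH (fker fockH y l)) + 1.
    by have := mulr_ge0 (sqr_ge0 (normc a)) (sqn_ge0 dH (fker fockH y l)); lra.
  have rb : 0 <= rho y < 1 by rewrite rho_ge0 /=; apply/ball_rho.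
  have [n2 h2] := geom_small rb (divr_gt0 u0 k0).
  exists (maxn n1 n2); apply: (le_trans (remn_lin _ _ _ _)).
  have := remn_mono f' (leq_maxl n1 n2); have := h2 _ (leq_maxr n1 n2).
  rewrite remn_ker // ltr_pdivlMr //.
  have := exprn_ge0 (maxn n1 n2) (rho_ge0 y).
  by move: (rho y ^+ _) (normc a ^+ 2) (sqn _ _) h1 => r A S; nra.
exists n; have -> : f = 1 *: (f - f') + f' by rewrite scale1r subrK.
apply: (le_trans (remn_lin _ _ _ _)); rewrite normc1 expr1n mul1r.
have := remn_le n (f - f'); rewrite -nmsq.
have h1 : nm dH (f - f') ^+ 2 <= e / 4.
  move: nf; rewrite lt_min => /andP[m1 m2]; have := nm_ge0 dH (f - f').
  by move: (nm _ _) m1 m2 => m; rewrite expr2; nra.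
lra.
Qed.

Definition cfl l f i j : K := dL (cf f i j) l.

Lemma asq_cfl n l f : asq n (cfl l f) <= sqn dL l * sqn dH f.
Proof.
apply: (@le_trans _ _ (sqn dL l * SL n f)).
  rewrite /asq /SL -tsZ; apply: ts_le => i j.
  by rewrite mulrC cauchy_schwarz2.
by rewrite ler_wpM2l ?sqn_ge0 ?SL_le.
Qed.

Lemma cfl_bounded l f : abounded (cfl l f).
Proof. by exists (sqn dL l * sqn dH f) => n; apply: asq_cfl. Qed.

(** The error after n degrees obeys the recursion of the value without its constant term, so its
    square is O(rho(x)^n). *)
Lemma cfl_sums l f x : ball x -> sums_to (cfl l f) x (dL (ev f x) l).
Proof.
move=> bx; have [C C0 hC] := nm_ev fockH bx.
pose D n h := dL (ev h x) l - aev n (cfl l h) x.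
have DS n h : D n.+1 h = x.1 * D n (B1 h) + x.2 * D n (B2 h).
  rewrite /D aevS.
  have -> : sh1 (cfl l h) = cfl l (B1 h) by rewrite /cfl -sh1_cf.
  have -> : sh2 (cfl l h) = cfl l (B2 h) by rewrite /cfl -sh2_cf.
  by rewrite (B_ev _ bx) !dtDl !dtZl /cfl /cf /=; ring.
have r0 := rho_ge0 x; have /ball_rho r1 := bx.
have Db n h : normc (D n h) ^+ 2 <= rho x ^+ n * ((nm dL l * C) ^+ 2 * sqn dH h).
  elim: n h => [|n IHn] h.
    rewrite /D /aev ts0 subr0 mul1r -nmsq -exprMn.
    rewrite ler_pXn2r ?nnegrE ?normc_ge0 ?mulr_ge0 ?nm_ge0 //.
    apply: (le_trans (cauchy_schwarz _ _ _)); rewrite mulrC -mulrA ler_wpM2l ?nm_ge0 //.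
  rewrite DS; apply: (le_trans (row_cauchy_schwarz _ _ _)).
  rewrite [rho x ^+ n.+1]exprS -[leRHS]mulrA ler_wpM2l //.
  apply: (le_trans (lerD (IHn _) (IHn _))); rewrite -!mulrDr ler_wpM2l ?exprn_ge0 //.
  rewrite ler_wpM2l ?sqr_ge0 // [leRHS]B_sqn -addrA lerDr sqn_ge0 //.
move=> e e0; pose M := (nm dL l * C) ^+ 2 * sqn dH f + 1.
have M0 : 0 < M by rewrite ltr_wpDl // mulr_ge0 ?sqr_ge0 ?sqn_ge0.
have rb : 0 <= rho x < 1 by rewrite r0.
have [n0 hn] := geom_small rb (divr_gt0 (exprn_gt0 2 e0) M0).
exists n0 => n /hn; rewrite ltr_pdivlMr // => h.
rewrite normc_distC -(@ltr_pXn2r _ 2) ?nnegrE ?normc_ge0 ?(ltW e0) //.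
apply: (le_lt_trans (Db n f)); apply: le_lt_trans h.
by rewrite ler_wpM2l ?exprn_ge0 // lerDl.
Qed.

Lemma ev_inP f l : inP (fun x => dL (ev f x) l).
Proof. by exists (cfl l f); split=> [|x]; [apply: cfl_bounded|apply: cfl_sums]. Qed.

Lemma array_eq (p q : nat -> nat -> K) (phi : C2 R -> K) :
  abounded p -> abounded q -> (forall x, ball x -> sums_to p x (phi x)) ->
  (forall x, ball x -> sums_to q x (phi x)) -> forall i j, p i j = q i j.
Proof.
move=> bp bq sp sq i j; apply/eqP; rewrite -subr_eq0 -mulN1r; apply/eqP.
apply: (@array_unique _ (arr_add p (arr_scl (- 1) q))).
  exact: abounded_add bp (abounded_scl _ bq).
exists 2^-1 => [|x x1 x2]; first by rewrite invr_gt0.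
have bx : ball x.
  apply/ball_rho; rewrite /rho.
  have h0 := normc_ge0 x.1; have h1 := normc_ge0 x.2.
  by move: (normc x.1) (normc x.2) x1 x2 h0 h1 => a d; rewrite !expr2; nra.
have -> : 0 = phi x + (- 1) * phi x by ring.
by apply: sums_add; [apply: sp|apply/sums_scl/sq].
Qed.

Lemma cf_mulz (u p : H) : (forall x, ball x -> ev p x = x.1 *: ev u x) ->
  forall l, cfl l p = mz (cfl l u).
Proof.
move=> h l; apply/funext => i; apply/funext => j.
apply: (array_eq (cfl_bounded _ _) (abounded_mz (cfl_bounded _ _)) (phi := fun x => x.1 * dL (ev u x) l)).
  by move=> x bx; rewrite -dtZl -h //; apply: cfl_sums.
by move=> x bx; apply/sums_mz/cfl_sums.
Qed.

Lemma cf_mulw (u p : H) : (forall x, ball x -> ev p x = x.2 *: ev u x) ->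
  forall l, cfl l p = mw (cfl l u).
Proof.
move=> h l; apply/funext => i; apply/funext => j.
apply: (array_eq (cfl_bounded _ _) (abounded_mw (cfl_bounded _ _)) (phi := fun x => x.2 * dL (ev u x) l)).
  by move=> x bx; rewrite -dtZl -h //; apply: cfl_sums.
by move=> x bx; apply/sums_mw/cfl_sums.
Qed.

Lemma normc_ratio m n : normc (m%:R / n%:R : K) = m%:R / n%:R :> R.
Proof. by rewrite normcM normcV !normc_nat. Qed.

(** On coefficients zu and wu carry the weights (i + 1) / (i + j + 1) and (j + 1) / (i + j + 1),
    with sum at least 1. This gives H_2 = 0 and bounds the boundary map from below. *)
Lemma mul_col_bound (u p q : H) : (forall x, ball x -> ev p x = x.1 *: ev u x) ->
  (forall x, ball x -> ev q x = x.2 *: ev u x) -> sqn dH u <= sqn dH p + sqn dH q.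
Proof.
move=> hp hq.
have cp i j : sqn dL (cf p i j) =
    if i is i'.+1 then (i%:R / (i + j)%:R) ^+ 2 * sqn dL (cf u i' j) else 0.
  case: i => [|i].
    rewrite (_ : cf p 0 j = 0) ?sqn0 //; apply: (dt_ext (d := dL)) => l.
    by rewrite dt0l; have := congr1 (fun F => F 0%N j) (cf_mulz hp l).
  rewrite -normc_ratio -sqnZ; congr sqn; apply: (dt_ext (d := dL)) => l.
  by rewrite dtZl; have := congr1 (fun F => F i.+1 j) (cf_mulz hp l).
have cq i j : sqn dL (cf q i j) =
    if j is j'.+1 then (j%:R / (i + j)%:R) ^+ 2 * sqn dL (cf u i j') else 0.
  case: j => [|j].
    rewrite (_ : cf q i 0 = 0) ?sqn0 //; apply: (dt_ext (d := dL)) => l.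
    by rewrite dt0l; have := congr1 (fun F => F i 0%N) (cf_mulw hq l); case: (i).
  rewrite -normc_ratio -sqnZ; congr sqn; apply: (dt_ext (d := dL)) => l.
  by rewrite dtZl; have := congr1 (fun F => F i j.+1) (cf_mulw hq l).
have SLpq n : SL n u <= SL n.+1 p + SL n.+1 q.
  rewrite /SL /ts ![\sum_(k < n.+1) _]big_ord_recl !dg0 cp cq !add0r -big_split /=.
  apply: ler_sum => k _.
  have -> : dg (fun i j => sqn dL (cf p i j)) k.+1 =
     dg (fun i j => i.+1%:R / (i + j).+1%:R * sqn dL (cf u i j)) k.
    by rewrite -dg_mz; apply: eq_dg => i j _; apply: cp.
  have -> : dg (fun i j => sqn dL (cf q i j)) k.+1 =
     dg (fun i j => j.+1%:R / (i + j).+1%:R * sqn dL (cf u i j)) k.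
    by rewrite -dg_mw; apply: eq_dg => i j _; apply: cq.
  rewrite /dg -big_split; apply: ler_sum => i _ /=.
  rewrite -mulrnDl lerMn2r; apply/orP; right.
  rewrite -mulrDl -mulrDl -natrD ler_peMl ?sqn_ge0 //.
  by rewrite ler_pdivlMr ?ltr0n // mul1r ler_nat addSn ltnS addnS ltnW.
apply: le_eps => e e0; have [n hn] := remn_small u e0.
have := SLpq n; have := SL_le n.+1 p; have := SL_le n.+1 q.
by move: hn; rewrite /remn; lra.
Qed.

(** Dual to the contractivity of the column of shifts: |F|^2 = Re (<f, B1 F> + <g, B2 F>), and |B1
    F|^2 + |B2 F|^2 <= |F|^2. *)
Lemma mul_row_bound (F f g : H) :
  (forall x, ball x -> ev F x = x.1 *: ev f x + x.2 *: ev g x) ->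
  sqn dH F <= sqn dH f + sqn dH g.
Proof.
move=> hF; have := bgr_adj hF (bgrB F); rewrite dtxx => /(congr1 (@complex.Re R)).
rewrite ReD /= => e.
have h1 := sqn_ge0 dH (f - B1 F); have h2 := sqn_ge0 dH (g - B2 F).
rewrite !sqnB in h1 h2; have := B_sqn F; have := sqn_ge0 dL (ev F 0).
by move: e h1 h2; rewrite /rd; lra.
Qed.

End FockCoefficients.

(** * Row contractions *)

Section RealInequalities.
Variable R : realType.
Implicit Types (p r u : R).

(** Cauchy-Schwarz in R^2 for vectors given by their squared entries, so that estimates of separate
    terms can be added. *)
Lemma sq_add_le_mul p1 p2 r1 r2 u1 u2 : 0 <= p1 -> 0 <= p2 -> 0 <= r1 -> 0 <= r2 ->
  0 <= u1 -> 0 <= u2 -> u1 ^+ 2 <= p1 * r1 -> u2 ^+ 2 <= p2 * r2 ->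
  (u1 + u2) ^+ 2 <= (p1 + p2) * (r1 + r2).
Proof.
move=> p10 p20 r10 r20 u10 u20 h1 h2.
have h3 : (u1 * u2) ^+ 2 <= (p1 * r1) * (p2 * r2).
  by rewrite exprMn ler_pM ?sqr_ge0.
have h4 : (2 * (u1 * u2)) ^+ 2 <= (p1 * r2 + p2 * r1) ^+ 2.
  have := sqr_ge0 (p1 * r2 - p2 * r1); move: h3; rewrite !expr2; lra.
have h5 : 2 * (u1 * u2) <= p1 * r2 + p2 * r1.
  rewrite -(@ler_pXn2r _ 2) // nnegrE ?mulr_ge0 // ?addr_ge0 ?mulr_ge0 //.
by rewrite sqrrD mulrDl !mulrDr; move: h1 h2 h5; lra.
Qed.

Lemma bounded_mono_cauchy (s : nat -> R) (B : R) :
  {homo s : m n / (m <= n)%N >-> m <= n} -> (forall n, s n <= B) ->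
  forall e : R, 0 < e -> exists n0, forall n, s n - s n0 < e.
Proof.
move=> sm sB e e0; pose S := [set s n | n in [set: nat]].
have hs : has_sup S by split; [exists (s 0%N); exists 0%N|exists B => _ [n _ <-]].
have [_ [n0 _ <-] h] := sup_adherent e0 hs.
exists n0 => n; have : s n <= sup S by apply: sup_upper_bound => //; exists n.
by move: h; lra.
Qed.

End RealInequalities.

Section RowContraction.
Variables (R : realType) (V : lmodType R[i]) (d : ip V).
Local Notation K := R[i].
Variables (E : set V) (sE : lsub E) (cE : complete_set d E).
Variables (Z W : V -> V).
Hypotheses (EZ : forall x, E x -> E (Z x)) (EW : forall x, E x -> E (W x)).
Hypotheses
  (linZ : forall a x y, E x -> E y -> Z (a *: x + y) = a *: Z x + Z y)
  (linW : forall a x y, E x -> E y -> W (a *: x + y) = a *: W x + W y)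
  (rowc : forall f g, E f -> E g -> sqn d (Z f + W g) <= sqn d f + sqn d g).
Implicit Types (x y h m v : V) (a : K) (b : nat -> nat -> K).

Lemma Z0 : Z 0 = 0.
Proof. by have := linZ (- 1) (sub0 sE) (sub0 sE); rewrite scaler0 addr0 scaleN1r addNr. Qed.

Lemma W0 : W 0 = 0.
Proof. by have := linW (- 1) (sub0 sE) (sub0 sE); rewrite scaler0 addr0 scaleN1r addNr. Qed.

Lemma ZZ a x : E x -> Z (a *: x) = a *: Z x.
Proof. by move=> Ex; have := linZ a Ex (sub0 sE); rewrite Z0 !addr0. Qed.

Lemma WZ a x : E x -> W (a *: x) = a *: W x.
Proof. by move=> Ex; have := linW a Ex (sub0 sE); rewrite W0 !addr0. Qed.

Lemma ZD x y : E x -> E y -> Z (x + y) = Z x + Z y.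
Proof. by move=> Ex Ey; have := linZ 1 Ex Ey; rewrite !scale1r. Qed.

Lemma WD x y : E x -> E y -> W (x + y) = W x + W y.
Proof. by move=> Ex Ey; have := linW 1 Ex Ey; rewrite !scale1r. Qed.

Lemma ZB x y : E x -> E y -> Z (x - y) = Z x - Z y.
Proof. by move=> Ex Ey; rewrite addrC -scaleN1r linZ // scaleN1r addrC. Qed.

Lemma WB x y : E x -> E y -> W (x - y) = W x - W y.
Proof. by move=> Ex Ey; rewrite addrC -scaleN1r linW // scaleN1r addrC. Qed.

Lemma nmZ_le x : E x -> nm d (Z x) <= nm d x.
Proof.
move=> Ex; rewrite nm_le ?nm_ge0 // nmsq; have := rowc Ex (sub0 sE).
by rewrite W0 sqn0 !addr0.
Qed.

Lemma nmW_le x : E x -> nm d (W x) <= nm d x.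
Proof.
move=> Ex; rewrite nm_le ?nm_ge0 // nmsq; have := rowc (sub0 sE) Ex.
by rewrite Z0 sqn0 !add0r.
Qed.

Lemma Zadj_ex : exists A : V -> V, forall h, E (A h) /\
  forall f, E f -> d (Z f) h = d f (A h).
Proof.
suff /choice[A hA] : forall h, exists y, E y /\ forall f, E f -> d (Z f) h = d f y.
  by exists A.
move=> h; have [| |b Eb hb] := @riesz _ _ d E sE cE (fun f => d (Z f) h) (nm d h).
- by move=> a x y Ex Ey; rewrite linZ // dtDl dtZl.
- move=> x Ex; apply: (le_trans (cauchy_schwarz _ _ _)); rewrite mulrC.
  by rewrite ler_wpM2l ?nm_ge0 ?nmZ_le.
by exists b.
Qed.

Lemma Wadj_ex : exists A : V -> V, forall h, E (A h) /\
  forall f, E f -> d (W f) h = d f (A h).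
Proof.
suff /choice[A hA] : forall h, exists y, E y /\ forall f, E f -> d (W f) h = d f y.
  by exists A.
move=> h; have [| |b Eb hb] := @riesz _ _ d E sE cE (fun f => d (W f) h) (nm d h).
- by move=> a x y Ex Ey; rewrite linW // dtDl dtZl.
- move=> x Ex; apply: (le_trans (cauchy_schwarz _ _ _)); rewrite mulrC.
  by rewrite ler_wpM2l ?nm_ge0 ?nmW_le.
by exists b.
Qed.

Definition Zadj := sval (cid Zadj_ex).
Definition Wadj := sval (cid Wadj_ex).

Lemma E_Zadj h : E (Zadj h). Proof. exact: (svalP (cid Zadj_ex) h).1. Qed.
Lemma E_Wadj h : E (Wadj h). Proof. exact: (svalP (cid Wadj_ex) h).1. Qed.

Lemma ZadjP f h : E f -> d (Z f) h = d f (Zadj h).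
Proof. exact: (svalP (cid Zadj_ex) h).2. Qed.

Lemma WadjP f h : E f -> d (W f) h = d f (Wadj h).
Proof. exact: (svalP (cid Wadj_ex) h).2. Qed.

Lemma E_ext x y : E x -> E y -> (forall f, E f -> d f x = d f y) -> x = y.
Proof.
move=> Ex Ey h; apply/eqP; rewrite -subr_eq0; apply/eqP/(sqn_eq0 (d := d)).
by rewrite /sqn /rd dtBr h ?subrr //; apply: subB.
Qed.

Lemma Zadj_lin a x y : Zadj (a *: x + y) = a *: Zadj x + Zadj y.
Proof.
apply: E_ext; [exact: E_Zadj| |].
  by apply: subD; [|apply: subZ|]; rewrite ?sE //; apply: E_Zadj.
by move=> f Ef; rewrite -ZadjP // !(dtDr, dtZr) !ZadjP.
Qed.

Lemma Wadj_lin a x y : Wadj (a *: x + y) = a *: Wadj x + Wadj y.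
Proof.
apply: E_ext; [exact: E_Wadj| |].
  by apply: subD; [|apply: subZ|]; rewrite ?sE //; apply: E_Wadj.
by move=> f Ef; rewrite -WadjP // !(dtDr, dtZr) !WadjP.
Qed.

Lemma ZadjB x y : Zadj (x - y) = Zadj x - Zadj y.
Proof. by rewrite addrC -scaleN1r Zadj_lin scaleN1r addrC. Qed.

Lemma WadjB x y : Wadj (x - y) = Wadj x - Wadj y.
Proof. by rewrite addrC -scaleN1r Wadj_lin scaleN1r addrC. Qed.

(** Expand |Z Zadj h + W Wadj h - h|^2 >= 0 and use the row bound. It says that the defect operator
    is nonnegative. *)
Lemma adj_bound h : sqn d (Zadj h) + sqn d (Wadj h) <= sqn d h.
Proof.
have := rowc (E_Zadj h) (E_Wadj h); have := sqn_ge0 d (Z (Zadj h) + W (Wadj h) - h).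
rewrite sqnB [rd _ _ h]/rd dtDl ZadjP ?WadjP ?dtxx; try exact: E_Zadj; try exact: E_Wadj.
by rewrite ReD /=; lra.
Qed.

Lemma Zadj_nm h : nm d (Zadj h) <= nm d h.
Proof.
by rewrite nm_le ?nm_ge0 // nmsq; have := adj_bound h; have := sqn_ge0 d (Wadj h); lra.
Qed.

Lemma Wadj_nm h : nm d (Wadj h) <= nm d h.
Proof.
by rewrite nm_le ?nm_ge0 // nmsq; have := adj_bound h; have := sqn_ge0 d (Zadj h); lra.
Qed.

Definition defect h := h - Z (Zadj h) - W (Wadj h).

Lemma E_defect h : E h -> E (defect h).
Proof.
by move=> Eh; do 2?apply: subB => //; [apply/EZ/E_Zadj|apply/EW/E_Wadj].
Qed.

Lemma defect_dot x y : d (defect x) y =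
  d x y - d (Zadj x) (Zadj y) - d (Wadj x) (Wadj y).
Proof. by rewrite !dtBl ZadjP ?WadjP //; [apply: E_Wadj|apply: E_Zadj]. Qed.

Definition dfq x : R := sqn d x - sqn d (Zadj x) - sqn d (Wadj x).

Lemma dfq_ge0 x : 0 <= dfq x.
Proof. by have := adj_bound x; rewrite /dfq; lra. Qed.

(** The form [d (defect x) y] is only semidefinite, with [dfq] as its quadratic form; [key] is its
    positivity at x - t q y. *)
Lemma defect_cauchy_schwarz x y : normc (d (defect x) y) ^+ 2 <= dfq x * dfq y.
Proof.
set q := d (defect x) y.
have key (t : R) : 0 <= dfq x - 2 * t * normc q ^+ 2 + t ^+ 2 * normc q ^+ 2 * dfq y.
  pose c := t%:C * q.
  have nc : normc (- c) ^+ 2 = t ^+ 2 * normc q ^+ 2.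
    by rewrite normcN normcM normcC exprMn real_normK ?num_real.
  have := dfq_ge0 (- c *: y + x).
  suff -> : dfq (- c *: y + x) =
      dfq x - 2 * t * normc q ^+ 2 + t ^+ 2 * normc q ^+ 2 * dfq y by [].
  have e1 : complex.Re (Num.conj (- c) * q) = - (t * normc q ^+ 2).
    have -> : Num.conj (- c) = - (t%:C * Num.conj q).
      by rewrite rmorphN /c rmorphM; congr (- (_ * _)); apply: conjc_real.
    by rewrite mulNr ReN -mulrA ReZ [_ * q]mulrC mul_conj.
  rewrite /dfq Zadj_lin Wadj_lin !sqnD !sqnZ nc.
  rewrite !(rdC d (- c *: _)) /rd !dtZr.
  have : complex.Re (Num.conj (- c) * d x y) - complex.Re (Num.conj (- c) * d (Zadj x) (Zadj y))
     - complex.Re (Num.conj (- c) * d (Wadj x) (Wadj y)) = - (t * normc q ^+ 2).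
    by rewrite -e1 /q defect_dot !mulrBr !ReB.
  by move=> e2; rewrite !mulrA; lra.
have q0 := normc_ge0 q.
have [y0|y0] := eqVneq (dfq y) 0.
  suff -> : normc q = 0 by rewrite expr0n mulr_ge0 ?dfq_ge0.
  apply/eqP; rewrite eq_le q0 andbT leNgt; apply/negP => qp.
  (* For isotropic y the bound is affine in t, and this t makes it negative. *)
  have := key ((dfq x + 1) / (normc q ^+ 2)); rewrite y0 mulr0 addr0.
  rewrite mulrA divfK ?expf_neq0 ?gt_eqF //; have := dfq_ge0 x; lra.
have yp : 0 < dfq y by rewrite lt_def y0 dfq_ge0.
have := key (dfq y)^-1.
have -> : dfq x - 2 * (dfq y)^-1 * normc q ^+ 2 + (dfq y)^-1 ^+ 2 * normc q ^+ 2 * dfq y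
   = (dfq x * dfq y - normc q ^+ 2) / dfq y by field.
by rewrite pmulr_lge0 ?invr_gt0 // subr_ge0.
Qed.

(** The truncation of the series b applied to v. The recursion suits induction through adjoints; for
    commuting [Z] and [W] the words collapse to the binomial sum of [epolE]. *)
Fixpoint epol n b v := if n is n'.+1 then
  b 0%N 0%N *: v + Z (epol n' (sh1 b) v) + W (epol n' (sh2 b) v) else 0.

Lemma E_epol n b v : E v -> E (epol n b v).
Proof.
move=> Ev; elim: n b => [|n IHn] b /=; first exact: sub0.
by do 2?apply: subD => //; [apply: subZ|apply: EZ|apply: EW].
Qed.

(** v is a multiplier: phi |-> phi v is bounded from scalar polynomials, hence from the scalar Fock
    space, into E. *)
Definition is_mult v (C : R) := E v /\ forall n b, sqn d (epol n b v) <= C * asq n b.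

(* The Cauchy-Schwarz inequality for the nonnegative form of the defect operator
   1 - Z Z^* - W W^* bounds the action of power series on its range. *)
Lemma defect_is_mult m : E m -> is_mult (defect m) (dfq m).
Proof.
move=> Em; split=> [|n b]; first exact: E_defect.
set v := defect m; have Ev : E v by apply: E_defect.
(* Tested against y, the operators move to y as adjoints; the three terms of the recursion are paid
   by [dfq y], |Zadj y|^2 and |Wadj y|^2, whose sum is exactly |y|^2. *)
have key y : E y -> normc (d (epol n b v) y) ^+ 2 <= dfq m * asq n b * sqn d y.
  elim: n b y => [|n IHn] b y Ey /=; first by rewrite dt0l normc0 expr0n !mulr_ge0 ?dfq_ge0 ?asq_ge0 ?sqn_ge0.
  rewrite !dtDl dtZl ZadjP ?WadjP; try exact: E_epol.
  set u0 := b _ _ * _; set u1 := d (epol n (sh1 b) v) _; set u2 := d (epol n (sh2 b) v) _.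
  have h0 : normc u0 ^+ 2 <= dfq m * normc (b 0%N 0%N) ^+ 2 * dfq y.
    rewrite [X in X * dfq y]mulrC -mulrA normcM exprMn.
    by apply: ler_wpM2l; [apply: sqr_ge0|apply: defect_cauchy_schwarz].
  have h1 : normc u1 ^+ 2 <= _ := IHn (sh1 b) _ (E_Zadj y).
  have h2 : normc u2 ^+ 2 <= _ := IHn (sh2 b) _ (E_Wadj y).
  have dm := dfq_ge0 m; have dy := dfq_ge0 y.
  have s1 := asq_ge0 n (sh1 b); have s2 := asq_ge0 n (sh2 b).
  have q1 := sqn_ge0 d (Zadj y); have q2 := sqn_ge0 d (Wadj y).
  have c0 := sqr_ge0 (normc (b 0%N 0%N)).
  have h12 := sq_add_le_mul (mulr_ge0 dm c0) (mulr_ge0 dm s1) dy q1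
    (normc_ge0 u0) (normc_ge0 u1) h0 h1.
  have h3 := sq_add_le_mul (addr_ge0 (mulr_ge0 dm c0) (mulr_ge0 dm s1)) (mulr_ge0 dm s2)
     (addr_ge0 dy q1) q2 (addr_ge0 (normc_ge0 u0) (normc_ge0 u1)) (normc_ge0 u2) h12 h2.
  have -> : sqn d y = dfq y + sqn d (Zadj y) + sqn d (Wadj y) by rewrite /dfq; ring.
  have -> : dfq m * asq n.+1 b = dfq m * normc (b 0%N 0%N) ^+ 2 +
    dfq m * asq n (sh1 b) + dfq m * asq n (sh2 b) by rewrite asqS !mulrDr.
  apply: le_trans h3.
  rewrite ler_pXn2r ?nnegrE ?normc_ge0 ?addr_ge0 ?normc_ge0 //.
  apply: (le_trans (le_normcD _ _)); rewrite lerD2r; exact: le_normcD.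
have [e0|e0] := eqVneq (sqn d (epol n b v)) 0.
  by rewrite e0 mulr_ge0 ?dfq_ge0 ?asq_ge0.
have ep : 0 < sqn d (epol n b v) by rewrite lt_def e0 sqn_ge0.
have := key _ (E_epol n b Ev); rewrite dtxx normcC ger0_norm ?sqn_ge0 //.
by rewrite expr2 ler_pM2r.
Qed.

Lemma epol_add n p q v : E v -> epol n (arr_add p q) v = epol n p v + epol n q v.
Proof.
move=> Ev; elim: n p q => [|n IHn] p q /=; first by rewrite addr0.
rewrite (IHn (sh1 p) (sh1 q)) (IHn (sh2 p) (sh2 q)) ZD ?WD; try exact: E_epol.
by rewrite scalerDl [RHS]addrACA; congr (_ + _); rewrite [RHS]addrACA.
Qed.

Lemma epol_scl n c p v : E v -> epol n (arr_scl c p) v = c *: epol n p v.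
Proof.
move=> Ev; elim: n p => [|n IHn] p /=; first by rewrite scaler0.
rewrite (IHn (sh1 p)) (IHn (sh2 p)) ZZ ?WZ; try exact: E_epol.
by rewrite !scalerDr scalerA.
Qed.

Lemma epol_tail (m n : nat) b v : E v ->
  epol (m + n) b v = epol m b v + epol (m + n) (tail m b) v.
Proof.
move=> Ev; elim: m b => [|m IHm] b.
  by rewrite add0r; congr epol; apply/funext => i; apply/funext => j.
have -> : epol (m.+1 + n) (tail m.+1 b) v =
   Z (epol (m + n) (tail m (sh1 b)) v) + W (epol (m + n) (tail m (sh2 b)) v).
  rewrite /= scale0r add0r; congr (Z (epol _ _ _) + W (epol _ _ _)).
  by apply/funext => i; apply/funext => j; rewrite /sh2 /tail addnS ltnS.
rewrite /= (IHm (sh1 b)) (IHm (sh2 b)) ZD ?WD; try exact: E_epol.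
by rewrite [RHS]addrACA; congr (_ + _); rewrite addrA.
Qed.

Definition acts b v F := E F /\ lims d (fun n => epol n b v) F.

(** The multiplier bound applied to tails of b turns convergence of [asq n b] into the Cauchy
    property. *)
Lemma acts_ex b v C : is_mult v C -> abounded b -> exists F, acts b v F.
Proof.
move=> [Ev mv] [B hB].
suff cu : cauchy_seq d (fun n => epol n b v).
  by have [F EF hF] := cE (fun n => E_epol n b Ev) cu; exists F.
have C0 : 0 <= `|C| + 1 by rewrite addr_ge0.
have Cp : 0 < `|C| + 1 by rewrite ltr_wpDl.
have key (m n : nat) : sqn d (epol (m + n) b v - epol m b v) <= (`|C| + 1) * (asq (m + n) b - asq m b).
  rewrite epol_tail // addrC addKr; apply: (le_trans (mv _ _)); rewrite asq_tail.
  rewrite ler_wpM2r ?subr_ge0 ?asq_mono ?leq_addr //.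
  by rewrite (le_trans (ler_norm C)) // lerDl.
move=> e e0; have e2 : 0 < (e / 2) ^+ 2 / (`|C| + 1) by rewrite !divr_gt0 ?exprn_gt0 ?divr_gt0.
have [n0 hn] := bounded_mono_cauchy (fun p n => @asq_mono _ p n b) hB e2.
have cl n : (n0 <= n)%N -> nm d (epol n b v - epol n0 b v) < e / 2.
  move=> /subnKC <-; rewrite nm_lt ?divr_ge0 ?(ltW e0) //; apply: (le_lt_trans (key _ _)).
  by rewrite mulrC -ltr_pdivlMr.
exists n0 => p n /cl h1 /cl h2.
by have := nm_dist d (epol n0 b v) (epol p b v) (epol n b v);
  rewrite (nm_distC d (epol n0 b v)); lra.
Qed.

Lemma acts_unique b v F G : acts b v F -> acts b v G -> F = G.
Proof. by move=> [_ h1] [_ h2]; apply: lims_unique h1 h2. Qed.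

Lemma acts_bound b v C B F : is_mult v C -> 0 <= C -> (forall n, asq n b <= B) ->
  acts b v F -> sqn d F <= C * B.
Proof.
move=> [Ev mv] C0 hB [EF hF].
have B0 : 0 <= B by apply: le_trans (hB 0%N); apply: asq_ge0.
have CB : 0 <= C * B by rewrite mulr_ge0.
rewrite -(sqr_sqrtr CB) -nm_le ?sqrtr_ge0 //; apply: lims_nm_le hF _ => n.
rewrite nm_le ?sqrtr_ge0 // sqr_sqrtr //; apply: (le_trans (mv n b)).
by rewrite ler_wpM2l.
Qed.

Lemma is_mult_ge0 v C : is_mult v C -> is_mult v `|C|.
Proof.
move=> [Ev mv]; split=> // n b; apply: (le_trans (mv n b)).
by rewrite ler_wpM2r ?asq_ge0 ?ler_norm.
Qed.

Lemma epol_eval (L : lmodType K) (phi : V -> L) (x : K * K) n b v :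
  (forall a u w, phi (a *: u + w) = a *: phi u + phi w) ->
  (forall u, E u -> phi (Z u) = x.1 *: phi u) ->
  (forall u, E u -> phi (W u) = x.2 *: phi u) ->
  E v -> phi (epol n b v) = aev n b x *: phi v.
Proof.
move=> plin pZ pW Ev.
have p0 : phi 0 = 0 by have := plin (- 1) 0 0; rewrite scaler0 addr0 scaleN1r addNr.
have pD u w : phi (u + w) = phi u + phi w by have := plin 1 u w; rewrite !scale1r.
have pZr a u : phi (a *: u) = a *: phi u by have := plin a u 0; rewrite p0 !addr0.
elim: n b => [|n IHn] b; first by rewrite /aev ts0 scale0r.
rewrite aevS /= !pD pZr pZ ?pW; try exact: E_epol.
by rewrite !IHn !scalerDl !scalerA.
Qed.

(** A bounded map on which [Z] and [W] become the scalars x sees the series b as its value at x; it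
    is used for point evaluations. *)
Lemma acts_eval (L : lmodType K) (dL : ip L) (phi : V -> L) (x : K * K) (y : K) b v F :
  (forall a u w, phi (a *: u + w) = a *: phi u + phi w) ->
  (forall u, E u -> phi (Z u) = x.1 *: phi u) ->
  (forall u, E u -> phi (W u) = x.2 *: phi u) ->
  (exists2 C : R, 0 <= C & forall u, nm dL (phi u) <= C * nm d u) ->
  E v -> sums_to b x y -> acts b v F -> phi F = y *: phi v.
Proof.
move=> plin pZ pW [C C0 hC] Ev by_ [EF hF].
apply/eqP; rewrite -subr_eq0; apply/eqP/(nm_small (d := dL)) => e e0.
have k0 : 0 < C + nm dL (phi v) + 1 by have := nm_ge0 dL (phi v); lra.
have ek0 := divr_gt0 e0 k0.
have [n1 h1] := hF _ ek0; have [n2 h2] := by_ _ ek0.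
pose n := maxn n1 n2; have g1 := h1 n (leq_maxl _ _); have g2 := h2 n (leq_maxr _ _).
have t1 : nm dL (phi (F - epol n b v)) <= C * (e / (C + nm dL (phi v) + 1)).
  by apply: (le_trans (hC _)); rewrite ler_wpM2l // nm_distC ltW.
have t2 : nm dL ((aev n b x - y) *: phi v) <=
    nm dL (phi v) * (e / (C + nm dL (phi v) + 1)).
  by rewrite nmZ mulrC ler_wpM2l ?nm_ge0 // ltW.
have -> : phi F - y *: phi v = phi (F - epol n b v) + (aev n b x - y) *: phi v.
  have -> : phi (F - epol n b v) = phi F - aev n b x *: phi v.
    by rewrite addrC -scaleN1r plin (epol_eval _ _ plin pZ pW) // scaleN1r addrC.
  by rewrite scalerBl addrA subrK.
apply: (le_trans (nmD _ _ _)); apply: (le_trans (lerD t1 t2)).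
rewrite -mulrDl mulrA ler_pdivrMr // mulrC ler_wpM2l ?(ltW e0) //; lra.
Qed.

Definition shift_image (l1 l2 : K) : set V :=
  [set r | exists p q, [/\ E p, E q & r = (Z p - l1 *: p) + (W q - l2 *: q)]].

Lemma shift_image_sub l1 l2 : lsub (shift_image l1 l2).
Proof.
split=> [|a _ _ [p [q [Ep Eq ->]]] [p' [q' [Ep' Eq' ->]]]].
  by exists 0, 0; rewrite Z0 W0 !scaler0 !subr0 addr0; split=> //; apply: sub0.
exists (a *: p + p'), (a *: q + q'); split; try by apply: sE.2.
rewrite linZ // linW // scalerDr addrACA; congr (_ + _).
  by rewrite !scalerDr scalerN !scalerA ![l1 * a]mulrC opprD addrACA.
by rewrite !scalerDr scalerN !scalerA ![l2 * a]mulrC opprD addrACA.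
Qed.

(** Modulo the images of Z - l1 and W - l2 the two operators are scalars, so a polynomial acts by
    its value at l. *)
Lemma epol_sub_eval (l1 l2 : K) n b v : E v ->
  shift_image l1 l2 (epol n b v - aev n b (l1, l2) *: v).
Proof.
move=> Ev; have sI := shift_image_sub l1 l2.
elim: n b => [|n IHn] b.
  by rewrite /aev ts0 /= scale0r subr0; apply: sub0 sI.
have E1 := E_epol n (sh1 b) Ev; have E2 := E_epol n (sh2 b) Ev.
have IH1 := subZ sI l1 (IHn (sh1 b)); have IH2 := subZ sI l2 (IHn (sh2 b)).
have I0 : shift_image l1 l2 ((Z (epol n (sh1 b) v) - l1 *: epol n (sh1 b) v) +
  (W (epol n (sh2 b) v) - l2 *: epol n (sh2 b) v)).
  by exists (epol n (sh1 b) v), (epol n (sh2 b) v).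
have := subD sI I0 (subD sI IH1 IH2).
rewrite !scalerBr addrACA !subrKA; congr (shift_image _ _ _).
rewrite aevS /= !scalerDl -!scalerA opprD [RHS]addrACA; congr (_ + _).
by rewrite opprD [RHS]addrACA subrr add0r.
Qed.

End RowContraction.

(** * Submodules and generators *)

Section InPTheory.
Variable R : realType.
Local Notation K := R[i].
Implicit Types (phi psi : C2 R -> K).

Lemma eq_inP phi psi : (forall x, ball2 x -> phi x = psi x) -> inP phi -> inP psi.
Proof. by move=> h [b [bb sb]]; exists b; split=> // x bx; rewrite -h //; apply: sb. Qed.

Lemma inP_add phi psi : inP phi -> inP psi -> inP (fun x => phi x + psi x).
Proof.
move=> [p [bp sp]] [q [bq sq]]; exists (arr_add p q); split; first exact: abounded_add.
by move=> x bx; apply: sums_add; [apply: sp|apply: sq].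
Qed.

Lemma inP_scl (c : K) phi : inP phi -> inP (fun x => c * phi x).
Proof.
move=> [p [bp sp]]; exists (arr_scl c p); split; first exact: abounded_scl.
by move=> x bx; apply/sums_scl/sp.
Qed.

Lemma inP0 : inP (fun=> 0 : K).
Proof.
exists (fun _ _ => 0); split.
  exists 0 => n; rewrite /asq ts_eq0 // => i j _; by rewrite normc0 expr0n.
move=> x _ e e0; exists 0%N => n _; rewrite /aev ts_eq0 ?subr0 ?normc0 // => i j _.
by rewrite mul0r.
Qed.

Lemma inP_sum (I : Type) (r : seq I) (P : pred I) (F : I -> C2 R -> K) :
  (forall i, P i -> inP (F i)) -> inP (fun x => \sum_(i <- r | P i) F i x).
Proof.
move=> h; elim: r => [|i r IHr].
  by apply: eq_inP inP0 => x _; rewrite big_nil.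
case Pi: (P i); last by apply: eq_inP IHr => x _; rewrite big_cons Pi.
by apply: eq_inP (inP_add (h _ Pi) IHr) => x _; rewrite big_cons Pi.
Qed.

Lemma small_ball (x : C2 R) : normc x.1 < 2^-1 -> normc x.2 < 2^-1 -> ball2 x.
Proof.
move=> x1 x2; apply/ball_rho; rewrite /rho.
have h0 := normc_ge0 x.1; have h1 := normc_ge0 x.2.
by move: (normc x.1) (normc x.2) x1 x2 h0 h1 => a d; rewrite !expr2; nra.
Qed.

(** Identity theorem for the scalar Fock space, by uniqueness of Taylor arrays. *)
Lemma inP_local phi (e : R) : inP phi -> 0 < e ->
  (forall x, normc x.1 < e -> normc x.2 < e -> phi x = 0) ->
  forall x, ball2 x -> phi x = 0.
Proof.
move=> [b [bb sb]] e0 h x bx.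
have b0 : forall i j, b i j = 0.
  apply: array_unique => //; exists (Num.min e 2^-1).
    by rewrite lt_min e0 invr_gt0 ltr0n.
  move=> y; rewrite !lt_min => /andP[y1 y1'] /andP[y2 y2'].
  by rewrite -(h y) //; apply/sb/small_ball.
apply: sums_unique (sb x bx) _ => u u0; exists 0%N => n _.
by rewrite /aev ts_eq0 ?subr0 ?normc0 // => i j _; rewrite b0 mul0r.
Qed.

(* Multiplier functions of the scalar Fock space. *)
Definition inMu (mu : C2 R -> K) := forall phi, inP phi -> inP (fun x => mu x * phi x).

Lemma inMu_const c : inMu (fun=> c).
Proof. by move=> phi; apply: inP_scl. Qed.

Lemma inMu_mul mu nu : inMu mu -> inMu nu -> inMu (fun x => mu x * nu x).
Proof.
move=> hm hn phi hp; apply: eq_inP (hm _ (hn _ hp)) => x _; by rewrite mulrA.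
Qed.

Lemma inMu_sum (I : finType) (F : I -> C2 R -> K) :
  (forall i, inMu (F i)) -> inMu (fun x => \sum_i F i x).
Proof.
move=> h phi hp; apply: eq_inP (inP_sum (index_enum I) (fun i (_ : true) => h i _ hp)) => x _.
by rewrite mulr_suml.
Qed.

Lemma inMu_prod (I : finType) (F : I -> C2 R -> K) :
  (forall i, inMu (F i)) -> inMu (fun x => \prod_i F i x).
Proof.
move=> h.
elim: (index_enum I) => [|i r IHr] phi hp.
  by apply: eq_inP hp => x _; rewrite big_nil mul1r.
apply: eq_inP (h i _ (IHr _ hp)) => x _; by rewrite big_cons mulrA.
Qed.

Lemma inMu_det n (A : 'I_n -> 'I_n -> C2 R -> K) : (forall i j, inMu (A i j)) ->
  inMu (fun x => \det (\matrix_(i, j) A i j x)).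
Proof.
move=> h; rewrite /determinant; apply: inMu_sum => s; apply: inMu_mul; first exact: inMu_const.
have := inMu_prod (fun i => h i (s i)); congr inMu; apply/funext => x.
by apply: eq_bigr => i _; rewrite mxE.
Qed.

Lemma inMu_adj n (A : 'I_n -> 'I_n -> C2 R -> K) k l : (forall i j, inMu (A i j)) ->
  inMu (fun x => (\adj (\matrix_(i, j) A i j x)) k l).
Proof.
case: n A k l => [|n] A k l h; first by case: k.
have := inMu_mul (inMu_const ((-1) ^+ (l + k)))
  (inMu_det (fun i j => h (lift l i) (lift k j))).
congr inMu; apply/funext => x; rewrite mxE /cofactor; congr (_ * \det _).
by apply/matrixP => i j; rewrite !mxE.
Qed.

End InPTheory.

(* A closed invariant subspace of a vector valued Fock space, reduced to the
   properties of its elements that the proof uses. *)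
Record fock_submodule (R : realType) := FockSubmodule {
  fsL : lmodType R[i];
  fsH : lmodType R[i];
  fs_dL : ip fsL;
  fs_d : ip fsH;
  fs_ev : fsH -> C2 R -> fsL;
  fsM :> set fsH;
  fsZ : fsH -> fsH;
  fsW : fsH -> fsH;
  fs_ev_lin : forall a f g x, ball2 x ->
    fs_ev (a *: f + g) x = a *: fs_ev f x + fs_ev g x;
  fs_ev_inj : forall f g, (forall x, ball2 x -> fs_ev f x = fs_ev g x) -> f = g;
  fs_ev_cont : forall x, ball2 x -> exists2 C : R, 0 <= C &
    forall f, nm fs_dL (fs_ev f x) <= C * nm fs_d f;
  fs_ev_inP : forall f l, inP (fun x => fs_dL (fs_ev f x) l);
  fs_sub : lsub fsM;
  fs_complete : complete_set fs_d fsM;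
  fs_Z : forall f, fsM f -> fsM (fsZ f);
  fs_W : forall f, fsM f -> fsM (fsW f);
  fs_evZ : forall f x, fsM f -> ball2 x -> fs_ev (fsZ f) x = x.1 *: fs_ev f x;
  fs_evW : forall f x, fsM f -> ball2 x -> fs_ev (fsW f) x = x.2 *: fs_ev f x;
  fs_row : forall f g, fsM f -> fsM g ->
    sqn fs_d (fsZ f + fsW g) <= sqn fs_d f + sqn fs_d g;
  fs_col : forall f, fsM f -> sqn fs_d f <= sqn fs_d (fsZ f) + sqn fs_d (fsW f) }.

Section SubmoduleBasics.
Variables (R : realType) (X : fock_submodule R).
Local Notation K := R[i].
Local Notation L := (fsL X).
Local Notation H := (fsH X).
Local Notation M := (@fsM R X).
Local Notation Z := (@fsZ R X).
Local Notation W := (@fsW R X).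
Local Notation d := (fs_d X).
Local Notation dL := (fs_dL X).
Local Notation ev := (@fs_ev R X).
Local Notation sM := (fs_sub X).
Implicit Types (f g h : H) (a : K) (x : C2 R).

Lemma evS0 x : ball2 x -> ev 0 x = 0.
Proof.
by move=> bx; have := fs_ev_lin (-1) (0 : H) 0 bx; rewrite scaler0 addr0 scaleN1r addNr.
Qed.

Lemma evSD f g x : ball2 x -> ev (f + g) x = ev f x + ev g x.
Proof. by move=> bx; have := fs_ev_lin 1 f g bx; rewrite !scale1r. Qed.

Lemma evSZ a f x : ball2 x -> ev (a *: f) x = a *: ev f x.
Proof. by move=> bx; have := fs_ev_lin a f 0 bx; rewrite evS0 // !addr0. Qed.

Lemma evSB f g x : ball2 x -> ev (f - g) x = ev f x - ev g x.
Proof. by move=> bx; rewrite -scaleN1r addrC fs_ev_lin // scaleN1r addrC. Qed.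

Lemma evS_sum (I : Type) (r : seq I) (P : pred I) (F : I -> H) x : ball2 x ->
  ev (\sum_(i <- r | P i) F i) x = \sum_(i <- r | P i) ev (F i) x.
Proof. by move=> bx; rewrite (big_morph (ev^~ x) (fun f g => evSD f g bx) (evS0 bx)). Qed.

Lemma linZ a f g : M f -> M g -> Z (a *: f + g) = a *: Z f + Z g.
Proof.
move=> Mf Mg; apply: fs_ev_inj => x bx; have Mfg := sM.2 a _ _ Mf Mg.
by rewrite fs_evZ // !fs_ev_lin // !fs_evZ // scalerDr !scalerA mulrC.
Qed.

Lemma linW a f g : M f -> M g -> W (a *: f + g) = a *: W f + W g.
Proof.
move=> Mf Mg; apply: fs_ev_inj => x bx; have Mfg := sM.2 a _ _ Mf Mg.
by rewrite fs_evW // !fs_ev_lin // !fs_evW // scalerDr !scalerA mulrC.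
Qed.

Lemma ZW_comm f : M f -> Z (W f) = W (Z f).
Proof.
move=> Mf; apply: fs_ev_inj => x bx; have MW := fs_W Mf; have MZ := fs_Z Mf.
by rewrite fs_evZ // !fs_evW // fs_evZ // !scalerA mulrC.
Qed.

Definition adjZ := Zadj sM (@fs_complete _ X) linZ linW (@fs_row _ X).
Definition adjW := Wadj sM (@fs_complete _ X) linZ linW (@fs_row _ X).

Local Notation epol := (epol Z W).
Local Notation is_mult := (is_mult d M Z W).
Local Notation acts := (acts d M Z W).

Lemma acts_ev b v F x y : M v -> ball2 x -> sums_to b x y -> acts b v F ->
  ev F x = y *: ev v x.
Proof.
move=> Mv bx sb aF; have h := @acts_eval _ _ d M sM Z W (@fs_Z _ X) (@fs_W _ X) L dL (ev^~ x) x y b v F.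
apply: h => //; last exact: fs_ev_cont.
- by move=> a u w; apply: fs_ev_lin.
- by move=> u Mu; apply: fs_evZ.
- by move=> u Mu; apply: fs_evW.
Qed.

Lemma mult_inP v C phi : is_mult v C -> inP phi ->
  exists2 F, M F & forall x, ball2 x -> ev F x = phi x *: ev v x.
Proof.
move=> mv [b [bb sb]].
have [F aF] := acts_ex sM (@fs_complete _ X) (@fs_Z _ X) (@fs_W _ X) linZ linW mv bb.
exists F; first exact: aF.1.
by move=> x bx; apply: acts_ev mv.1 bx (sb x bx) aF.
Qed.

(** The product with phi is a coordinate of the element phi v of M, and coordinates of elements of M
    lie in the scalar space. Hence minors of values of multipliers are scalar multipliers. *)
Lemma mult_inMu v C l : is_mult v C -> inMu (fun x => dL (ev v x) l).
Proof.
move=> mv phi hp; have [F MF hF] := mult_inP mv hp.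
by apply: eq_inP (fs_ev_inP F l) => x bx; rewrite hF // dtZl mulrC.
Qed.

End SubmoduleBasics.

Lemma subr_subACA (V : zmodType) (p p' q q' : V) :
  p - p' - (q - q') = p - q - (p' - q').
Proof. by rewrite opprD addrACA -opprD. Qed.

Lemma addr_subACA (V : zmodType) (p p' q q' : V) :
  p - p' + (q - q') = p + q - (p' + q').
Proof. by rewrite opprD addrACA. Qed.

(** * Determinant of a bordered matrix *)

Section Bordered.

(** Right multiplication by an upper triangular block matrix of determinant det A clears the last
    column; det A is then cancelled. *)
Lemma det_bordered_idomain (D : idomainType) r (A : 'M[D]_r) (a : 'cV_r) (p : 'rV_r) (t : D) :
  \det A != 0 ->
  \det (block_mx A a p t%:M : 'M_(r + 1)) = \det A * t - (p *m \adj A *m a) 0 0.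
Proof.
move=> dA; apply: (mulIf dA).
have e : block_mx A a p t%:M *m block_mx 1%:M (- (\adj A *m a)) 0 (\det A)%:M =
  block_mx A 0 p ((t * \det A - (p *m \adj A *m a) 0 0)%:M : 'M_1).
  rewrite mulmx_block !mulmx1 !mulmx0 !addr0 !mulmxN !mulmxA mul_mx_adj.
  rewrite mul_scalar_mx mul_mx_scalar addNr; congr block_mx.
  rewrite -scalar_mxM rmorphB addrC; congr (_ - _).
  by apply/matrixP => i j; rewrite !ord1 [RHS]mxE eqxx mulr1n.
have := congr1 determinant e; rewrite det_mulmx det_ublock det_lblock.
by rewrite !det1 !det_scalar1 mul1r => ->; ring.
Qed.

(** A may be singular here, as at zeros of delta, so A is replaced by X + A, whose determinant is
    monic and thus nonzero, and X is then set to 0. *)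
Lemma det_bordered (F : fieldType) r (A : 'M[F]_r) (a : 'cV_r) (p : 'rV_r) (t : F) :
  \det (block_mx A a p t%:M : 'M_(r + 1)) = \det A * t - (p *m \adj A *m a) 0 0.
Proof.
pose A' := char_poly_mx (- A); pose f : {rmorphism {poly F} -> F} := horner_eval (0 : F).
have fE q : f q = q.[0] by [].
have hA : map_mx f A' = A.
  apply/matrixP => i j; rewrite !mxE fE hornerD hornerN hornerC.
  by rewrite hornerMn hornerX mul0rn add0r opprK.
have fC m n (B : 'M[F]_(m, n)) : map_mx f (map_mx polyC B) = B.
  by apply/matrixP => i j; rewrite !mxE fE hornerC.
have dA : \det A' != 0 by rewrite -/(char_poly (- A)) monic_neq0 // char_poly_monic.
have := congr1 f (det_bordered_idomain (map_mx polyC a) (map_mx polyC p) t%:P dA).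
rewrite -det_map_mx map_block_mx !fC hA map_scalar_mx /=.
rewrite rmorphB rmorphM -det_map_mx hA.
have -> : f t%:P = t by rewrite fE hornerC.
move=> ->; congr (_ - _); first by congr (_ * _); apply: hornerC.
transitivity ((map_mx f (map_mx polyC p *m \adj A' *m map_mx polyC a)) 0 0).
  by rewrite [RHS]mxE.
by rewrite !map_mxM !fC map_mx_adj hA.
Qed.

End Bordered.

(** * The generators and their perturbation *)

Section Generators.
Variables (R : realType) (X : fock_submodule R).
Local Notation K := R[i].
Local Notation L := (fsL X).
Local Notation H := (fsH X).
Local Notation M := (@fsM R X).
Local Notation Z := (@fsZ R X).
Local Notation W := (@fsW R X).
Local Notation d := (fs_d X).
Local Notation dL := (fs_dL X).
Local Notation ev := (@fs_ev R X).
Local Notation sM := (fs_sub X).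
Local Notation adjZ := (@adjZ R X).
Local Notation adjW := (@adjW R X).
Implicit Types (f g h y : H) (a : K) (x : C2 R).

(* A basis of M modulo zM + wM made of multipliers. *)
Definition generators n (v : 'I_n -> H) := [/\
  forall j, exists C, is_mult d M Z W (v j) C,
  forall f, M f -> exists f1 f2 (c : 'I_n -> K),
    [/\ M f1, M f2 & f = Z f1 + W f2 + \sum_j c j *: v j]
  & forall f1 f2 (c : 'I_n -> K), M f1 -> M f2 ->
    Z f1 + W f2 + \sum_j c j *: v j = 0 -> forall j, c j = 0].

Variables (n : nat) (v : 'I_n -> H).
Hypothesis gv : generators v.

Lemma M_v j : M (v j).
Proof. by case: gv => h _ _; have [C []] := h j. Qed.

Lemma M_adjZ y : M (adjZ y). Proof. exact: E_Zadj. Qed.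
Lemma M_adjW y : M (adjW y). Proof. exact: E_Wadj. Qed.

Lemma adjZP f y : M f -> d (Z f) y = d f (adjZ y).
Proof. exact: ZadjP. Qed.

Lemma adjWP f y : M f -> d (W f) y = d f (adjW y).
Proof. exact: WadjP. Qed.

Lemma adjZ_nm y : nm d (adjZ y) <= nm d y.
Proof. exact: Zadj_nm. Qed.

Lemma adjW_nm y : nm d (adjW y) <= nm d y.
Proof. exact: Wadj_nm. Qed.

Lemma adjZ_lin a f g : adjZ (a *: f + g) = a *: adjZ f + adjZ g.
Proof. exact: Zadj_lin. Qed.

Lemma adjW_lin a f g : adjW (a *: f + g) = a *: adjW f + adjW g.
Proof. exact: Wadj_lin. Qed.

Lemma adjZZ a y : adjZ (a *: y) = a *: adjZ y.
Proof.
have h0 : adjZ 0 = 0 by have := adjZ_lin (- 1) 0 0; rewrite scaler0 addr0 scaleN1r addNr.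
by have := adjZ_lin a y 0; rewrite h0 !addr0.
Qed.

Lemma adjWZ a y : adjW (a *: y) = a *: adjW y.
Proof.
have h0 : adjW 0 = 0 by have := adjW_lin (- 1) 0 0; rewrite scaler0 addr0 scaleN1r addNr.
by have := adjW_lin a y 0; rewrite h0 !addr0.
Qed.

Lemma adjZB f g : adjZ (f - g) = adjZ f - adjZ g.
Proof. exact: ZadjB. Qed.

Lemma adjWB f g : adjW (f - g) = adjW f - adjW g.
Proof. exact: WadjB. Qed.

(** Write Phi_l for the map (f, g, c) |-> (z - l1) f + (w - l2) g + sum_j c_j v_j. This is Phi_l
    composed with the adjoint of Phi_0; keeping the adjoint at the origin makes it affine in l. *)
Definition gram (l1 l2 : K) y :=
  (Z (adjZ y) - l1 *: adjZ y) + (W (adjW y) - l2 *: adjW y) + \sum_j d y (v j) *: v j.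

Lemma M_gram l1 l2 y : M (gram l1 l2 y).
Proof.
have m1 := M_adjZ y; have m2 := M_adjW y.
apply: (subD sM); last by apply: (sub_sum sM) => j _; apply: (subZ sM); apply: M_v.
by apply: (subD sM); apply: (subB sM); [apply: fs_Z|apply: (subZ sM)|apply: fs_W|apply: (subZ sM)].
Qed.

Lemma gramB l1 l2 y y' : gram l1 l2 (y - y') = gram l1 l2 y - gram l1 l2 y'.
Proof.
rewrite /gram adjZB adjWB.
have -> : Z (adjZ y - adjZ y') = Z (adjZ y) - Z (adjZ y').
  by apply: (ZB (@linZ _ X)); apply: M_adjZ.
have -> : W (adjW y - adjW y') = W (adjW y) - W (adjW y').
  by apply: (WB (@linW _ X)); apply: M_adjW.
have -> : \sum_j d (y - y') (v j) *: v j = \sum_j d y (v j) *: v j - \sum_j d y' (v j) *: v j.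
  by rewrite -sumrB; apply: eq_bigr => j _; rewrite dtBl scalerBl.
rewrite 2!scalerBr [X in X + _ + _ = _]subr_subACA [X in _ + X + _ = _]subr_subACA.
by rewrite [X in X + _ = _]addr_subACA [LHS]addr_subACA.
Qed.

Definition gramq y : R := sqn d (adjZ y) + sqn d (adjW y) + \sum_j normc (d y (v j)) ^+ 2.

Lemma gramq_ge0 y : 0 <= gramq y.
Proof. by rewrite !addr_ge0 ?sqn_ge0 // sumr_ge0 // => j _; rewrite sqr_ge0. Qed.

Lemma rd_gram y : rd d (gram 0 0 y) y = gramq y.
Proof.
rewrite /rd /gram !scale0r !subr0 !dtDl adjZP ?adjWP ?dtxx; try exact: M_adjZ; try exact: M_adjW.
rewrite !ReD /= /gramq; congr (_ + _).
rewrite dt_suml (big_morph _ (@ReD R) (erefl _)); apply: eq_bigr => j _.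
by rewrite dtZl (ip_sym d y) mul_conj.
Qed.

Lemma gramqZ (t : R) y : gramq (t%:C *: y) = t ^+ 2 * gramq y.
Proof.
rewrite /gramq adjZZ adjWZ !sqnZ normcC real_normK ?num_real // !mulrDr mulr_sumr.
congr (_ + _); apply: eq_bigr => j _.
by rewrite dtZl normcM normcC exprMn real_normK ?num_real.
Qed.

(** Phi_0 is onto M, so its adjoint, whose square norm is [gramq], is bounded below: every f = Phi_0
    (f1, f2, c) pairs boundedly with the y such that [gramq y <= 1], and uniform boundedness
    applies. *)
Lemma gram_coercive0 : exists2 c : R, 0 < c & forall y, M y -> c * sqn d y <= gramq y.
Proof.
have [||B hB] := @uniform_boundedness _ _ d M sM (@fs_complete _ X)
  [set y | M y /\ gramq y <= 1].
- by move=> y [].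
- move=> f Mf; case: gv => _ sp _; have [f1 [f2 [c [M1 M2 ->]]]] := sp _ Mf.
  exists (nm d f1 + nm d f2 + \sum_j normc (c j)) => y [My q1].
  have s0 : 0 <= \sum_j normc (d y (v j)) ^+ 2 by rewrite sumr_ge0 // => j _; rewrite sqr_ge0.
  have p1 := sqn_ge0 d (adjZ y); have p2 := sqn_ge0 d (adjW y).
  rewrite !dtDl adjZP // adjWP //.
  apply: (le_trans (le_normcD _ _)); apply: lerD.
    apply: (le_trans (le_normcD _ _)); apply: lerD.
      apply: (le_trans (cauchy_schwarz _ _ _)); rewrite ler_piMr ?nm_ge0 //.
      by rewrite nm_le // expr1n; move: q1; rewrite /gramq; lra.
    apply: (le_trans (cauchy_schwarz _ _ _)); rewrite ler_piMr ?nm_ge0 //.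
    by rewrite nm_le // expr1n; move: q1; rewrite /gramq; lra.
  rewrite dt_suml; apply: (le_trans (normc_sum _ _ _)); apply: ler_sum => j _.
  rewrite dtZl normcM ler_piMr ?normc_ge0 // ip_sym normc_conj.
  rewrite -(@ler_pXn2r _ 2) ?nnegrE ?normc_ge0 // expr1n.
  have : normc (d y (v j)) ^+ 2 <= \sum_j normc (d y (v j)) ^+ 2.
    by rewrite (bigD1 j) //= lerDl sumr_ge0 // => i _; rewrite sqr_ge0.
  by move: q1; rewrite /gramq; lra.
have c0 : 0 < B ^+ 2 + 1 by have := sqr_ge0 B; lra.
exists (B ^+ 2 + 1)^-1; first by rewrite invr_gt0.
move=> y My; rewrite mulrC ler_pdivrMr //; apply: le_eps => e e0.
have q0 := gramq_ge0 y; set q := gramq y in q0 *.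
pose e' := e / (B ^+ 2 + 1); have e'0 : 0 < e' by rewrite divr_gt0.
have k0 : 0 < q + e' by lra.
(* Normalisation of y; e' is added because q is not yet known to be nonzero. *)
pose t := (Num.sqrt (q + e'))^-1.
have t2 : t ^+ 2 = (q + e')^-1 by rewrite exprVn sqr_sqrtr // ltW.
have t0 : 0 < t by rewrite invr_gt0 sqrtr_gt0.
have Mt : M (t%:C *: y) by apply: (subZ sM).
have h : t * nm d y <= B.
  have -> : t * nm d y = nm d (t%:C *: y) by rewrite nmZ normcC ger0_norm // ltW.
  apply: hB; split=> //.
  by rewrite gramqZ t2 mulrC ler_pdivrMr // -/q; lra.
have h2 : (t * nm d y) ^+ 2 <= B ^+ 2.
  rewrite ler_pXn2r ?nnegrE ?mulr_ge0 ?nm_ge0 ?(ltW t0) //.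
  by apply: le_trans h; rewrite mulr_ge0 ?nm_ge0 ?(ltW t0).
move: h2; rewrite exprMn nmsq t2 mulrC ler_pdivrMr //.
have ee : e = e' * (B ^+ 2 + 1) by rewrite /e' divfK // gt_eqF.
by rewrite [X in _ <= _ + X]ee; have := sqr_ge0 B; nra.
Qed.

Lemma gram_split l1 l2 y : gram l1 l2 y = gram 0 0 y - (l1 *: adjZ y + l2 *: adjW y).
Proof. by rewrite /gram !scale0r !subr0 addr_subACA addrAC. Qed.

Lemma gram_coercive : exists2 c : R, 0 < c & forall l1 l2,
  normc l1 + normc l2 <= c -> forall y, M y -> c * sqn d y <= rd d (gram l1 l2 y) y.
Proof.
have [c0 c0p hc] := gram_coercive0; exists (c0 / 2); first by rewrite divr_gt0.
move=> l1 l2 hl y My; have := hc _ My; rewrite -rd_gram [gram l1 l2 y]gram_split rdBl (rdDl d (l1 *: _)).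
have b (l : K) (u : H) : nm d u <= nm d y -> rd d (l *: u) y <= normc l * sqn d y.
  move=> uy; apply: (le_trans (rd_le _ _ _)); rewrite nmZ -mulrA.
  by rewrite ler_wpM2l ?normc_ge0 // -nmsq expr2 ler_wpM2r ?nm_ge0.
have b1 := b l1 _ (adjZ_nm y); have b2 := b l2 _ (adjW_nm y).
have b3 : (normc l1 + normc l2) * sqn d y <= c0 / 2 * sqn d y by rewrite ler_wpM2r ?sqn_ge0.
by move: b1 b2 b3; lra.
Qed.

(** Perturbing l changes the coercive form by at most (|l1| + |l2|) |y|^2, so Lax-Milgram gives
    surjectivity near the origin and a lower bound with one constant for all these l. *)
Lemma gram_solve : exists2 c : R, 0 < c & forall l1 l2, normc l1 + normc l2 <= c ->
  (forall y, M y -> c * nm d y <= nm d (gram l1 l2 y)) /\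
  forall m, M m -> exists2 y, M y & gram l1 l2 y = m.
Proof.
have [c c0 hc] := gram_coercive; exists c => // l1 l2 hl; split.
  by move=> y My; apply: (rd_ge_coercive (A := gram l1 l2)) => //; apply: hc.
pose B := 2 + normc l1 + normc l2 + \sum_j nm d (v j) * nm d (v j).
apply: (lax_milgram sM (@fs_complete _ X) (c := c) (K := B)) => //.
- by move=> y _; apply: M_gram.
- by move=> y y' _ _; apply: gramB.
- move=> y My; rewrite /gram.
  have hZ : nm d (Z (adjZ y)) <= nm d y.
    apply: le_trans (adjZ_nm y).
    exact: (nmZ_le sM (@linW _ X) (@fs_row _ X) (M_adjZ y)).
  have hW : nm d (W (adjW y)) <= nm d y.
    apply: le_trans (adjW_nm y).
    exact: (nmW_le sM (@linZ _ X) (@fs_row _ X) (M_adjW y)).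
  have hs : nm d (\sum_j d y (v j) *: v j) <= (\sum_j nm d (v j) * nm d (v j)) * nm d y.
    rewrite mulr_suml; elim/big_ind2: _ => [|p p' q q' h h'|j _]; first by rewrite nm0.
      by apply: (le_trans (nmD _ _ _)); apply: lerD.
    rewrite nmZ; apply: (le_trans (ler_wpM2r (nm_ge0 d (v j)) (cauchy_schwarz d y (v j)))).
    by rewrite [leRHS]mulrC mulrA.
  have h1 := nmB d (Z (adjZ y)) (l1 *: adjZ y); have h2 := nmB d (W (adjW y)) (l2 *: adjW y).
  rewrite !nmZ in h1 h2.
  have h3 := ler_wpM2l (normc_ge0 l1) (adjZ_nm y).
  have h4 := ler_wpM2l (normc_ge0 l2) (adjW_nm y).
  have h5 := nmD d (Z (adjZ y) - l1 *: adjZ y) (W (adjW y) - l2 *: adjW y).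
  have h6 := nmD d ((Z (adjZ y) - l1 *: adjZ y) + (W (adjW y) - l2 *: adjW y)) (\sum_j d y (v j) *: v j).
  rewrite /B !mulrDl; move: hZ hW hs h1 h2 h3 h4 h5 h6; lra.
- exact: hc.
Qed.

Lemma gram_ev l1 l2 y : ball2 (l1, l2) ->
  ev (gram l1 l2 y) (l1, l2) = \sum_j d y (v j) *: ev (v j) (l1, l2).
Proof.
move=> bl; rewrite /gram evSD // evSD // !evSB // !evSZ // fs_evZ ?fs_evW //; try exact: M_adjZ; try exact: M_adjW.
by rewrite !subrr !add0r evS_sum //; apply: eq_bigr => j _; rewrite evSZ.
Qed.

(* Near the origin every element of M is pointwise a combination of the
   generators, since [gram] remains onto there. *)
Lemma ev_span : exists2 e : R, 0 < e & forall f x, M f ->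
  normc x.1 < e -> normc x.2 < e ->
  exists c : 'I_n -> K, ev f x = \sum_j c j *: ev (v j) x.
Proof.
have [c c0 hc] := gram_solve; exists (Num.min 2^-1 (c / 2)).
  by rewrite lt_min invr_gt0 ltr0n divr_gt0.
move=> f [l1 l2] Mf; rewrite !lt_min /= => /andP[a1 b1] /andP[a2 b2].
have hl : normc l1 + normc l2 <= c by lra.
have [_ /(_ _ Mf)[y My <-]] := hc l1 l2 hl.
exists (fun j => d y (v j)); apply: gram_ev; exact: small_ball.
Qed.

End Generators.

(** * Cramer's rule for the generators *)

Lemma inP_const (R : realType) (c : R[i]) : inP (fun=> c).
Proof.
pose b (i j : nat) : R[i] := if (i + j == 0)%N then c else 0.
have sb0 : sh1 b = fun _ _ => 0 by apply/funext => i; apply/funext => j; rewrite /sh1 /b addSn.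
have sb1 : sh2 b = fun _ _ => 0 by apply/funext => i; apply/funext => j; rewrite /sh2 /b addnS.
have a0 m : asq m (fun _ _ => 0 : R[i]) = 0.
  by rewrite /asq ts_eq0 // => i j _; rewrite normc0 expr0n.
have e0 m (x : R[i] * R[i]) : aev m (fun _ _ => 0) x = 0.
  by rewrite /aev ts_eq0 // => i j _; rewrite mul0r.
exists b; split.
  exists (normc c ^+ 2) => -[|m]; first by rewrite /asq ts0 sqr_ge0.
  by rewrite asqS sb0 sb1 !a0 !addr0.
move=> x _ e ep; exists 1%N => -[//|m] _.
by rewrite aevS sb0 sb1 !e0 !mulr0 !addr0 subrr normc0.
Qed.

Section Cramer.
Variables (R : realType) (X : fock_submodule R).
Local Notation K := R[i].
Local Notation L := (fsL X).
Local Notation H := (fsH X).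
Local Notation M := (@fsM R X).
Local Notation Z := (@fsZ R X).
Local Notation W := (@fsW R X).
Local Notation d := (fs_d X).
Local Notation dL := (fs_dL X).
Local Notation ev := (@fs_ev R X).
Local Notation sM := (fs_sub X).
Variables (n : nat) (v : 'I_n -> H).
Hypothesis gv : generators v.
Implicit Types (f g h : H) (x y : C2 R).

Definition vmat k (J : 'I_k -> 'I_n) (l : 'I_k -> L) x : 'M[K]_k :=
  \matrix_(a, b) dL (ev (v (J b)) x) (l a).

(** A nonzero minor of maximal size exists since its size is at most n: otherwise a column would
    repeat. *)
Lemma rank_ex : exists r (J : 'I_r -> 'I_n) (l : 'I_r -> L),
  (exists2 x, ball2 x & \det (vmat J l x) != 0) /\
  forall (J' : 'I_(r + 1) -> 'I_n) (l' : 'I_(r + 1) -> L) x, ball2 x ->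
    \det (vmat J' l' x) = 0.
Proof.
pose P k := `[< exists (J : 'I_k -> 'I_n) (l : 'I_k -> L) x,
  ball2 x /\ \det (vmat J l x) != 0 >].
have P0 : P 0%N.
  have J0 : 'I_0 -> 'I_n by case.
  apply/asboolP; exists J0, (fun=> 0), 0; split; first exact: ball2_0.
  by rewrite det_mx00 oner_neq0.
have Pn k : P k -> (k <= n)%N.
  move=> /asboolP[J [l [x [bx]]]]; rewrite leqNgt; apply: contra_neqN => kn.
  have /injectivePn[a [b ab Jab]] : ~~ injectiveb J.
    by apply/negP => /injectiveP/leq_card; rewrite !card_ord leqNgt kn.
  rewrite -det_tr; apply: (determinant_alternate ab) => c.
  by rewrite !mxE Jab.
have [r Pr rmax] := ex_maxnP (ex_intro P _ P0) Pn.
have /asboolP[J [l [x [bx dx]]]] := Pr.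
exists r, J, l; split; first by exists x.
move=> J' l' y by'; apply/eqP; apply: contraT => dy.
suff /rmax : P (r + 1)%N by rewrite addn1 ltnn.
by apply/asboolP; exists J', l', y.
Qed.

Variables (r : nat) (J : 'I_r -> 'I_n) (l : 'I_r -> L).
Hypothesis rmax : forall (J' : 'I_(r + 1) -> 'I_n) (l' : 'I_(r + 1) -> L) x,
  ball2 x -> \det (vmat J' l' x) = 0.

Definition delta x : K := \det (vmat J l x).
(** The numerators of Cramer's rule. Unlike the quotients by delta, they are functions in the scalar
    Fock space ([inP_dcol]). *)
Definition dcol f x : 'cV[K]_r := \adj (vmat J l x) *m \col_a dL (ev f x) (l a).

Lemma inMu_v j l' : inMu (fun x => dL (ev (v j) x) l').
Proof. by case: gv => h _ _; have [C mC] := h j; apply: mult_inMu mC. Qed.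

Lemma inMu_delta : inMu delta.
Proof. by apply: inMu_det => i j; apply: inMu_v. Qed.

Lemma inP_delta : inP delta.
Proof. by apply: eq_inP (inMu_delta (inP_const 1)) => x _; rewrite mulr1. Qed.

Lemma inP_dcol f i : inP (fun x => dcol f x i 0).
Proof.
have h (a : 'I_r) : inP (fun x => (\adj (vmat J l x)) i a * dL (ev f x) (l a)).
  have hm : inMu (fun x => (\adj (vmat J l x)) i a).
    by apply: (inMu_adj (A := fun p q x => dL (ev (v (J q)) x) (l p))) => k m; apply: inMu_v.
  exact: hm (fs_ev_inP f (l a)).
have h2 := @inP_sum R _ (index_enum 'I_r) xpredT
  (fun (a : 'I_r) x => (\adj (vmat J l x)) i a * dL (ev f x) (l a)) (fun p _ => h p).
apply: eq_inP h2 => x _.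
by rewrite [RHS]mxE; apply: eq_bigr => p _; congr (_ * _); rewrite mxE.
Qed.

Lemma dcol_lin a f g x : ball2 x -> dcol (a *: f + g) x = a *: dcol f x + dcol g x.
Proof.
move=> bx; rewrite /dcol scalemxAr -mulmxDr; congr (_ *m _).
by apply/matrixP => i j; rewrite !mxE fs_ev_lin // dtDl dtZl.
Qed.

Lemma dcol_Z f x : M f -> ball2 x -> dcol (Z f) x = x.1 *: dcol f x.
Proof.
move=> Mf bx; rewrite /dcol scalemxAr; congr (_ *m _).
by apply/matrixP => i j; rewrite !mxE fs_evZ // dtZl.
Qed.

Lemma dcol_W f x : M f -> ball2 x -> dcol (W f) x = x.2 *: dcol f x.
Proof.
move=> Mf bx; rewrite /dcol scalemxAr; congr (_ *m _).
by apply/matrixP => i j; rewrite !mxE fs_evW // dtZl.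
Qed.

Lemma dcol_v i b x : dcol (v (J b)) x i 0 = delta x *+ (i == b).
Proof.
have -> : dcol (v (J b)) x = \adj (vmat J l x) *m col b (vmat J l x).
  by congr (_ *m _); apply/matrixP => a c; rewrite !mxE.
by rewrite colE mulmxA mul_adj_mx mul_scalar_mx !mxE eqxx andbT mulr_natr.
Qed.

Lemma dcol_sum (I : finType) (c : I -> K) (F : I -> H) x : ball2 x ->
  dcol (\sum_i c i *: F i) x = \sum_i c i *: dcol (F i) x.
Proof.
move=> bx; have h0 : dcol 0 x = 0.
  by have := dcol_lin (-1) 0 0 bx; rewrite scaler0 addr0 scaleN1r addNr.
elim/big_rec2: _ => // i y z _ <-; exact: dcol_lin.
Qed.

(** The minor bordered by the column of v_j and the row of l' has size r + 1, hence vanishes; expand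
    it by [det_bordered]. *)
Lemma cramer_v j l' x : ball2 x ->
  delta x * dL (ev (v j) x) l' = \sum_i dcol (v j) x i 0 * dL (ev (v (J i)) x) l'.
Proof.
move=> bx.
pose J' (i : 'I_(r + 1)) := match fintype.split i with inl b => J b | inr _ => j end.
pose L' (i : 'I_(r + 1)) := match fintype.split i with inl b => l b | inr _ => l' end.
pose p : 'rV[K]_r := \row_b dL (ev (v (J b)) x) l'.
have e : vmat J' L' x = block_mx (vmat J l x) (\col_a dL (ev (v j) x) (l a)) p
    (dL (ev (v j) x) l')%:M.
  apply/matrixP => a b; rewrite !mxE /J' /L'.
  by case: (fintype.split a) => a'; rewrite !mxE; case: (fintype.split b) => b'; rewrite !mxE ?ord1 ?eqxx ?mulr1n.
have := rmax J' L' bx; rewrite e det_bordered => /eqP; rewrite subr_eq0 => /eqP ->.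
rewrite -mulmxA mxE; apply: eq_bigr => i _; rewrite mulrC; congr (_ * _).
by rewrite mxE.
Qed.

(** Near the origin f is pointwise a combination of the v_j and the claim follows from [cramer_v].
    Paired with l', the difference of the two sides lies in the scalar Fock space, so it vanishes in
    the whole ball. *)
Lemma cramer f x : M f -> ball2 x ->
  delta x *: ev f x = \sum_i dcol f x i 0 *: ev (v (J i)) x.
Proof.
move=> Mf bx; apply: (dt_ext (d := dL)) => l'.
have [e e0 he] := ev_span gv.
pose phi y := delta y * dL (ev f y) l' +
   (-1) * \sum_i dcol f y i 0 * dL (ev (v (J i)) y) l'.
have phiP : inP phi.
  apply: inP_add; first exact: inMu_delta (fs_ev_inP f l').
  apply/inP_scl/inP_sum => i _.
  apply: eq_inP (inMu_v (J i) l' (inP_dcol f i)) => y _; by rewrite mulrC.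
have e2 : 0 < Num.min e 2^-1 by rewrite lt_min e0 invr_gt0 ltr0n.
suff : phi x = 0.
  rewrite /phi mulN1r => /eqP; rewrite subr_eq0 => /eqP; rewrite dtZl dt_suml => ->.
  by apply: eq_bigr => i _; rewrite dtZl.
apply: (inP_local phiP e2 _ bx) => y.
rewrite !lt_min => /andP[y1 y1'] /andP[y2 y2']; have yb := small_ball y1' y2'.
have [c hc] := he f y Mf y1 y2; rewrite /phi.
have -> : dL (ev f y) l' = \sum_j c j * dL (ev (v j) y) l'.
  by rewrite hc dt_suml; apply: eq_bigr => j _; rewrite dtZl.
have -> : dcol f y = \sum_j c j *: dcol (v j) y.
  rewrite -dcol_sum //; rewrite /dcol; congr (_ *m _).
  apply/matrixP => a b; rewrite !mxE hc evS_sum //.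
  by congr (dL _ _); apply: eq_bigr => j _; rewrite evSZ.
rewrite mulN1r; apply/eqP; rewrite subr_eq0; apply/eqP.
rewrite mulr_sumr; under [RHS]eq_bigr do rewrite summxE mulr_suml.
rewrite exchange_big; apply: eq_bigr => j _ /=.
rewrite mulrCA cramer_v // mulr_sumr; apply: eq_bigr => i _.
by rewrite !mxE mulrA.
Qed.

End Cramer.

(** * Counting monomials *)

Section TaylorCoefficients.
Variable R : realType.
Local Notation K := R[i].
Implicit Types (b : nat -> nat -> K).

(** The ordinary Taylor coefficient, for which multiplication by a monomial is a translation of
    exponents. *)
Definition taylor b i j : K := 'C(i + j, i)%:R * b i j.

Lemma taylor_mz b i j : taylor (mz b) i j = if i is i'.+1 then taylor b i' j else 0.
Proof.
case: i => [|i]; first by rewrite /taylor mulr0.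
by rewrite /taylor /= addSn mulrA bin_ratio.
Qed.

Lemma taylor_mw b i j : taylor (mw b) i j = if j is j'.+1 then taylor b i j' else 0.
Proof.
case: j => [|j]; first by rewrite /taylor mulr0.
rewrite /taylor /= addnS mulrA.
have -> : 'C((i + j).+1, i) = 'C((i + j).+1, j.+1).
  by rewrite -bin_sub ?leqW ?leq_addr // -addnS addKn.
rewrite bin_ratio -[in LHS]bin_sub ?leq_addl //; congr ('C(_, _)%:R * _).
by rewrite addnK.
Qed.

Lemma taylor_mzw b p q i j : taylor (iter p (@mz R) (iter q (@mw R) b)) i j =
  if (p <= i)%N && (q <= j)%N then taylor b (i - p) (j - q) else 0.
Proof.
elim: p i => [|p IHp] i /=.
  rewrite subn0; elim: q j => [|q IHq] j /=; first by rewrite subn0.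
  by rewrite taylor_mw; case: j => [|j] //; rewrite IHq ltnS subSS.
by rewrite taylor_mz; case: i => [|i] //; rewrite IHp ltnS subSS.
Qed.

Lemma taylor_add b b' i j : taylor (arr_add b b') i j = taylor b i j + taylor b' i j.
Proof. by rewrite /taylor mulrDr. Qed.

Lemma taylor_scl c b i j : taylor (arr_scl c b) i j = c * taylor b i j.
Proof. by rewrite /taylor mulrCA. Qed.

Lemma taylor_eq0 b i j : (taylor b i j == 0) = (b i j == 0).
Proof.
by rewrite mulf_eq0 pnatr_eq0 -leqn0 leqNgt bin_gt0 leq_addr.
Qed.

End TaylorCoefficients.

Section ExponentCount.
Variables (N a b : nat) (B : nat -> nat -> bool).

Definition nexp := #|[pred x : 'I_N * 'I_N | B x.1 x.2]|.
Definition nexp_low := #|[pred x : 'I_N * 'I_N | B x.1 x.2 & ~~ ((a <= x.1) && (b <= x.2))%N]|.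
Definition nexp_shift := #|[pred x : 'I_N * 'I_N | B (x.1 + a)%N (x.2 + b)%N]|.

(** These exponents lie in the strips i < a and j < b of the square of side N. *)
Lemma nexp_low_le : (nexp_low <= (a + b) * N)%N.
Proof.
apply: (@leq_trans #|[pred x : 'I_N * 'I_N | (x.1 < a)%N || (x.2 < b)%N]|).
  by apply: subset_leq_card; apply/fintype.subsetP => x; rewrite !inE negb_and -!ltnNge => /andP[].
have -> : #|[pred x : 'I_N * 'I_N | (x.1 < a)%N || (x.2 < b)%N]| =
    #|predU [pred x : 'I_N * 'I_N | (x.1 < a)%N] [pred x : 'I_N * 'I_N | (x.2 < b)%N]|.
  by apply: eq_card => x; rewrite !inE.
apply: (@leq_trans (#|[pred x : 'I_N * 'I_N | (x.1 < a)%N]| +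
    #|[pred x : 'I_N * 'I_N | (x.2 < b)%N]|)%N); first by rewrite -cardUI leq_addr.
rewrite mulnDl.
have card_lt c : (#|[pred i : 'I_N | (i < c)%N]| <= c)%N.
  rewrite cardE -(size_map val) -[leqRHS](size_iota 0 c).
  apply: uniq_leq_size; first by rewrite map_inj_uniq ?enum_uniq //; apply: val_inj.
  by move=> m /mapP[k]; rewrite mem_enum inE => ic ->; rewrite mem_iota.
apply: leq_add.
  have -> : #|[pred x : 'I_N * 'I_N | (x.1 < a)%N]| = (#|[pred i : 'I_N | (i < a)%N]| * N)%N.
    by rewrite -[X in (_ * X)%N]card_ord -cardX; apply: eq_card => -[i j]; rewrite !inE andbT.
  by rewrite leq_mul2r card_lt orbT.
have -> : #|[pred x : 'I_N * 'I_N | (x.2 < b)%N]| = (N * #|[pred i : 'I_N | (i < b)%N]|)%N.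
  by rewrite -[X in (X * _)%N]card_ord -cardX; apply: eq_card => -[i j]; rewrite !inE.
by rewrite mulnC leq_mul2r card_lt orbT.
Qed.

(** Exponents of B outside the two strips are translated injectively by (- a, - b) into those
    counted by [nexp_shift]. *)
Lemma nexp_shift_ge : (nexp <= nexp_shift + (a + b) * N)%N.
Proof.
apply: leq_trans (leq_add (leqnn _) nexp_low_le).
pose U := [pred x : 'I_N * 'I_N | B x.1 x.2 & ((a <= x.1) && (b <= x.2))%N].
pose C := [pred x : 'I_N * 'I_N | B x.1 x.2 & ~~ ((a <= x.1) && (b <= x.2))%N].
apply: (@leq_trans (#|U| + #|C|)%N).
  rewrite -cardUI; apply: (@leq_trans #|predU U C|); last exact: leq_addr.
  by apply: subset_leq_card; apply/fintype.subsetP => x; rewrite !inE => ->; rewrite /= orbN.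
rewrite leq_add2r.
pose sh (x : 'I_N * 'I_N) : 'I_N * 'I_N :=
  (Ordinal (leq_ltn_trans (leq_subr a x.1) (ltn_ord x.1)),
   Ordinal (leq_ltn_trans (leq_subr b x.2) (ltn_ord x.2))).
have shi : {in U &, injective sh}.
  move=> [i j] [i' j']; rewrite !inE /= => /andP[_ /andP[ai bj]] /andP[_ /andP[ai' bj']].
  move=> [/eqP e1 /eqP e2]; congr (_, _); apply/val_inj/eqP => /=.
    by rewrite -(eqn_add2r a) !subnK // in e1.
  by rewrite -(eqn_add2r b) !subnK // in e2.
rewrite -(card_in_imset shi); apply: subset_leq_card; apply/fintype.subsetP => x.
case/imsetP => -[p q]; rewrite !inE /= => /andP[Bpq /andP[ap bq]] -> /=.
by rewrite !subnK.
Qed.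

End ExponentCount.

Section Monomials.
Variables (R : realType) (X : fock_submodule R).
Local Notation K := R[i].
Local Notation L := (fsL X).
Local Notation H := (fsH X).
Local Notation M := (@fsM R X).
Local Notation Z := (@fsZ R X).
Local Notation W := (@fsW R X).
Local Notation d := (fs_d X).
Local Notation dL := (fs_dL X).
Local Notation ev := (@fs_ev R X).
Local Notation sM := (fs_sub X).
Local Notation epol := (epol Z W).
Local Notation acts := (acts d M Z W).
Implicit Types (f g h u : H) (x y : C2 R) (c : K).

Definition mon i j f := iter i Z (iter j W f).

Lemma M_mon i j f : M f -> M (mon i j f).
Proof.
move=> Mf; elim: i => [|i IHi] /=; last exact: fs_Z.
by elim: j => //= j IHj; apply: fs_W.
Qed.

Lemma ev_mon i j f x : M f -> ball2 x ->
  ev (mon i j f) x = (x.1 ^+ i * x.2 ^+ j) *: ev f x.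
Proof.
move=> Mf bx; elim: i => [|i IHi] /=.
  rewrite mul1r; elim: j => [|j IHj] /=; first by rewrite scale1r.
  by rewrite fs_evW ?IHj ?scalerA ?exprS //; apply: (M_mon 0).
by rewrite fs_evZ ?IHi ?scalerA ?exprS ?mulrA //; apply: M_mon.
Qed.

Lemma mon_mon i j p q f : M f -> mon i j (mon p q f) = mon (i + p) (j + q) f.
Proof.
move=> Mf; apply: fs_ev_inj => x bx; rewrite !ev_mon //; last exact: M_mon.
by rewrite scalerA !exprD; congr (_ *: _); ring.
Qed.

Lemma mon_Z i j f : M f -> mon i j (Z f) = mon i.+1 j f.
Proof. by move=> Mf; have := mon_mon i j 1 0 Mf; rewrite addn1 addn0. Qed.

Lemma mon_W i j f : mon i j (W f) = mon i j.+1 f.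
Proof. by rewrite /mon iterSr. Qed.

Lemma mon_lin i j c f g : M f -> M g -> mon i j (c *: f + g) = c *: mon i j f + mon i j g.
Proof.
move=> Mf Mg; apply: fs_ev_inj => x bx.
rewrite fs_ev_lin // !ev_mon ?fs_ev_lin //; last exact: sM.2.
by rewrite scalerDr !scalerA mulrC.
Qed.

Lemma mon0 i j : mon i j 0 = 0.
Proof. by have := mon_lin i j (-1) (sub0 sM) (sub0 sM); rewrite scaler0 addr0 scaleN1r addNr. Qed.

Lemma monD i j f g : M f -> M g -> mon i j (f + g) = mon i j f + mon i j g.
Proof. by move=> Mf Mg; have := mon_lin i j 1 Mf Mg; rewrite !scale1r. Qed.

Lemma monB i j f g : M f -> M g -> mon i j (f - g) = mon i j f - mon i j g.
Proof. by move=> Mf Mg; rewrite addrC -scaleN1r mon_lin // scaleN1r addrC. Qed.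

Lemma monZ i j c f : M f -> mon i j (c *: f) = c *: mon i j f.
Proof. by move=> Mf; have := mon_lin i j c Mf (sub0 sM); rewrite mon0 !addr0. Qed.

Lemma mon_sum i j (I : finType) (F : I -> H) : (forall k, M (F k)) ->
  mon i j (\sum_k F k) = \sum_k mon i j (F k).
Proof.
move=> MF; suff [] : M (\sum_k F k) /\ mon i j (\sum_k F k) = \sum_k mon i j (F k) by [].
elim/big_rec2: _ => [|k f g _ [Mg <-]]; first by rewrite mon0; split=> //; apply: sub0 sM.
by rewrite monD //; split=> //; apply: (subD sM).
Qed.

Lemma M_ts (F : nat -> nat -> H) m : (forall i j, M (F i j)) -> M (ts F m).
Proof.
move=> h; apply: (sub_sum sM) => k _; apply: (sub_sum sM) => i _.
by rewrite -scaler_nat; apply: (subZ sM).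
Qed.

Lemma mon_ts i j (F : nat -> nat -> H) m : (forall p q, M (F p q)) ->
  mon i j (ts F m) = ts (fun p q => mon i j (F p q)) m.
Proof.
move=> MF; apply: fs_ev_inj => x bx; rewrite ev_mon //; last exact: M_ts.
have e0 : ev 0 x = 0 by apply: evS0.
have eD f g : ev (f + g) x = ev f x + ev g x by apply: evSD.
rewrite !(ts_morph (f := ev^~ x)) //.
rewrite (ts_morph (f := fun z => (x.1 ^+ i * x.2 ^+ j) *: z)) ?scaler0 //.
  by apply: eq_ts => p q _; rewrite ev_mon.
by move=> z z'; rewrite scalerDr.
Qed.

Lemma epolE n b u : M u -> epol n b u = ts (fun i j => b i j *: mon i j u) n.
Proof.
move=> Mu; apply: fs_ev_inj => x bx.
rewrite (epol_eval sM (@fs_Z _ X) (@fs_W _ X) (phi := ev^~ x) (x := x)) //;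
  try by move=> *; rewrite ?fs_ev_lin ?fs_evZ ?fs_evW.
rewrite (ts_morph (f := ev^~ x)) ?evS0 //; last by move=> f g; apply: evSD.
rewrite /aev (ts_morph (f := fun z => z *: ev u x)) ?scale0r //.
  by apply: eq_ts => i j _; rewrite evSZ // ev_mon // scalerA.
by move=> z z'; rewrite scalerDl.
Qed.

Variables (N : nat) (B : nat -> nat -> bool).

Definition down_closed := [/\ forall i j, B i.+1 j -> B i j,
  forall i j, B i j.+1 -> B i j & forall i j, B i j -> (i + j < N)%N].

(* [JM] is the product of M with the ideal spanned by the monomials
   z ^ i * w ^ j with (i, j) outside [B]. *)
Definition monomial_image (JM : set H) := [/\ lsub JM, (forall f, JM f -> M f),
  forall i j f, ~~ B i j -> M f -> JM (mon i j f)
  & forall P : set H, lsub P -> (forall i j f, ~~ B i j -> M f -> P (mon i j f)) ->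
    forall f, JM f -> P f].

Hypothesis dB : down_closed.
Variable JM : set H.
Hypothesis hJ : monomial_image JM.

Lemma sJ : lsub JM. Proof. by case: hJ. Qed.
Lemma J_M f : JM f -> M f. Proof. by case: hJ => _ h _ _; apply: h. Qed.
Lemma J_mon i j f : ~~ B i j -> M f -> JM (mon i j f).
Proof. by case: hJ => _ _ h _; apply: h. Qed.

Lemma notB_shift i j p q : ~~ B i j -> ~~ B (p + i) (q + j).
Proof.
case: dB => d1 d2 _ nB; elim: p => [|p IHp]; last by apply: contra IHp; apply: d1.
by elim: q => [//|q IHq]; apply: contra IHq; apply: d2.
Qed.

Lemma notB_large i j : (N <= i + j)%N -> ~~ B i j.
Proof. by case: dB => _ _ h Nij; apply/negP => /h; rewrite ltnNge Nij. Qed.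

Lemma acts_S b u C F : is_mult d M Z W u C -> abounded b -> acts b u F ->
  exists F1 F2, [/\ acts (sh1 b) u F1, acts (sh2 b) u F2
    & F = b 0%N 0%N *: u + Z F1 + W F2].
Proof.
move=> mu bb aF; have Mu := mu.1.
have [F1 a1] := acts_ex sM (@fs_complete _ X) (@fs_Z _ X) (@fs_W _ X)
  (@linZ _ X) (@linW _ X) mu (abounded_sh1 bb).
have [F2 a2] := acts_ex sM (@fs_complete _ X) (@fs_Z _ X) (@fs_W _ X)
  (@linZ _ X) (@linW _ X) mu (abounded_sh2 bb).
exists F1, F2; split=> //.
have shift (s : nat -> H) (G : H) : lims d s G -> lims d (fun n => s n.+1) G.
  by move=> h e /h[n0 hn]; exists n0 => n nn; apply/hn/leqW.
have Mp b' n := E_epol sM (@fs_Z _ X) (@fs_W _ X) n b' Mu.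
have hZ : lims d (fun n => Z (epol n (sh1 b) u)) (Z F1).
  move=> e /a1.2[n0 hn]; exists n0 => n /hn; apply: le_lt_trans.
  rewrite -(ZB (@linZ _ X)) //; last exact: a1.1.
  by apply: (nmZ_le sM (@linW _ X) (@fs_row _ X)); apply: (subB sM) => //; exact: a1.1.
have hW : lims d (fun n => W (epol n (sh2 b) u)) (W F2).
  move=> e /a2.2[n0 hn]; exists n0 => n /hn; apply: le_lt_trans.
  rewrite -(WB (@linW _ X)) //; last exact: a2.1.
  by apply: (nmW_le sM (@linZ _ X) (@fs_row _ X)); apply: (subB sM) => //; exact: a2.1.
have hc : lims d (fun=> b 0%N 0%N *: u) (b 0%N 0%N *: u).
  by move=> e e0; exists 0%N => n _; rewrite subrr nm0.
apply: lims_unique (shift _ _ aF.2) _; exact: limsD (limsD hc hZ) hW.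
Qed.

(** The tail beyond degree m is a finite sum of monomials of degree m applied to elements of M, the
    actions of the iterated shifts of b. So it lies in JM itself, and not merely in its closure. *)
Lemma acts_tail_J b u C F m p q : is_mult d M Z W u C -> abounded b -> acts b u F ->
  (N <= p + q + m)%N -> JM (mon p q (F - epol m b u)).
Proof.
move=> mu; have Mu := mu.1; elim: m b F p q => [|m IHm] b F p q bb aF Npq.
  by rewrite subr0; apply: J_mon; [apply: notB_large; rewrite addn0 in Npq|apply: aF.1].
have [F1 [F2 [a1 a2 ->]]] := acts_S mu bb aF.
have Mp b' := E_epol sM (@fs_Z _ X) (@fs_W _ X) m b' Mu.
have M1 : M (F1 - epol m (sh1 b) u) by apply: (subB sM) => //; exact: a1.1.
have M2 : M (F2 - epol m (sh2 b) u) by apply: (subB sM) => //; exact: a2.1.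
have -> : b 0%N 0%N *: u + Z F1 + W F2 - epol m.+1 b u =
   Z (F1 - epol m (sh1 b) u) + W (F2 - epol m (sh2 b) u).
  rewrite (ZB (@linZ _ X)) ?(WB (@linW _ X)) //; try exact: a1.1; try exact: a2.1.
  by rewrite /= opprD [LHS]addrACA; congr (_ + _); rewrite opprD addrACA subrr add0r.
rewrite monD; [|exact: fs_Z|exact: fs_W]; apply: (subD sJ).
  by rewrite mon_Z //; apply: IHm => //; [apply: abounded_sh1|lia].
rewrite mon_W; apply: IHm => //; first exact: abounded_sh2.
lia.
Qed.

End Monomials.

(** In characteristic 0 the binomial weight of the remaining term can be divided out. *)
Lemma ts_isolate (K : numFieldType) (V : lmodType K) (S : set V) (F : nat -> nat -> V) a b N :
  lsub S -> (a + b < N)%N -> S (ts F N) ->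
  (forall i j, (i, j) != (a, b) -> S (F i j)) -> S (F a b).
Proof.
move=> sS abN; elim: N a b F abN => // N IHN a b F.
have Sn x m : S x -> S (x *+ m) by rewrite -scaler_nat; apply: subZ.
have Sdg G k : (forall i j, (i + j)%N = k -> S (G i j)) -> S (dg G k).
  by move=> h; apply: (sub_sum sS) => i _; apply/Sn/h; rewrite subnKC // -ltnS.
have Sts G m : (forall i j, (i + j < m)%N -> S (G i j)) -> S (ts G m).
  by move=> h; apply: (sub_sum sS) => k _; apply: Sdg => i j ij; apply: h; rewrite ij.
rewrite ltnS leq_eqVlt tsSr => /orP[/eqP abN|abN] hN oth; last first.
  apply: (IHN _ _ F abN _ oth); apply: (subDl sS (x := dg F N)); last exact: hN.
  by apply: Sdg => i j ij; apply: oth; apply: contraTneq abN => -[<- <-]; rewrite ij ltnn.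
have h2 : S (dg F N).
  apply: (subDl sS (x := ts F N)); last by rewrite addrC.
  by apply: Sts => i j ij; apply: oth; apply: contraTneq ij => -[-> ->]; rewrite abN ltnn.
have aN : (a < N.+1)%N by rewrite ltnS -abN leq_addr.
rewrite /dg (bigD1 (Ordinal aN)) //= in h2.
have h3 : S (F a (N - a)%N *+ 'C(N, a)).
  apply: (subDl sS _ h2).
  apply: (sub_sum sS) => i ia; apply/Sn/oth; apply: contraNneq ia => -[e _].
  by apply/eqP/val_inj.
rewrite -abN addKn in h3.
have c0 : 'C(a + b, a)%:R != 0 :> K by rewrite pnatr_eq0 -lt0n bin_gt0 leq_addr.
by have := subZ sS ('C(a + b, a)%:R^-1) h3; rewrite -[F a b *+ _]scaler_nat scalerA mulVf ?scale1r.
Qed.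

(** * Upper bound for dim M/JM *)

Section Counting.
Variables (R : realType) (X : fock_submodule R).
Local Notation K := R[i].
Local Notation L := (fsL X).
Local Notation H := (fsH X).
Local Notation M := (@fsM R X).
Local Notation Z := (@fsZ R X).
Local Notation W := (@fsW R X).
Local Notation d := (fs_d X).
Local Notation dL := (fs_dL X).
Local Notation ev := (@fs_ev R X).
Local Notation sM := (fs_sub X).
Local Notation epol := (epol Z W).
Local Notation acts := (acts d M Z W).
Local Notation mon := (@mon R X).
Variables (n : nat) (v : 'I_n -> H).
Hypothesis gv : generators v.
Variables (r : nat) (J : 'I_r -> 'I_n) (l : 'I_r -> L).
Hypothesis rmax : forall (J' : 'I_(r + 1) -> 'I_n) (l' : 'I_(r + 1) -> L) x,
  ball2 x -> \det (vmat v J' l' x) = 0.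
Implicit Types (f g h u : H) (x y : C2 R) (c : K).

Variable D : nat -> nat -> K.
Hypothesis bD : abounded D.
Hypothesis sD : forall x, ball2 x -> sums_to D x (delta v J l x).
Variables (a b : nat).
Hypothesis Dab : D a b != 0.
Hypothesis Dmin : forall i j, D i j != 0 -> (a < i)%N \/ (i = a /\ (b <= j)%N).

Variables (N : nat) (B : nat -> nat -> bool) (JM : set H).
Hypothesis dB : down_closed N B.
Hypothesis hJ : monomial_image B JM.
Let sJM : lsub JM := sJ hJ.

Let Mv j : M (v j) := M_v gv j.

Let T1 : finType := ({x : 'I_N * 'I_N | B x.1 x.2} * 'I_r)%type.
Let T2 : finType :=
  ({x : 'I_N * 'I_N | B x.1 x.2 && ~~ ((a <= x.1) && (b <= x.2))%N} * 'I_n)%type.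

(** The spanning family: all monomials of B on the r chosen generators, and on all n generators only
    the monomials of B not divisible by z^a w^b. The second kind contributes O(N). *)
Let fam (t : T1 + T2) : H := match t with
  | inl p => mon (val p.1).1 (val p.1).2 (v (J p.2))
  | inr p => mon (val p.1).1 (val p.1).2 (v p.2) end.

Lemma M_fam t : M (fam t).
Proof. by case: t => p; apply/M_mon/Mv. Qed.

Let S : set H := [set f | M f /\ exists c : T1 + T2 -> K, JM (f - \sum_t c t *: fam t)].

Lemma lsub_S : lsub S.
Proof.
split=> [|c f g [Mf [cf hf]] [Mg [cg hg]]].
  split; first exact: sub0 sM.
  exists (fun=> 0); rewrite big1 ?subr0; first exact: sub0 sJM.
  by move=> t _; rewrite scale0r.
split; first exact: sM.2.
exists (fun t => c * cf t + cg t).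
have -> : c *: f + g - \sum_t (c * cf t + cg t) *: fam t =
   c *: (f - \sum_t cf t *: fam t) + (g - \sum_t cg t *: fam t).
  under eq_bigr do rewrite scalerDl -scalerA.
  rewrite big_split -scaler_sumr scalerBr opprD addrACA; congr (_ + _).
exact: sJM.2.
Qed.

Lemma J_S f : JM f -> S f.
Proof.
move=> Jf; have Mf := J_M hJ Jf. split; first exact: Mf.
by exists (fun=> 0); rewrite big1 ?subr0 // => t _; rewrite scale0r.
Qed.

Lemma fam_S t : S (fam t).
Proof.
split; first exact: M_fam.
exists (fun t' => (t' == t)%:R); rewrite (bigD1 t) //= eqxx scale1r big1 ?addr0 ?subrr.
  exact: sub0 sJM.
by move=> t' /negPf ->; rewrite scale0r.
Qed.

Lemma mon_vJ_S i j k : S (mon i j (v (J k))).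
Proof.
have [Bij|nB] := boolP (B i j); last by apply/J_S/(J_mon hJ).
have ijN : (i + j < N)%N by case: dB => _ _; apply.
have iN : (i < N)%N by lia. have jN : (j < N)%N by lia.
exact: (fam_S (inl (exist _ (Ordinal iN, Ordinal jN) Bij, k))).
Qed.

(* The Cramer relation [delta v_j = sum_k dcol_k v_(J k)] inside M, in terms of
   the actions of the Taylor arrays. *)
Lemma cramer_acts j : exists (F : 'I_r -> H) (F0 : H) (q : 'I_r -> nat -> nat -> K),
  [/\ acts D (v j) F0, forall k, acts (q k) (v (J k)) (F k), forall k, abounded (q k),
      forall k x, ball2 x -> sums_to (q k) x (dcol v J l (v j) x k 0)
    & F0 = \sum_k F k].
Proof.
have hq k : exists q : nat -> nat -> K, abounded q /\
   forall x, ball2 x -> sums_to q x (dcol v J l (v j) x k 0) by exact: (inP_dcol gv J l (v j) k).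
have [q hq'] := choice hq.
have hm j' : exists C, is_mult d M Z W (v j') C by case: gv.
have hF k : exists F, acts (q k) (v (J k)) F.
  have [C mC] := hm (J k).
  have h0 := acts_ex sM (@fs_complete _ X) (@fs_Z _ X) (@fs_W _ X) (@linZ _ X) (@linW _ X)
    mC (hq' k).1.
  exact: h0.
have [F hF'] := choice hF.
have [F0 hF0] : exists F, acts D (v j) F.
  have [C mC] := hm j.
  have h0 := acts_ex sM (@fs_complete _ X) (@fs_Z _ X) (@fs_W _ X) (@linZ _ X) (@linW _ X)
    mC bD.
  exact: h0.
exists F, F0, q; split=> // [k|k x|]; try by case: (hq' k) => // _; apply.
apply: fs_ev_inj => x bx; rewrite (acts_ev (Mv j) bx (sD bx) hF0) (cramer gv J l rmax (Mv j) bx).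
by rewrite evS_sum //; apply: eq_bigr => k _; rewrite (acts_ev (Mv (J k)) bx ((hq' k).2 x bx) (hF' k)).
Qed.

(** If z^a w^b divides z^p w^q, multiply delta v_j = sum_k dcol_k v_(J k) by z^(p-a) w^(q-b). The
    right side is in S, and on the left z^p w^q v_j is accompanied only by terms with
    lexicographically larger exponents. *)
Lemma mon_v_S j p q : S (mon p q (v j)).
Proof.
have sS := lsub_S.
(* Lexicographic induction down from N. The bound k is quantified after m because the exponent of w
   may drop when that of z grows. *)
have key m : forall k p q, (N - p <= m)%N -> (N - q <= k)%N -> S (mon p q (v j)).
  elim: m => [|m IHm] k; elim: k => [|k IHk] {}p {}q pm qk;
    try by apply/J_S/(J_mon hJ) => //; apply: (notB_large dB); lia.
  have [Bpq|nB] := boolP (B p q); last by apply/J_S/(J_mon hJ).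
  have pqN : (p + q < N)%N by case: dB => _ _; apply.
  have pN : (p < N)%N by lia. have qN : (q < N)%N by lia.
  have [ab|nab] := boolP ((a <= p) && (b <= q))%N; last first.
    have BC : B p q && ~~ ((a <= p) && (b <= q))%N by rewrite Bpq.
    exact: (fam_S (inr (exist _ (Ordinal pN, Ordinal qN) BC, j))).
  have /andP[ap bq] := ab.
  have [F [F0 [qq [hF0 hF bq' _ e]]]] := cramer_acts j.
  have hm j' : exists C, is_mult d M Z W (v j') C by case: gv.
  have MF0 : M F0 := hF0.1.
  pose p' := (p - a)%N; pose q' := (q - b)%N.
  have SF k' : S (mon p' q' (F k')).
    have [C mC] := hm (J k').
    have := acts_tail_J dB hJ (m := N) (p := p') (q := q') mC (bq' k') (hF k') (leq_addl _ _).
    have Me := E_epol sM (@fs_Z _ X) (@fs_W _ X) N (qq k') (Mv (J k')).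
    rewrite monB //; last exact: (hF k').1.
    move=> /J_S h; apply: (subDl sS (x := - mon p' q' (epol N (qq k') (v (J k'))))) => //.
    apply: (subN sS); rewrite epolE // mon_ts; last by move=> *; apply: (subZ sM); apply: M_mon.
    apply: (sub_sum sS) => k1 _; apply: (sub_sum sS) => i _.
    rewrite -scaler_nat monZ ?mon_mon //; last exact: M_mon.
    by apply/(subZ sS)/(subZ sS)/mon_vJ_S.
  have SF0 : S (mon p' q' F0).
    rewrite e mon_sum => [|k']; last exact: (hF k').1.
    by apply: (sub_sum sS) => k' _; apply: SF.
  have [C mC] := hm j.
  have := acts_tail_J dB hJ (m := N) (p := p') (q := q') mC bD hF0 (leq_addl _ _).
  have Me := E_epol sM (@fs_Z _ X) (@fs_W _ X) N D (Mv j).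
  rewrite monB // => /J_S h.
  have : S (mon p' q' (epol N D (v j))).
    have := subB sS SF0 h; rewrite subKr //.
  rewrite epolE // mon_ts; last by move=> *; apply: (subZ sM); apply: M_mon.
  move=> hts; have abN : (a + b < N)%N by lia.
  have := ts_isolate sS abN hts.
  rewrite monZ ?mon_mon //; last exact: M_mon.
  rewrite !subnK // => h2.
  have h3 : S (D a b *: mon p q (v j)).
    apply: h2 => i1 j1 ij; rewrite monZ ?mon_mon //; last exact: M_mon.
    have [D0|D0] := eqVneq (D i1 j1) 0; first by rewrite D0 scale0r; apply: sub0 sS.
    apply: (subZ sS); case: (Dmin D0) => [ai|[ia bj]].
      apply: (IHm (N - (q' + j1))%N) => //; rewrite /p'; lia.
    have : j1 != b by apply: contraNneq ij => ->; rewrite ia.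
    by move=> jb; apply: IHk; rewrite /p' /q'; lia.
  by have := subZ sS (D a b)^-1 h3; rewrite scalerA mulVf // scale1r.
exact: key (leqnn _) (leqnn _).
Qed.

(** Decompose f = Z f1 + W f2 + sum_j c_j v_j repeatedly; after N steps the part without generators
    has degree N and lies in JM. *)
Lemma M_S f : M f -> S f.
Proof.
have sS := lsub_S.
suff key m : forall f p q, M f -> (N <= p + q + m)%N -> S (mon p q f).
  by move=> Mf; apply: (key N f 0%N 0%N).
elim: m => [|m IHm] {}f p q Mf Npq.
  by apply/J_S/(J_mon hJ) => //; apply: (notB_large dB); rewrite addn0 in Npq.
case: gv => _ sp _; have [f1 [f2 [c [M1 M2 ->]]]] := sp _ Mf.
have MZ1 := fs_Z M1; have MW2 := fs_W M2.
have Mc : M (\sum_j c j *: v j) by apply: (sub_sum sM) => j _; apply: (subZ sM).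
rewrite !monD //; last exact: (subD sM).
rewrite mon_Z // mon_W; apply: (subD sS).
  by apply: (subD sS); apply: IHm => //; lia.
rewrite mon_sum => [|j]; last exact: (subZ sM).
by apply: (sub_sum sS) => j _; rewrite monZ //; apply/(subZ sS)/mon_v_S.
Qed.

Lemma monomial_qdim_ub : exists2 m, (m <= r * nexp N B + n * nexp_low N a b B)%N &
  has_qdim M JM m.
Proof.
have [m hm qm] := @spans_mod_has_qdim _ _ M JM sJM _ fam
   (conj M_fam (fun f Mf => (M_S Mf).2)).
exists m => //; apply: (leq_trans hm).
by rewrite card_sum !card_prod !card_sig !card_ord mulnC [(_ * n)%N]mulnC.
Qed.

End Counting.

Lemma abounded0 (R : realType) : abounded (fun _ _ => 0 : R[i]).
Proof. by exists 0 => n; rewrite /asq ts_eq0 // => i j _; rewrite normc0 expr0n. Qed.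

Lemma sums0 (R : realType) (x : R[i] * R[i]) : sums_to (fun _ _ => 0) x 0.
Proof.
move=> e e0; exists 0%N => n _; rewrite subr0 /aev ts_eq0 ?normc0 //.
by move=> i j _; rewrite mul0r.
Qed.

Lemma sums_big (R : realType) (I : finType) (b : I -> nat -> nat -> R[i])
    (phi : I -> C2 R -> R[i]) :
  (forall t, abounded (b t)) -> (forall t x, ball2 x -> sums_to (b t) x (phi t x)) ->
  exists Q, [/\ abounded Q, forall x, ball2 x -> sums_to Q x (\sum_t phi t x)
    & forall i j, taylor Q i j = \sum_t taylor (b t) i j].
Proof.
move=> hb hs; elim: (index_enum I) => [|t s [Q [bQ sQ tQ]]].
  exists (fun _ _ => 0); split=> [|x _|i j].
  - exact: abounded0.
  - rewrite big_nil; exact: sums0.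
  - by rewrite big_nil /taylor mulr0.
exists (arr_add (b t) Q); split=> [|x bx|i j].
- exact: abounded_add.
- by rewrite big_cons; apply: sums_add; [apply: hs|apply: sQ].
- by rewrite big_cons taylor_add tQ.
Qed.

Lemma abounded_mzw (R : realType) p q (b : nat -> nat -> R[i]) : abounded b ->
  abounded (iter p (@mz R) (iter q (@mw R) b)).
Proof.
move=> bb; elim: p => [|p IHp] /=; last exact: abounded_mz.
by elim: q => //= q IHq; apply: abounded_mw.
Qed.

Lemma sums_mzw (R : realType) p q b (x : R[i] * R[i]) y : sums_to b x y ->
  sums_to (iter p (@mz R) (iter q (@mw R) b)) x (x.1 ^+ p * x.2 ^+ q * y).
Proof.
move=> sb; elim: p => [|p IHp] /=.
  rewrite mul1r; elim: q => [|q IHq] /=; first by rewrite mul1r.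
  by rewrite exprS -mulrA; apply: sums_mw.
by rewrite exprS -!mulrA; apply: sums_mz; rewrite mulrA.
Qed.

(** * Lower bound for dim M/JM *)

Section CountingBelow.
Variables (R : realType) (X : fock_submodule R).
Local Notation K := R[i].
Local Notation L := (fsL X).
Local Notation H := (fsH X).
Local Notation M := (@fsM R X).
Local Notation Z := (@fsZ R X).
Local Notation W := (@fsW R X).
Local Notation sM := (fs_sub X).
Local Notation mon := (@mon R X).
Variables (n : nat) (v : 'I_n -> H).
Hypothesis gv : generators v.
Variables (r : nat) (J : 'I_r -> 'I_n) (l : 'I_r -> L).
Variable D : nat -> nat -> K.
Hypothesis bD : abounded D.
Hypothesis sD : forall x, ball2 x -> sums_to D x (delta v J l x).
Variables (a b : nat).
Hypothesis Dab : D a b != 0.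
Hypothesis Dmin : forall i j, D i j != 0 -> (a < i)%N \/ (i = a /\ (b <= j)%N).
Variables (N : nat) (B : nat -> nat -> bool) (JM : set H).
Hypothesis dB : down_closed N B.
Hypothesis hJ : monomial_image B JM.

Let T : finType := ({x : 'I_N * 'I_N | B (x.1 + a)%N (x.2 + b)%N} * 'I_r)%type.
Let fam (t : T) : H := mon (val t.1).1 (val t.1).2 (v (J t.2)).

(** [dcol] sends z^i w^j g to z^i w^j times a scalar function, whose coefficients at exponents of B
    vanish when (i, j) is outside B; [monomial_image] extends this to JM. *)
Lemma dcol_J f k : JM f -> exists q, [/\ abounded q,
  forall x, ball2 x -> sums_to q x (dcol v J l f x k 0) & forall i j, B i j -> q i j = 0].
Proof.
case: hJ => _ _ _ least.
pose P f := exists q, [/\ abounded q,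
  forall x, ball2 x -> sums_to q x (dcol v J l f x k 0) & forall i j, B i j -> q i j = 0].
apply: (least P) => [|i j g nB Mg].
  split=> [|c g h [p [bp sp p0]] [q [bq sq q0]]].
    exists (fun _ _ => 0); split=> // [|x bx]; first exact: abounded0.
    have -> : dcol v J l 0 x = 0.
      have := dcol_sum v J l (I := 'I_0) (fun=> 0) (fun=> 0) bx.
      by rewrite !big_ord0.
    rewrite mxE; exact: sums0.
  exists (arr_add (arr_scl c p) q); split=> [|x bx|i j Bij].
  - by apply: abounded_add => //; apply: abounded_scl.
  - rewrite dcol_lin // mxE [X in X + _]mxE; apply: sums_add; [apply: sums_scl; exact: sp|exact: sq].
  - by rewrite /arr_add /arr_scl p0 ?q0 // mulr0 addr0.
have [q [bq sq]] := inP_dcol gv J l g k.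
exists (iter i (@mz R) (iter j (@mw R) q)); split=> [|x bx|i' j' Bij].
- exact: abounded_mzw.
- have -> : dcol v J l (mon i j g) x = (x.1 ^+ i * x.2 ^+ j) *: dcol v J l g x.
    rewrite /dcol scalemxAr; congr (_ *m _).
    by apply/matrixP => p s; rewrite !mxE ev_mon // dtZl.
  rewrite mxE; apply: sums_mzw; exact: sq.
- apply/eqP; rewrite -taylor_eq0 taylor_mzw; case: ifP => // /andP[ii jj].
  case/negP: (notB_shift dB (i' - i) (j' - j) nB); by rewrite !subnK.
Qed.

(** The k-th component of [dcol] turns a relation into a polynomial times delta with no coefficient
    in B. Its coefficient at x + (a, b) isolates c (x, k). *)
Lemma fam_free : free_mod M JM fam.
Proof.
split=> [t|c hc]; first by apply/M_mon/(M_v gv).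
move=> [x k].
have [q [bq sq q0]] := dcol_J k hc.
pose bt (t : T) := arr_scl (c t *+ (k == t.2))
  (iter (val t.1).1 (@mz R) (iter (val t.1).2 (@mw R) D)).
pose phi (t : T) (y : C2 R) := (c t *+ (k == t.2)) *
  (y.1 ^+ (val t.1).1 * y.2 ^+ (val t.1).2 * delta v J l y).
have [Q [bQ sQ tQ]] : exists Q, [/\ abounded Q,
    forall y, ball2 y -> sums_to Q y (\sum_t phi t y)
    & forall i j, taylor Q i j = \sum_t taylor (bt t) i j].
  apply: sums_big => [t|t y b_y]; first exact/abounded_scl/abounded_mzw.
  by apply: sums_scl; apply: sums_mzw; apply: sD.
have hphi y : ball2 y -> \sum_t phi t y = dcol v J l (\sum_t c t *: fam t) y k 0.
  move=> b_y; rewrite dcol_sum // summxE; apply: eq_bigr => t _.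
  have -> : dcol v J l (fam t) y = (y.1 ^+ (val t.1).1 * y.2 ^+ (val t.1).2) *:
      dcol v J l (v (J t.2)) y.
    rewrite /dcol scalemxAr; congr (_ *m _).
    by apply/matrixP => p s; rewrite !mxE ev_mon ?dtZl //; apply: M_v gv _.
  by rewrite mxE [in RHS]mxE dcol_v /phi mulrnAl -!mulrnAr.
have Q0 i j : B i j -> taylor Q i j = 0.
  move=> Bij; apply/eqP; rewrite taylor_eq0; apply/eqP.
  rewrite -(q0 _ _ Bij); apply: (array_eq (phi := fun y => \sum_t phi t y)) => // y b_y.
  by rewrite hphi //; apply: sq.
(* Lexicographic induction upwards: since (a, b) is the first exponent of delta, only smaller
   exponents also contribute to this coefficient. *)
suff key i : forall j (y : {x : 'I_N * 'I_N | B (x.1 + a)%N (x.2 + b)%N}),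
    (val y).1 = i :> nat -> (val y).2 = j :> nat -> c (y, k) = 0 by exact: key.
have [m] := ubnP i; elim: m i => // m IHm i im j.
have [m'] := ubnP j; elim: m' j => // m' IHm' j jm y yi yj.
have := Q0 _ _ (valP y); rewrite tQ (bigD1 (y, k)) //= big1 => [|[t k'] tk].
  rewrite addr0 taylor_scl taylor_mzw !leq_addr eqxx !addKn => /eqP.
  by rewrite mulf_eq0 taylor_eq0 (negPf Dab) orbF => /eqP.
rewrite taylor_scl taylor_mzw /=.
have [kk|] := eqVneq k k'; last by rewrite mul0r.
have ty : t != y by apply: contraNneq tk => ->; rewrite kk.
case: ifP => [/andP[ti0 tj0]|_]; last by rewrite mulr0.
have ti : ((val t).1 <= (val y).1 + a)%N := ti0.
have tj : ((val t).2 <= (val y).2 + b)%N := tj0.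
have [D0|/Dmin D0] := eqVneq (D ((val y).1 + a - (val t).1)%N ((val y).2 + b - (val t).2)%N) 0.
  by rewrite /taylor D0 !mulr0.
suff -> : c (t, k') = 0 by rewrite mul0r.
rewrite -kk; case: D0 => [ai|[ia bj]].
  by apply: (IHm (val t).1 _ (val t).2) => //; lia.
have t1 : (val t).1 = i :> nat by lia.
have t2 : (val t).2 <> j :> nat.
  move=> t2; case/eqP: ty; apply/val_inj; case: (val t) (val y) t1 t2 yi yj => [p1 p2] [s1 s2] /=.
  by move=> e1 e2 e3 e4; congr (_, _); apply/val_inj => /=; rewrite ?e1 ?e2.
by apply: (IHm' (val t).2) => //; lia.
Qed.

Lemma monomial_qdim_lb m : has_qdim M JM m -> (r * nexp_shift N a b B <= m)%N.
Proof.
move=> hm; have := free_mod_leq sM (sJ hJ) fam_free hm.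
by rewrite card_prod card_sig card_ord mulnC.
Qed.

End CountingBelow.

Lemma lex_min_exists (K : nmodType) (D : nat -> nat -> K) : (exists i j, D i j != 0) ->
  exists a b, D a b != 0 /\ forall i j, D i j != 0 -> (a < i)%N \/ (i = a /\ (b <= j)%N).
Proof.
move=> [i0 [j0 h0]].
have [a /asboolP[j hj] amin] := ex_minnP (ex_intro (fun i => `[< exists j, D i j != 0 >]) i0
  (introT (asboolP _) (ex_intro _ j0 h0))).
have [b hb bmin] := ex_minnP (ex_intro (fun j => D a j != 0) j hj).
exists a, b; split=> // i j' hij.
have : (a <= i)%N by apply/amin/asboolP; exists j'.
rewrite leq_eqVlt => /orP[/eqP ai|]; last by left.
by right; split=> //; apply: bmin; rewrite ai.
Qed.

(** The bounds are additive in the naturals to avoid truncated subtraction; the quotient differs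
    from r by at most C / k. *)
Lemma cvg_nat_ratio (R : realType) (u : nat -> nat) r C :
  (forall k, (r * k ^ 2 <= u k + C * k)%N) -> (forall k, (u k <= r * k ^ 2 + C * k)%N) ->
  (fun k => (u k)%:R / k%:R ^+ 2 : R) @ \oo --> (r%:R : R).
Proof.
move=> h1 h2; apply/cvgrPdist_le => e e0.
have Ce : (C%:R / e : R) \is Num.real by apply: num_real.
have := archi_boundP (x := C%:R / e) (divr_ge0 (ler0n _ _) (ltW e0)).
set m := Num.bound _ => hm.
exists m.+1 => // k /= mk.
have k0 : 0 < k%:R :> R by rewrite ltr0n; apply: leq_trans mk.
have kC : C%:R <= e * k%:R.
  rewrite -ler_pdivrMl // mulrC; apply/ltW/(lt_le_trans hm).
  by rewrite ler_nat ltnW.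
have -> : r%:R - (u k)%:R / k%:R ^+ 2 = (r%:R * k%:R ^+ 2 - (u k)%:R) / k%:R ^+ 2 :> R.
  by field; rewrite gt_eqF.
rewrite normrM [X in _ * X]ger0_norm ?invr_ge0 ?sqr_ge0 // ler_pdivrMr ?exprn_gt0 //.
have e1 : `|r%:R * k%:R ^+ 2 - (u k)%:R| <= C%:R * k%:R :> R.
  rewrite ler_norml lerBrDr addrC lerBlDl -natrX -!natrM lerBlDl -!natrD !ler_nat.
  by rewrite addnC h2 h1.
by apply: (le_trans e1); rewrite expr2 mulrA ler_pM2r.
Qed.

(** * The two families of ideals and their limits *)

Section ExponentSets.

(* The exponents of the monomials outside (z ^ k, w ^ k) and (z, w) ^ k. *)
Definition box k i j := ((i < k) && (j < k))%N.
Definition triangle k i j := (i + j < k)%N.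

Lemma down_closed_box k : down_closed (2 * k) (box k).
Proof. by split=> i j; rewrite /box => /andP[? ?]; [apply/andP|apply/andP|]; lia. Qed.

Lemma down_closed_triangle k : down_closed k (triangle k).
Proof. by split=> i j; rewrite /triangle; lia. Qed.

Lemma nexp_sum N (B : nat -> nat -> bool) : nexp N B = (\sum_(i < N) \sum_(j < N) B i j)%N.
Proof.
rewrite /nexp -sum1_card pair_big /= big_mkcond /=; apply: eq_bigr => -[i j] _.
by rewrite inE /=; case: (B i j).
Qed.

Lemma sum_lt N k : (\sum_(i < N) (i < k)%N = minn k N)%N.
Proof.
elim: N => [|N IHN]; first by rewrite big_ord0 minn0.
by rewrite big_ord_recr /= IHN; case: ltnP => h; lia.
Qed.

Lemma nexp_box k : nexp (2 * k) (box k) = (k ^ 2)%N.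
Proof.
rewrite nexp_sum.
under eq_bigr => i _ do under eq_bigr => j _ do rewrite /box -mulnb.
under eq_bigr do rewrite -big_distrr /=.
by rewrite -big_distrl /= !sum_lt; have -> : minn k (2 * k) = k by lia.
Qed.

Lemma nexp_triangle k : (2 * nexp k (triangle k) = k ^ 2 + k)%N.
Proof.
rewrite nexp_sum.
have h i : (i <= k)%N -> (\sum_(j < k) triangle k i j = k - i)%N.
  move=> ik; rewrite (eq_bigr (fun j : 'I_k => ((j < k - i) : nat))) => [|j _].
    by rewrite sum_lt; lia.
  by congr nat_of_bool; rewrite /triangle; lia.
rewrite (eq_bigr (fun i : 'I_k => (k - i)%N)) => [|i _]; last by apply/h/ltnW.
have h2 m : (m <= k -> 2 * \sum_(i < m) (k - i) = m * (2 * k + 1 - m))%N.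
  elim: m => [|m IHm] mk; first by rewrite big_ord0.
  rewrite big_ord_recr /= mulnDr (IHm (ltnW mk)).
  have [p ep] : exists p, k = (m.+1 + p)%N by exists (k - m.+1)%N; lia.
  have -> : (k - m = p.+1)%N by lia.
  have -> : (2 * k + 1 - m = m + 2 * p + 3)%N by lia.
  have -> : (2 * k + 1 - m.+1 = m + 2 * p + 2)%N by lia.
  ring.
rewrite h2 //; have -> : (2 * k + 1 - k = k + 1)%N by lia.
ring.
Qed.

End ExponentSets.

Section Asymptotics.
Variables (R : realType) (X : fock_submodule R).
Local Notation K := R[i].
Local Notation L := (fsL X).
Local Notation H := (fsH X).
Local Notation M := (@fsM R X).
Local Notation sM := (fs_sub X).
Variables (n : nat) (v : 'I_n -> H).
Hypothesis gv : generators v.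
Variables (r : nat) (J : 'I_r -> 'I_n) (l : 'I_r -> L).
Hypothesis rmax : forall (J' : 'I_(r + 1) -> 'I_n) (l' : 'I_(r + 1) -> L) x,
  ball2 x -> \det (vmat v J' l' x) = 0.
Hypothesis delta_n0 : exists2 x, ball2 x & delta v J l x != 0.

(** The constant depends on the generators and on delta only, and thus serves both families of
    ideals and every k. *)
Lemma monomial_qdim_bounds : exists C, forall N B (JM : set H),
  down_closed N B -> monomial_image B JM ->
  exists m, [/\ has_qdim M JM m, (r * nexp N B <= m + C * N)%N & (m <= r * nexp N B + C * N)%N].
Proof.
have [D [bD sD]] := inP_delta gv J l.
have Dn0 : exists i j, D i j != 0.
  apply: contrapT => h; have [x bx] := delta_n0; case/eqP.
  apply: (sums_unique (sD x bx)).
  have -> : D = fun _ _ => 0; last exact: sums0.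
  apply/funext => i; apply/funext => j; apply/eqP; apply: contrapT => hij.
  by apply: h; exists i, j; apply/negP.
have [a [b [Dab Dmin]]] := lex_min_exists Dn0.
exists ((n + r) * (a + b))%N => N B JM dB hJ.
have [m hm qm] := monomial_qdim_ub gv rmax bD sD Dab Dmin dB hJ.
exists m; split=> //; last first.
  by apply: (leq_trans hm); rewrite leq_add2l; have := nexp_low_le N a b B; nia.
have := monomial_qdim_lb gv bD sD Dab Dmin dB hJ qm.
have := nexp_shift_ge N a b B; nia.
Qed.

Lemma box_limit (JM : nat -> set H) : (forall k, monomial_image (box k) (JM k)) ->
  (forall k, qfindim M (JM k)) /\
  ((fun k => (qdim M (JM k))%:R / k%:R ^+ 2 : R) @ \oo --> (r%:R : R)).
Proof.
move=> hJ; have [C hC] := monomial_qdim_bounds.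
have qd k := hC _ _ _ (down_closed_box k) (hJ k).
have h k : (r * k ^ 2 <= qdim M (JM k) + 2 * C * k)%N /\ (qdim M (JM k) <= r * k ^ 2 + 2 * C * k)%N.
  have [m [qm]] := qd k; rewrite nexp_box (qdimE sM (sJ (hJ k)) qm).
  by have -> : (C * (2 * k) = 2 * C * k)%N by ring.
split=> [k|]; first by have [m [qm _ _]] := qd k; exists m.
by apply: (@cvg_nat_ratio R _ r (2 * C)) => k; case: (h k).
Qed.

Lemma triangle_limit (JM : nat -> set H) : (forall k, monomial_image (triangle k) (JM k)) ->
  (forall k, qfindim M (JM k)) /\
  ((fun k => (2`!)%:R * ((qdim M (JM k))%:R / k%:R ^+ 2) : R) @ \oo --> (r%:R : R)).
Proof.
move=> hJ; have [C hC] := monomial_qdim_bounds.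
have qd k := hC _ _ _ (down_closed_triangle k) (hJ k).
have h k : (r * k ^ 2 <= 2 * qdim M (JM k) + (2 * C + r) * k)%N /\
    (2 * qdim M (JM k) <= r * k ^ 2 + (2 * C + r) * k)%N.
  have [m [qm]] := qd k; rewrite (qdimE sM (sJ (hJ k)) qm).
  (* The triangle has (k^2 + k) / 2 exponents; the 2 explains the factorial in the Samuel
     multiplicity, and r k joins the error term. *)
  by have := nexp_triangle k; nia.
split=> [k|]; first by have [m [qm _ _]] := qd k; exists m.
have := @cvg_nat_ratio R (fun k => 2 * qdim M (JM k))%N r (2 * C + r).
move=> /(_ (fun k => (h k).1) (fun k => (h k).2)).
by under eq_fun do rewrite natrM -mulrA.
Qed.

End Asymptotics.

(** * Division of scalar cycles *)

Section Division.
Variable R : realType.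
Local Notation K := R[i].
Implicit Types (p q psi : nat -> nat -> K) (l : K).

Definition mz_sub l psi := arr_add (mz psi) (arr_scl (- l) psi).
Definition mw_sub l psi := arr_add (mw psi) (arr_scl (- l) psi).

Definition array_cycle l1 l2 p q :=
  forall i j, mz p i j + mw q i j = l1 * p i j + l2 * q i j.

Lemma mzD p q i j : mz (arr_add p q) i j = mz p i j + mz q i j.
Proof. by case: i => [|i] /=; rewrite /arr_add ?addr0 ?mulrDr. Qed.

Lemma mwD p q i j : mw (arr_add p q) i j = mw p i j + mw q i j.
Proof. by case: j => [|j] /=; rewrite /arr_add ?addr0 ?mulrDr. Qed.

Lemma mzZ l p i j : mz (arr_scl l p) i j = l * mz p i j.
Proof. by case: i => [|i] /=; rewrite /arr_scl ?mulr0 // mulrCA. Qed.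

Lemma mwZ l p i j : mw (arr_scl l p) i j = l * mw p i j.
Proof. by case: j => [|j] /=; rewrite /arr_scl ?mulr0 // mulrCA. Qed.

Lemma mzw_comm p i j : mz (mw p) i j = mw (mz p) i j.
Proof.
apply: (@mulfI _ ('C(i + j, i)%:R)); first by rewrite pnatr_eq0 -lt0n bin_gt0 leq_addr.
rewrite -/(taylor (mz (mw p)) i j) -/(taylor (mw (mz p)) i j) taylor_mz taylor_mw.
by case: i => [|i]; case: j => [|j]; rewrite ?taylor_mw ?taylor_mz.
Qed.

Lemma weight_cancel (k n : nat) (x y : K) :
  k%:R / n.+1%:R * (n.+1%:R / n.+2%:R * (x - y)) = (k%:R * x - k%:R * y) / n.+2%:R.
Proof.
by rewrite -mulrBr mulrA [_ * (n.+1%:R / _)]mulrA divfK ?pnatr_eq0 // mulrAC.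
Qed.

Lemma weight_split (i j : nat) (x : K) :
  x = (i.+1%:R * x + j.+1%:R * x) / (i + j).+2%:R.
Proof.
rewrite -mulrDl -natrD addSn addnS mulrAC divff ?mul1r // pnatr_eq0 //.
Qed.

Section Step.
Variables (l1 l2 : K) (p q : nat -> nat -> K).
Hypothesis cpq : array_cycle l1 l2 p q.

(** By the cycle relation e is also zp + wq. As z (sh1 e) + w (sh2 e) = e, the pair (p1, q1) is an
    exact cycle at the origin, and e is small with l. *)
Let e := arr_add (arr_scl l1 p) (arr_scl l2 q).
Let p1 := arr_add p (arr_scl (-1) (sh1 e)).
Let q1 := arr_add q (arr_scl (-1) (sh2 e)).
(** The quotient for which p1 = - w psi and q1 = z psi. Taking the difference of the two equations
    gives coefficients at most 1, whereas solving a single one would divide by i + 1 or j + 1. *)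
Let psi i j := (i + j).+1%:R / (i + j).+2%:R * (q1 i.+1 j - p1 i j.+1).

(** The equation z p1 + w q1 = 0 in normalised coefficients, cleared of the denominator i + j +
    2. *)
Lemma euler_relation i j : i.+1%:R * p1 i j.+1 + j.+1%:R * q1 i.+1 j = 0.
Proof.
have := cpq i.+1 j.+1; rewrite /= -[l1 * _ + _]/(e i.+1 j.+1) => he.
have n0 : (i.+1 + j.+1)%:R != 0 :> K by rewrite pnatr_eq0 addSn.
have he' : i.+1%:R * p i j.+1 + j.+1%:R * q i.+1 j = (i.+1%:R + j.+1%:R) * e i.+1 j.+1.
  rewrite -he -natrD mulrDr !mulrA; congr (_ * _ + _ * _); by rewrite mulrAC divff ?mul1r.
rewrite /p1 /q1 /arr_add /arr_scl /sh1 /sh2 !mulN1r !mulrBr addrACA -opprD -mulrDl he'.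
by rewrite subrr.
Qed.

Lemma p_division i j : p i j + mw psi i j = sh1 e i j.
Proof.
case: j => [|j] /=.
  have := cpq i.+1 0; rewrite /= -[l1 * _ + _]/(e i.+1 0%N) addn0 divff ?pnatr_eq0 //.
  by rewrite mul1r => ->.
have h := euler_relation i j.
have e1 : sh1 e i j.+1 = p i j.+1 - p1 i j.+1.
  by rewrite /p1 /arr_add /arr_scl mulN1r opprB addrC subrK.
rewrite e1; congr (_ + _); rewrite /psi.
set P := p1 i j.+1 in h *; set Q := q1 i.+1 j in h *.
have hQ : j.+1%:R * Q = - (i.+1%:R * P) by apply/eqP; rewrite -addr_eq0 addrC h.
rewrite addnS weight_cancel hQ -opprD mulNr; congr (- _).
by rewrite [RHS](weight_split i j).
Qed.

Lemma q_division i j : q i j - mz psi i j = sh2 e i j.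
Proof.
case: i => [|i] /=.
  have := cpq 0 j.+1; rewrite /= -[l1 * _ + _]/(e 0%N j.+1) add0n divff ?pnatr_eq0 //.
  by rewrite mul1r add0r subr0 => ->.
have h := euler_relation i j.
have e1 : sh2 e i.+1 j = q i.+1 j - q1 i.+1 j.
  by rewrite /q1 /arr_add /arr_scl mulN1r opprB addrC subrK.
rewrite e1; congr (_ - _); rewrite /psi.
set P := p1 i j.+1 in h *; set Q := q1 i.+1 j in h *.
have hP : i.+1%:R * P = - (j.+1%:R * Q) by apply/eqP; rewrite -addr_eq0 h.
rewrite addSn weight_cancel hP opprK.
by rewrite [RHS](weight_split i j).
Qed.

Lemma asq_psi n : asq n psi <= 2 * asq n.+1 q1 + 2 * asq n.+1 p1.
Proof.
apply: (@le_trans _ _ (asq n (arr_add (sh1 q1) (arr_scl (-1) (sh2 p1))))).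
  apply: ts_le => i j; rewrite /psi normcM exprMn /arr_add /arr_scl mulN1r.
  rewrite ler_piMl ?sqr_ge0 // expr_le1 ?normc_ge0 //.
  rewrite normcM normc_nat.
  have -> : normc ((i + j).+2%:R^-1 : K) = (i + j).+2%:R^-1.
    by apply: (mulfI (x := (i + j).+2%:R)); rewrite ?pnatr_eq0 // -{1}normc_nat -normcM !divff ?pnatr_eq0 // normc1.
  by rewrite ler_pdivrMr ?ltr0n // mul1r ler_nat.
apply: (le_trans (asq_add _ _ _)); rewrite lerD // ler_wpM2l ?asq_sh1 //.
by rewrite asq_scl normcN normc1 expr1n mul1r asq_sh2.
Qed.

Variable C : R.
Hypothesis hC : forall n, asq n p + asq n q <= C.
Hypothesis small1 : normc l1 ^+ 2 <= 64^-1.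
Hypothesis small2 : normc l2 ^+ 2 <= 64^-1.

Lemma asq_e n : asq n e <= C / 32.
Proof.
apply: (le_trans (asq_add _ _ _)); rewrite !asq_scl.
have h1 := asq_ge0 n p; have h2 := asq_ge0 n q; have h := hC n.
have k1 : normc l1 ^+ 2 * asq n p <= 64^-1 * asq n p by apply: ler_wpM2r.
have k2 : normc l2 ^+ 2 * asq n q <= 64^-1 * asq n q by apply: ler_wpM2r.
lra.
Qed.

Lemma asq_psi_le n : asq n psi <= 5 * C.
Proof.
have := asq_psi n.
have a1 : asq n.+1 p1 <= 2 * asq n.+1 p + 2 * asq n.+1 (sh1 e).
  by apply: (le_trans (asq_add _ _ _)); rewrite asq_scl normcN normc1 expr1n mul1r.
have a2 : asq n.+1 q1 <= 2 * asq n.+1 q + 2 * asq n.+1 (sh2 e).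
  by apply: (le_trans (asq_add _ _ _)); rewrite asq_scl normcN normc1 expr1n mul1r.
have a3 := asq_sh n.+1 e; have a4 := asq_e n.+2; have a5 := hC n.+1.
have c0 : 0 <= C by have := asq_ge0 0 p; have := asq_ge0 0 q; have := hC 0; lra.
lra.
Qed.

(** The corrected pair is (sh1 e - l2 psi, sh2 e + l1 psi), where |e|^2 <= C/32 and |psi|^2 <= 5 C;
    with |l_i|^2 <= 1/64 it totals at most C/16 + 5 C/16. *)
Lemma division_step : exists psi, [/\ abounded psi,
  array_cycle l1 l2 (arr_add p (mw_sub l2 psi)) (arr_add q (arr_scl (-1) (mz_sub l1 psi)))
  & forall n, asq n (arr_add p (mw_sub l2 psi)) +
      asq n (arr_add q (arr_scl (-1) (mz_sub l1 psi))) <= C / 2].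
Proof.
exists psi; split=> [|i j|n].
- by exists (5 * C) => n; apply: asq_psi_le.
- rewrite mzD mwD mwZ /mw_sub /mz_sub mzD mwD mzZ mwZ mzw_comm.
  rewrite addrACA cpq /arr_add /arr_scl; ring.
have -> : arr_add p (mw_sub l2 psi) = arr_add (sh1 e) (arr_scl (- l2) psi).
  by apply/funext => i; apply/funext => j; rewrite /arr_add -p_division /mw_sub /arr_add addrA.
have -> : arr_add q (arr_scl (-1) (mz_sub l1 psi)) = arr_add (sh2 e) (arr_scl l1 psi).
  apply/funext => i; apply/funext => j.
  by rewrite /arr_add -q_division /mz_sub /arr_add /arr_scl; ring.
have a1 := asq_add n (sh1 e) (arr_scl (- l2) psi).
have a2 := asq_add n (sh2 e) (arr_scl l1 psi).
have a3 := asq_sh n e; have a4 := asq_e n.+1; have a5 := asq_psi_le n.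
rewrite !asq_scl normcN in a1 a2.
have h := asq_ge0 n psi.
have k1 : normc l1 ^+ 2 * asq n psi <= 64^-1 * asq n psi by apply: ler_wpM2r.
have k2 : normc l2 ^+ 2 * asq n psi <= 64^-1 * asq n psi by apply: ler_wpM2r.
lra.
Qed.

End Step.

(* Each application of [division_step] halves the obstruction to the cycle
   (p, q) being the boundary of an array. *)
Lemma array_division l1 l2 p q C k : array_cycle l1 l2 p q ->
  (forall n, asq n p + asq n q <= C) ->
  normc l1 ^+ 2 <= 64^-1 -> normc l2 ^+ 2 <= 64^-1 ->
  exists psi, abounded psi /\ forall n, asq n (arr_add p (mw_sub l2 psi)) +
      asq n (arr_add q (arr_scl (-1) (mz_sub l1 psi))) <= C / 2 ^+ k.
Proof.
move=> cpq hC s1 s2; elim: k p q C cpq hC => [|k IHk] p q C cpq hC.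
  exists (fun _ _ => 0); split; first exact: abounded0.
  have -> : mw_sub l2 (fun _ _ => 0) = fun _ _ => 0.
    apply/funext => i; apply/funext => j; rewrite /mw_sub /arr_add /arr_scl mulr0 addr0.
    by case: j => //= j; rewrite mulr0.
  have -> : mz_sub l1 (fun _ _ => 0) = fun _ _ => 0.
    apply/funext => i; apply/funext => j; rewrite /mz_sub /arr_add /arr_scl mulr0 addr0.
    by case: i => //= i; rewrite mulr0.
  have z r : arr_add r (fun _ _ => 0) = r.
    by apply/funext => i; apply/funext => j; rewrite /arr_add addr0.
  have -> : arr_scl (-1 : K) (fun _ _ => 0) = fun _ _ => 0.
    by apply/funext => i; apply/funext => j; rewrite /arr_scl mulr0.
  by rewrite !z expr0 divr1.
have [psi1 [b1 c1 h1]] := division_step cpq hC s1 s2.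
have [psi2 [b2 h2]] := IHk _ _ _ c1 h1.
exists (arr_add psi1 psi2); split; first exact: abounded_add.
move=> n; have := h2 n.
have -> : C / 2 / 2 ^+ k = C / 2 ^+ k.+1 by rewrite exprS invfM mulrA.
apply: le_trans; rewrite le_eqVlt; apply/orP; left; apply/eqP.
congr (asq n _ + asq n _); apply/funext => i; apply/funext => j.
  by rewrite /mw_sub /arr_add mwD /arr_scl; ring.
by rewrite /mz_sub /arr_add /arr_scl mzD; ring.
Qed.

End Division.

(** * Cycles at a nearby point *)

Section Approximation.
Variables (R : realType) (V : lmodType R[i]) (d : ip V).
Implicit Types (S : set V) (x y : V).

Definition approx S x := forall e : R, 0 < e -> exists2 y, S y & nm d (x - y) < e.

Lemma sub_approx S x : S x -> approx S x.
Proof. by move=> Sx e e0; exists x; rewrite ?subrr ?nm0. Qed.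

Lemma approx_sub S S' x : (forall y, S y -> S' y) -> approx S x -> approx S' x.
Proof. by move=> h Sx e /Sx[y /h Sy he]; exists y. Qed.

Lemma approx_approx S x :
  (forall e : R, 0 < e -> exists2 y, approx S y & nm d (x - y) < e) -> approx S x.
Proof.
move=> h e e0; have e2 : 0 < e / 2 by rewrite divr_gt0.
have [y hy xy] := h _ e2; have [z Sz yz] := hy _ e2.
by exists z => //; have := nm_dist d y x z; lra.
Qed.

Lemma lsub_approx S : lsub S -> lsub (approx S).
Proof.
move=> sS; split=> [|a x y Sx Sy e e0]; first by apply: sub_approx; exact: sub0 sS.
have k0 : 0 < normc a + 1 by rewrite ltr_wpDl ?normc_ge0.
have e2 : 0 < e / 2 by rewrite divr_gt0.
have [x' Sx' hx] := Sx _ (divr_gt0 e2 k0); have [y' Sy' hy] := Sy _ e2.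
exists (a *: x' + y'); first exact: sS.2.
rewrite opprD addrACA -scalerBr; apply: (le_lt_trans (nmD _ _ _)); rewrite nmZ.
have h1 : normc a * nm d (x - x') <= e / 2.
  apply: (@le_trans _ _ ((normc a + 1) * (e / 2 / (normc a + 1)))).
    by apply: ler_pM; [exact: normc_ge0|exact: nm_ge0|rewrite lerDl|exact: ltW].
  by rewrite mulrC divfK // gt_eqF.
lra.
Qed.

Lemma lims_approx S (u : nat -> V) x : lims d u x -> (forall n, approx S (u n)) -> approx S x.
Proof.
move=> ux Su; apply: approx_approx => e /ux[n hn]; exists (u n) => //.
by rewrite nm_distC hn.
Qed.

Lemma limsZ (u : nat -> V) x c : lims d u x -> lims d (fun n => c *: u n) (c *: x).
Proof.
move=> ux e e0; have k0 : 0 < normc c + 1 by rewrite ltr_wpDl ?normc_ge0.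
have [n hn] := ux _ (divr_gt0 e0 k0); exists n => m /hn h.
rewrite -scalerBr nmZ; apply: (@le_lt_trans _ _ ((normc c + 1) * nm d (u m - x))).
  by rewrite ler_wpM2r ?nm_ge0 // lerDl.
by rewrite mulrC -ltr_pdivlMr.
Qed.

Lemma lims_cst x : lims d (fun=> x) x.
Proof. by move=> e e0; exists 0%N => n _; rewrite subrr nm0. Qed.

Lemma lims_eval (u : nat -> R[i]) c x :
  (forall e : R, 0 < e -> exists n0, forall n, (n0 <= n)%N -> normc (u n - c) < e) ->
  lims d (fun n => u n *: x) (c *: x).
Proof.
move=> uc e e0; have k0 : 0 < nm d x + 1 by rewrite ltr_wpDl ?nm_ge0.
have [n hn] := uc _ (divr_gt0 e0 k0); exists n => m /hn h.
rewrite -scalerBl nmZ; apply: (@le_lt_trans _ _ (normc (u m - c) * (nm d x + 1))).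
  by rewrite ler_wpM2l ?normc_ge0 // lerDl.
by rewrite -ltr_pdivlMr.
Qed.

End Approximation.

Section ShiftImage.
Variables (R : realType) (V : lmodType R[i]) (d : ip V).
Local Notation K := R[i].
Variables (E : set V) (sE : lsub E) (cE : complete_set d E).
Variables (Z W : V -> V).
Hypotheses (EZ : forall x, E x -> E (Z x)) (EW : forall x, E x -> E (W x)).
Hypotheses
  (linZ : forall a x y, E x -> E y -> Z (a *: x + y) = a *: Z x + Z y)
  (linW : forall a x y, E x -> E y -> W (a *: x + y) = a *: W x + W y)
  (rowc : forall f g, E f -> E g -> sqn d (Z f + W g) <= sqn d f + sqn d g).

(* With adjZ, adjW the adjoints of Z, W and k' = (1 - l1 adjZ - l2 adjW)^-1 k, the
   difference of k and the defect of k' is (Z - l1) adjZ k' + (W - l2) adjW k'. *)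
Lemma mult_mod_shift l1 l2 k : normc l1 + normc l2 <= 2^-1 -> E k ->
  exists u C, is_mult d E Z W u C /\ shift_image E Z W l1 l2 (k - u).
Proof.
move=> hl Ek.
pose adjZ := Zadj sE cE linZ linW rowc; pose adjW := Wadj sE cE linZ linW rowc.
have EA1 y : E (adjZ y) by apply: E_Zadj.
have EA2 y : E (adjW y) by apply: E_Wadj.
have nA1 y : nm d (adjZ y) <= nm d y by apply: Zadj_nm.
have nA2 y : nm d (adjW y) <= nm d y by apply: Wadj_nm.
pose A y := y - (l1 *: adjZ y + l2 *: adjW y).
have nA y : nm d (l1 *: adjZ y + l2 *: adjW y) <= 2^-1 * nm d y.
  apply: (le_trans (nmD _ _ _)); rewrite !nmZ.
  have h1 : normc l1 * nm d (adjZ y) <= normc l1 * nm d y by rewrite ler_wpM2l ?normc_ge0.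
  have h2 : normc l2 * nm d (adjW y) <= normc l2 * nm d y by rewrite ler_wpM2l ?normc_ge0.
  have h3 : (normc l1 + normc l2) * nm d y <= 2^-1 * nm d y by rewrite ler_wpM2r ?nm_ge0.
  by rewrite mulrDl in h3; lra.
have [k' Ek' Ak] : exists2 k', E k' & A k' = k.
  apply: (lax_milgram sE cE (A := A) (c := 2^-1) (K := 2)) => //.
  - by rewrite invr_gt0 ltr0n.
  - by move=> y Ey; apply: (subB sE) => //; apply: (subD sE); apply: (subZ sE).
  - move=> x y Ex Ey; rewrite /A /adjZ /adjW ZadjB // WadjB // -/adjZ -/adjW !scalerBr.
    by rewrite [X in _ - X = _]addr_subACA [LHS]subr_subACA.
  - move=> y Ey; apply: (le_trans (nmB _ _ _)); have := nA y; have := nm_ge0 d y; lra.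
  - move=> y Ey; rewrite /A /rd dtBl ReB -/(sqn d y) -/(rd d _ y).
    have := rd_le d (l1 *: adjZ y + l2 *: adjW y) y.
    have := ler_wpM2r (nm_ge0 d y) (nA y); rewrite -mulrA -expr2 nmsq; lra.
exists (defect sE cE linZ linW rowc k'), (dfq sE cE linZ linW rowc k').
split; first exact: defect_is_mult.
exists (adjZ k'), (adjW k'); split=> //.
rewrite -Ak /A /defect -/adjZ -/adjW addr_subACA.
rewrite -[k' - _ - W _]addrA -opprD [LHS]subr_subACA subrr sub0r opprB //.
Qed.

(** [epol_sub_eval] in the limit; only the closure of the image is reached, since the image is not
    known to be closed. *)
Lemma acts_sub_eval l1 l2 b u F y : E u -> sums_to b (l1, l2) y ->
  acts d E Z W b u F -> approx d (shift_image E Z W l1 l2) (F - y *: u).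
Proof.
move=> Eu sb aF.
have h n : approx d (shift_image E Z W l1 l2) (epol Z W n b u - aev n b (l1, l2) *: u).
  by apply: sub_approx; apply: epol_sub_eval.
apply: lims_approx h; apply: limsD; first exact: aF.2.
rewrite -scaleNr; under eq_fun do rewrite -scaleNr.
apply: lims_eval => e /sb[n hn]; exists n => m /hn.
by rewrite -normcN opprB opprK addrC.
Qed.

End ShiftImage.

(** * The Hilbert space of pairs *)

Section ProductSpace.
Variables (R : realType) (V : lmodType R[i]) (d : ip V).
Local Notation V2 := (V * V)%type.

Definition prod_dt (p q : V2) := d p.1 q.1 + d p.2 q.2.

Lemma prod_dt_lin a x y z : prod_dt (a *: x + y) z = a * prod_dt x z + prod_dt y z.
Proof. by rewrite /prod_dt /= !ip_lin mulrDr addrACA. Qed.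

Lemma prod_dt_sym x y : prod_dt y x = Num.conj (prod_dt x y).
Proof. by rewrite /prod_dt rmorphD /= -!ip_sym. Qed.

Lemma prod_dt_pos x : x != 0 -> 0 < prod_dt x x.
Proof.
case: x => x y h; have [x0|x0] := eqVneq x 0.
  have y0 : y != 0 by apply: contraNneq h => y0; rewrite x0 y0.
  by rewrite /prod_dt x0 dt0l add0r ip_pos.
rewrite /prod_dt ltr_wpDr ?ip_pos //.
by have [->|y0] := eqVneq y 0; rewrite ?dt0l // ltW // ip_pos.
Qed.

Definition ip_prod : ip V2 := Ip prod_dt_lin prod_dt_sym prod_dt_pos.

Lemma sqn_prod p : sqn ip_prod p = sqn d p.1 + sqn d p.2.
Proof. by rewrite /sqn /rd /= /prod_dt ReD. Qed.

Lemma nm_fst p : nm d p.1 <= nm ip_prod p.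
Proof. by rewrite nm_le ?nm_ge0 // nmsq sqn_prod lerDl sqn_ge0. Qed.

Lemma nm_snd p : nm d p.2 <= nm ip_prod p.
Proof. by rewrite nm_le ?nm_ge0 // nmsq sqn_prod lerDr sqn_ge0. Qed.

Lemma nm_prod p : nm ip_prod p <= nm d p.1 + nm d p.2.
Proof.
rewrite nm_le ?addr_ge0 ?nm_ge0 // sqn_prod sqrrD !nmsq.
have := mulr_ge0 (nm_ge0 d p.1) (nm_ge0 d p.2); lra.
Qed.

Lemma lims_fst (u : nat -> V2) p : lims ip_prod u p -> lims d (fun n => (u n).1) p.1.
Proof.
move=> up e /up[n hn]; exists n => m /hn; apply: le_lt_trans.
exact: (nm_fst (u m - p)).
Qed.

Lemma lims_snd (u : nat -> V2) p : lims ip_prod u p -> lims d (fun n => (u n).2) p.2.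
Proof.
move=> up e /up[n hn]; exists n => m /hn; apply: le_lt_trans.
exact: (nm_snd (u m - p)).
Qed.

Lemma lims_pair (u : nat -> V2) p : lims d (fun n => (u n).1) p.1 ->
  lims d (fun n => (u n).2) p.2 -> lims ip_prod u p.
Proof.
move=> h1 h2 e e0; have e2 : 0 < e / 2 by rewrite divr_gt0.
have [n1 k1] := h1 _ e2; have [n2 k2] := h2 _ e2.
exists (maxn n1 n2) => n; rewrite geq_max => /andP[/k1 H1 /k2 H2].
by apply: (le_lt_trans (nm_prod (u n - p))); move: H1 H2 => /=; lra.
Qed.

End ProductSpace.

Section Cycles.
Variables (R : realType) (X : fock_submodule R).
Local Notation K := R[i].
Local Notation L := (fsL X).
Local Notation H := (fsH X).
Local Notation M := (@fsM R X).
Local Notation Z := (@fsZ R X).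
Local Notation W := (@fsW R X).
Local Notation d := (fs_d X).
Local Notation dL := (fs_dL X).
Local Notation ev := (@fs_ev R X).
Local Notation sM := (fs_sub X).
Local Notation epolX := (epol Z W).
Local Notation d2 := (ip_prod d).
Variables (l1 l2 : K).
Implicit Types (p q : (H * H)%type).

Definition zs f := Z f - l1 *: f.
Definition ws f := W f - l2 *: f.

Lemma M_zs f : M f -> M (zs f).
Proof. by move=> Mf; apply: (subB sM); [apply: fs_Z|apply: (subZ sM)]. Qed.

Lemma M_ws f : M f -> M (ws f).
Proof. by move=> Mf; apply: (subB sM); [apply: fs_W|apply: (subZ sM)]. Qed.

Lemma ev_zs f x : M f -> ball2 x -> ev (zs f) x = (x.1 - l1) *: ev f x.
Proof. by move=> Mf bx; rewrite evSB // evSZ // fs_evZ // scalerBl. Qed.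

Lemma ev_ws f x : M f -> ball2 x -> ev (ws f) x = (x.2 - l2) *: ev f x.
Proof. by move=> Mf bx; rewrite evSB // evSZ // fs_evW // scalerBl. Qed.

Lemma zs_lin c f g : M f -> M g -> zs (c *: f + g) = c *: zs f + zs g.
Proof.
move=> Mf Mg; have Mfg := sM.2 c _ _ Mf Mg.
apply: fs_ev_inj => x bx; rewrite fs_ev_lin // !ev_zs // fs_ev_lin //.
by rewrite scalerDr !scalerA mulrC.
Qed.

Lemma ws_lin c f g : M f -> M g -> ws (c *: f + g) = c *: ws f + ws g.
Proof.
move=> Mf Mg; have Mfg := sM.2 c _ _ Mf Mg.
apply: fs_ev_inj => x bx; rewrite fs_ev_lin // !ev_ws // fs_ev_lin //.
by rewrite scalerDr !scalerA mulrC.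
Qed.

Lemma zs_ws f : M f -> zs (ws f) = ws (zs f).
Proof.
move=> Mf; have M1 := M_zs Mf; have M2 := M_ws Mf.
by apply: fs_ev_inj => x bx; rewrite ev_zs // ev_ws // ev_ws // ev_zs // !scalerA mulrC.
Qed.

Lemma lims_Z (u : nat -> H) f : (forall n, M (u n)) -> M f -> lims d u f ->
  lims d (fun n => Z (u n)) (Z f).
Proof.
move=> Mu Mf uf e /uf[n hn]; exists n => m /hn; apply: le_lt_trans.
rewrite -(ZB (@linZ _ X)) //.
by apply: (nmZ_le sM (@linW _ X) (@fs_row _ X)); apply: (subB sM).
Qed.

Lemma lims_W (u : nat -> H) f : (forall n, M (u n)) -> M f -> lims d u f ->
  lims d (fun n => W (u n)) (W f).
Proof.
move=> Mu Mf uf e /uf[n hn]; exists n => m /hn; apply: le_lt_trans.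
rewrite -(WB (@linW _ X)) //.
by apply: (nmW_le sM (@linZ _ X) (@fs_row _ X)); apply: (subB sM).
Qed.

Definition cycles : set (H * H)%type := [set p | [/\ M p.1, M p.2 & zs p.1 + ws p.2 = 0]].
Definition bnd h : (H * H)%type := (- ws h, zs h).
Definition boundaries : set (H * H)%type := [set bnd h | h in M].

Lemma bnd_lin c f g : M f -> M g -> bnd (c *: f + g) = c *: bnd f + bnd g.
Proof.
move=> Mf Mg; rewrite /bnd zs_lin // ws_lin //; apply: injective_projections => //=.
by rewrite opprD scalerN.
Qed.

Lemma lsub_boundaries : lsub boundaries.
Proof.
split=> [|c _ _ [f Mf <-] [g Mg <-]]; last first.
  by exists (c *: f + g); [apply: sM.2|rewrite bnd_lin].
exists 0; first exact: sub0 sM.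
by have := bnd_lin (-1) (sub0 sM) (sub0 sM); rewrite scaler0 addr0 scaleN1r addNr.
Qed.

Lemma lsub_cycles : lsub cycles.
Proof.
have z0 : zs 0 = 0.
  by have := zs_lin (-1) (sub0 sM) (sub0 sM); rewrite scaler0 addr0 scaleN1r addNr.
have w0 : ws 0 = 0.
  by have := ws_lin (-1) (sub0 sM) (sub0 sM); rewrite scaler0 addr0 scaleN1r addNr.
split=> [|c p q [Mp1 Mp2 hp] [Mq1 Mq2 hq]].
  by split; rewrite ?z0 ?w0 ?addr0 //; apply: sub0 sM.
split; try by apply: sM.2.
by rewrite /= zs_lin // ws_lin // addrACA -scalerDr hp hq scaler0 addr0.
Qed.

(** With [cycles_Z2], [cycles_W2] and [row2] this makes the cycles a complete space with a row
    contraction, to which the multiplier argument applies as it does to M. *)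
Lemma cycles_complete : complete_set d2 cycles.
Proof.
move=> u cu hu.
have c1 : cauchy_seq d (fun n => (u n).1).
  move=> e /hu[n hn]; exists n => m k nm nk; apply: le_lt_trans (hn m k nm nk).
  exact: (nm_fst d (u m - u k)).
have c2 : cauchy_seq d (fun n => (u n).2).
  move=> e /hu[n hn]; exists n => m k nm nk; apply: le_lt_trans (hn m k nm nk).
  exact: (nm_snd d (u m - u k)).
have M1 n : M (u n).1 by case: (cu n).
have M2 n : M (u n).2 by case: (cu n).
have [f Mf hf] := @fs_complete _ X _ M1 c1.
have [g Mg hg] := @fs_complete _ X _ M2 c2.
exists (f, g); last exact: lims_pair.
split=> //=; apply: (lims_unique (d := d) (u := fun n => zs (u n).1 + ws (u n).2)).
  apply: limsD; rewrite /zs /ws.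
    have -> : (fun n => Z (u n).1 - l1 *: (u n).1) = (fun n => Z (u n).1 + (- l1) *: (u n).1).
      by apply/funext => n; rewrite scaleNr.
    by rewrite -scaleNr; apply: limsD; [apply: lims_Z|apply: limsZ].
  have -> : (fun n => W (u n).2 - l2 *: (u n).2) = (fun n => W (u n).2 + (- l2) *: (u n).2).
    by apply/funext => n; rewrite scaleNr.
  by rewrite -scaleNr; apply: limsD; [apply: lims_W|apply: limsZ].
have -> : (fun n => zs (u n).1 + ws (u n).2) = fun=> 0; last exact: lims_cst.
by apply/funext => n; case: (cu n).
Qed.

Definition Z2 p := (Z p.1, Z p.2).
Definition W2 p := (W p.1, W p.2).

Lemma cycles_Z2 p : cycles p -> cycles (Z2 p).
Proof.
move=> [M1 M2 h]; split; try by apply: fs_Z.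
have -> : zs (Z p.1) + ws (Z p.2) = Z (zs p.1 + ws p.2).
  apply: fs_ev_inj => x bx; have Mz := M_zs M1; have Mw := M_ws M2.
  have eD a b : ev (zs a + ws b) x = ev (zs a) x + ev (ws b) x by apply: evSD.
  have Ms := subD sM Mz Mw; have N1 := fs_Z M1; have N2 := fs_Z M2.
  rewrite fs_evZ // !eD !ev_zs // !ev_ws // !fs_evZ //.
  by rewrite scalerDr !scalerA ![x.1 * _]mulrC.
by rewrite h (Z0 sM (@linZ _ X)).
Qed.

Lemma cycles_W2 p : cycles p -> cycles (W2 p).
Proof.
move=> [M1 M2 h]; split; try by apply: fs_W.
have -> : zs (W p.1) + ws (W p.2) = W (zs p.1 + ws p.2).
  apply: fs_ev_inj => x bx; have Mz := M_zs M1; have Mw := M_ws M2.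
  have eD a b : ev (zs a + ws b) x = ev (zs a) x + ev (ws b) x by apply: evSD.
  have Ms := subD sM Mz Mw; have N1 := fs_W M1; have N2 := fs_W M2.
  rewrite fs_evW // !eD !ev_zs // !ev_ws // !fs_evW //.
  by rewrite scalerDr !scalerA ![x.2 * _]mulrC.
by rewrite h (W0 sM (@linW _ X)).
Qed.

Lemma linZ2 c p q : cycles p -> cycles q -> Z2 (c *: p + q) = c *: Z2 p + Z2 q.
Proof. by move=> [? ? _] [? ? _]; rewrite /Z2 /= !linZ. Qed.

Lemma linW2 c p q : cycles p -> cycles q -> W2 (c *: p + q) = c *: W2 p + W2 q.
Proof. by move=> [? ? _] [? ? _]; rewrite /W2 /= !linW. Qed.

Lemma row2 p q : cycles p -> cycles q -> sqn d2 (Z2 p + W2 q) <= sqn d2 p + sqn d2 q.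
Proof.
move=> [Mp1 Mp2 _] [Mq1 Mq2 _]; rewrite !sqn_prod /= addrACA.
by apply: lerD; apply: fs_row.
Qed.

Lemma epol2 n b p : epol Z2 W2 n b p = (epolX n b p.1, epolX n b p.2).
Proof. by elim: n b => [|n IHn] b //=; rewrite !IHn. Qed.

(* On a cycle (f, g), z - l1 and w - l2 act as the boundaries of g and - f. *)
Lemma shift_image_boundaries p : shift_image cycles Z2 W2 l1 l2 p -> boundaries p.
Proof.
move=> [s [t [[Ms1 Ms2 hs] [Mt1 Mt2 ht] ->]]].
have -> : Z2 s - l1 *: s = bnd s.2.
  rewrite /bnd -/(zs s.2); congr (_, _).
  by apply/eqP; rewrite -addr_eq0 hs.
have e : W2 t - l2 *: t = - bnd t.1.
  apply: injective_projections; first by rewrite /= opprK.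
  by apply/eqP; rewrite /= -addr_eq0 addrC ht.
rewrite e; apply: (subB lsub_boundaries); [by exists s.2|by exists t.1].
Qed.

Variables (n : nat) (v : 'I_n -> H).
Hypothesis gv : generators v.
Variables (r : nat) (J : 'I_r -> 'I_n) (l : 'I_r -> L).
Hypothesis rmax : forall (J' : 'I_(r + 1) -> 'I_n) (l' : 'I_(r + 1) -> L) x,
  ball2 x -> \det (vmat v J' l' x) = 0.
Hypothesis small1 : normc l1 <= 8^-1.
Hypothesis small2 : normc l2 <= 8^-1.
Hypothesis delta_n0 : delta v J l (l1, l2) != 0.

Let sq1 : normc l1 ^+ 2 <= 64^-1.
Proof.
have : normc l1 ^+ 2 <= 8^-1 ^+ 2 by rewrite ler_pXn2r ?nnegrE ?normc_ge0 ?invr_ge0.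
by rewrite exprVn; have -> : (8 ^+ 2 : R) = 64 by ring.
Qed.

Let sq2 : normc l2 ^+ 2 <= 64^-1.
Proof.
have : normc l2 ^+ 2 <= 8^-1 ^+ 2 by rewrite ler_pXn2r ?nnegrE ?normc_ge0 ?invr_ge0.
by rewrite exprVn; have -> : (8 ^+ 2 : R) = 64 by ring.
Qed.

Lemma acts_fst b u F : acts d2 cycles Z2 W2 b u F -> acts d M Z W b u.1 F.1.
Proof.
move=> [[M1 _ _] h]; split=> //; have := lims_fst h.
by under eq_fun do rewrite epol2.
Qed.

Lemma acts_snd b u F : acts d2 cycles Z2 W2 b u F -> acts d M Z W b u.2 F.2.
Proof.
move=> [[_ M2 _] h]; split=> //; have := lims_snd h.
by under eq_fun do rewrite epol2.
Qed.

Lemma ev_epol k b w x : M w -> ball2 x -> ev (epolX k b w) x = aev k b x *: ev w x.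
Proof.
move=> Mw bx; rewrite (epol_eval sM (@fs_Z _ X) (@fs_W _ X) (phi := ev^~ x) (x := x)) //;
  by move=> *; rewrite ?fs_ev_lin ?fs_evZ ?fs_evW.
Qed.

Lemma lims_shift (u : nat -> H) f : lims d (fun k => u k.+1) f -> lims d u f.
Proof. by move=> h e /h[k hk]; exists k.+1 => -[//|m]; apply: hk. Qed.

Lemma acts_add (p q : nat -> nat -> K) w P Q : M w -> acts d M Z W p w P -> acts d M Z W q w Q ->
  acts d M Z W (arr_add p q) w (P + Q).
Proof.
move=> Mw [MP hP] [MQ hQ]; split; first exact: (subD sM).
have -> : (fun k => epolX k (arr_add p q) w) = (fun k => epolX k p w + epolX k q w).
  apply/funext => k; apply: (epol_add sM (@fs_Z _ X) (@fs_W _ X) (@linZ _ X) (@linW _ X)) => //.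
exact: limsD.
Qed.

Lemma acts_scl c (p : nat -> nat -> K) w P : M w -> acts d M Z W p w P -> acts d M Z W (arr_scl c p) w (c *: P).
Proof.
move=> Mw [MP hP]; split; first exact: (subZ sM).
have -> : (fun k => epolX k (arr_scl c p) w) = (fun k => c *: epolX k p w).
  apply/funext => k; apply: (epol_scl sM (@fs_Z _ X) (@fs_W _ X) (@linZ _ X) (@linW _ X)) => //.
exact: limsZ.
Qed.

Lemma acts_mz (p : nat -> nat -> K) w P : M w -> acts d M Z W p w P -> acts d M Z W (mz p) w (Z P).
Proof.
move=> Mw [MP hP]; split; first exact: fs_Z.
have Me k : M (epolX k p w) by apply: (E_epol sM (@fs_Z _ X) (@fs_W _ X)).
apply: lims_shift.
have -> : (fun k => epolX k.+1 (mz p) w) = (fun k => Z (epolX k p w)).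
  apply/funext => k; apply: fs_ev_inj => x bx.
  by rewrite ev_epol // aev_mz fs_evZ // ev_epol // scalerA.
exact: lims_Z.
Qed.

Lemma acts_mw (p : nat -> nat -> K) w P : M w -> acts d M Z W p w P -> acts d M Z W (mw p) w (W P).
Proof.
move=> Mw [MP hP]; split; first exact: fs_W.
have Me k : M (epolX k p w) by apply: (E_epol sM (@fs_Z _ X) (@fs_W _ X)).
apply: lims_shift.
have -> : (fun k => epolX k.+1 (mw p) w) = (fun k => W (epolX k p w)).
  apply/funext => k; apply: fs_ev_inj => x bx.
  by rewrite ev_epol // aev_mw fs_evW // ev_epol // scalerA.
exact: lims_W.
Qed.

(** The scalar quotient psi acts on w to give G in M; subtracting the boundary of G leaves the
    action of the scalar remainder, which the multiplier bound makes small. *)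
Lemma division_approx w C (p q : nat -> nat -> K) P Q : is_mult d M Z W w C ->
  abounded p -> abounded q -> array_cycle l1 l2 p q ->
  acts d M Z W p w P -> acts d M Z W q w Q -> approx d2 boundaries (P, Q).
Proof.
move=> mw [Cp hp] [Cq hq] cpq aP aQ e e0.
have mw' := is_mult_ge0 mw.
have hC m : asq m p + asq m q <= Cp + Cq by apply: lerD.
have C0 : 0 <= Cp + Cq by have := hC 0%N; have := asq_ge0 0 p; have := asq_ge0 0 q; lra.
pose T := `|C| * (Cp + Cq) + 1.
have T0 : 0 < T by rewrite ltr_wpDl // mulr_ge0.
have q01 : 0 <= (2^-1 : R) < 1 by rewrite invr_ge0 ler0n invf_lt1 ?ltr0n ?ltr1n.
have [k hk] := geom_small q01 (divr_gt0 (exprn_gt0 2 (divr_gt0 e0 (ltr0Sn R 1))) T0).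
have {hk} hk : T / 2 ^+ k < (e / 2) ^+ 2.
  by have := hk k (leqnn k); rewrite ltr_pdivlMr // mulrC exprVn.
have [psi [bpsi hpsi]] := array_division k cpq hC sq1 sq2.
have ex b : abounded b -> exists F, acts d M Z W b w F.
  move=> bb; have h0 := acts_ex sM (@fs_complete _ X) (@fs_Z _ X) (@fs_W _ X) (@linZ _ X) (@linW _ X)
    mw bb.
  exact: h0.
have [G aG] := ex _ bpsi; have MG : M G := aG.1.
pose p' := arr_add p (mw_sub l2 psi); pose q' := arr_add q (arr_scl (-1) (mz_sub l1 psi)).
have bp' : abounded p'.
  by exists ((Cp + Cq) / 2 ^+ k) => m; have := hpsi m; rewrite -/p' -/q'; have := asq_ge0 m q'; lra.
have bq' : abounded q'.
  by exists ((Cp + Cq) / 2 ^+ k) => m; have := hpsi m; rewrite -/p' -/q'; have := asq_ge0 m p'; lra.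
have [P' aP'] := ex _ bp'; have [Q' aQ'] := ex _ bq'.
have Mw : M w := mw.1.
have eP : P' = P + ws G.
  apply: (acts_unique aP'); apply: acts_add => //; rewrite /ws -scaleNr.
  by apply: acts_add => //; [apply: acts_mw|apply: acts_scl].
have eQ : Q' = Q - zs G.
  apply: (acts_unique aQ'); apply: acts_add => //; rewrite -scaleN1r; apply: acts_scl => //.
  by rewrite /zs -scaleNr; apply: acts_add => //; [apply: acts_mz|apply: acts_scl].
exists (bnd G); first by exists G.
have small F b : (forall m, asq m b <= (Cp + Cq) / 2 ^+ k) -> acts d M Z W b w F -> nm d F < e / 2.
  move=> hb aF; rewrite nm_lt; last by rewrite ltW // divr_gt0.
  have h0 := acts_bound mw' (normr_ge0 C) hb aF.
  apply: le_lt_trans hk; apply: (le_trans h0).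
  rewrite mulrA ler_pM2r ?invr_gt0 ?exprn_gt0 // lerDl //.
have nP : nm d P' < e / 2.
  by apply: small aP' => m; have := hpsi m; rewrite -/p' -/q'; have := asq_ge0 m q'; lra.
have nQ : nm d Q' < e / 2.
  by apply: small aQ' => m; have := hpsi m; rewrite -/p' -/q'; have := asq_ge0 m p'; lra.
apply: (le_lt_trans (nm_prod _ _)) => /=.
rewrite opprK -eP -eQ; lra.
Qed.

(** [dcol] commutes with multiplication by z and w, so it carries cycles to scalar cycles. *)
Lemma cycle_arrays u k : cycles u -> exists (p q : nat -> nat -> K),
  [/\ abounded p /\ abounded q, array_cycle l1 l2 p q,
      forall x, ball2 x -> sums_to p x (dcol v J l u.1 x k 0)
    & forall x, ball2 x -> sums_to q x (dcol v J l u.2 x k 0)].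
Proof.
move=> [M1 M2 hu].
have [p [bp sp]] := inP_dcol gv J l u.1 k; have [q [bq sq]] := inP_dcol gv J l u.2 k.
exists p, q; split=> // i j.
apply: (array_eq (p := arr_add (mz p) (mw q)) (q := arr_add (arr_scl l1 p) (arr_scl l2 q))
  (phi := fun x => x.1 * dcol v J l u.1 x k 0 + x.2 * dcol v J l u.2 x k 0)).
- by apply: abounded_add; [apply: abounded_mz|apply: abounded_mw].
- by apply: abounded_add; apply: abounded_scl.
- by move=> x bx; apply: sums_add; [apply/sums_mz/sp|apply/sums_mw/sq].
move=> x bx.
suff -> : x.1 * dcol v J l u.1 x k 0 + x.2 * dcol v J l u.2 x k 0 =
    l1 * dcol v J l u.1 x k 0 + l2 * dcol v J l u.2 x k 0.
  by apply: sums_add; apply: sums_scl; [apply: sp|apply: sq].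
have e : Z u.1 + W u.2 = l1 *: u.1 + l2 *: u.2.
  by apply/eqP; rewrite -subr_eq0 -addr_subACA; apply/eqP.
have e1 := dcol_lin v J l 1 (Z u.1) (W u.2) bx.
have e2 := dcol_lin v J l l1 u.1 (l2 *: u.2) bx.
have e3 := dcol_lin v J l l2 u.2 0 bx.
have e4 : dcol v J l 0 x = 0.
  have := dcol_sum v J l (I := 'I_0) (fun=> 0) (fun=> 0) bx; by rewrite !big_ord0.
rewrite !scale1r e e2 dcol_Z // dcol_W // in e1; rewrite !addr0 e4 addr0 in e3.
rewrite e3 in e1; have := congr1 (fun A : 'cV[K]_r => A k 0) e1.
by rewrite !mxE => ->.
Qed.

(** By Cramer's rule in both components, delta u is a sum over k of scalar cycles acting on the
    multipliers v_(J k). *)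
Lemma delta_action u C F D : is_mult d2 cycles Z2 W2 u C ->
  (forall x, ball2 x -> sums_to D x (delta v J l x)) ->
  acts d2 cycles Z2 W2 D u F -> approx d2 boundaries F.
Proof.
move=> mu sD aF; have cu : cycles u := mu.1; have [M1 M2 _] := cu.
have [p hp] := choice (fun k => cycle_arrays k cu).
have [q hq] := choice hp.
have mJ k : exists C, is_mult d M Z W (v (J k)) C by case: gv.
have ex k b : abounded b -> exists P, acts d M Z W b (v (J k)) P.
  move=> bb; have [C' mC] := mJ k.
  have h0 := acts_ex sM (@fs_complete _ X) (@fs_Z _ X) (@fs_W _ X) (@linZ _ X) (@linW _ X)
    mC bb.
  exact: h0.
have bp k : abounded (p k) by case: (hq k) => -[].
have bq k : abounded (q k) by case: (hq k) => -[].
have [P hP] := choice (fun k => ex k _ (bp k)).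
have [Q hQ] := choice (fun k => ex k _ (bq k)).
have -> : F = \sum_k (P k, Q k).
  have MvJ k : M (v (J k)) := M_v gv (J k).
  have -> : \sum_k (P k, Q k) = (\sum_k P k, \sum_k Q k).
    by apply: injective_projections; rewrite /= ?raddf_sum //.
  apply: injective_projections => /=; apply: fs_ev_inj => x bx; rewrite evS_sum //.
    rewrite (acts_ev M1 bx (sD x bx) (acts_fst aF)) (cramer gv J l rmax M1 bx).
    apply: eq_bigr => k _; have [_ _ h1 h2] := hq k.
    by rewrite (acts_ev (MvJ k) bx (h1 x bx) (hP k)).
  rewrite (acts_ev M2 bx (sD x bx) (acts_snd aF)) (cramer gv J l rmax M2 bx).
  apply: eq_bigr => k _; have [_ _ h1 h2] := hq k.
  by rewrite (acts_ev (MvJ k) bx (h2 x bx) (hQ k)).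
apply: (sub_sum (lsub_approx d2 lsub_boundaries)) => k _.
have [C' mC] := mJ k; have [_ hc _ _] := hq k.
exact: division_approx mC (bp k) (bq k) hc (hP k) (hQ k).
Qed.

(** Modulo boundaries p is a multiplier u of the space of cycles. Then delta u is a limit of
    boundaries and agrees with delta(l) u up to such limits, while delta(l) is invertible. *)
Lemma cycles_approx p : cycles p -> approx d2 boundaries p.
Proof.
move=> cp; have sA := lsub_approx d2 lsub_boundaries.
have h8 : 8^-1 + 8^-1 <= 2^-1 :> R by lra.
have h82 : 8^-1 < 2^-1 :> R by lra.
have hl : normc l1 + normc l2 <= 2^-1 := le_trans (lerD small1 small2) h8.
have [u [C [mu su]]] := mult_mod_shift lsub_cycles cycles_complete cycles_Z2 cycles_W2 linZ2 linW2 row2 hl cp.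
suff : approx d2 boundaries u.
  move=> hu; rewrite -(subrK u p); apply: (subD sA) => //.
  by apply: sub_approx; apply: shift_image_boundaries.
have bl : ball2 (l1, l2) := @small_ball R (l1, l2) (le_lt_trans small1 h82) (le_lt_trans small2 h82).
have [D [bD sD]] := inP_delta gv J l.
have [F aF] := acts_ex lsub_cycles cycles_complete cycles_Z2 cycles_W2 linZ2 linW2 mu bD.
have h1 : approx d2 boundaries (F - delta v J l (l1, l2) *: u).
  apply: approx_sub (acts_sub_eval lsub_cycles cycles_Z2 cycles_W2 linZ2 linW2 mu.1 (sD _ bl) aF).
  exact: shift_image_boundaries.
have h2 := delta_action mu sD aF.
have h3 := subB sA h2 h1; rewrite subKr in h3.
by have := subZ sA (delta v J l (l1, l2))^-1 h3; rewrite scalerA mulVf // scale1r.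
Qed.

End Cycles.

(** * Stability of the first homology *)

Section Stability.
Variables (R : realType) (X : fock_submodule R).
Local Notation K := R[i].
Local Notation L := (fsL X).
Local Notation H := (fsH X).
Local Notation M := (@fsM R X).
Local Notation Z := (@fsZ R X).
Local Notation W := (@fsW R X).
Local Notation d := (fs_d X).
Local Notation dL := (fs_dL X).
Local Notation ev := (@fs_ev R X).
Local Notation sM := (fs_sub X).
Local Notation d2 := (ip_prod d).
Local Notation adjZ := (@adjZ R X).
Local Notation adjW := (@adjW R X).
Implicit Types (f g h y : H) (p q : (H * H)%type) (l : K).

(** Orthogonality to the boundaries at the origin ([normal_dot]). This fixed condition normalises
    cycles at every nearby l. *)
Definition normal_pair p := adjZ p.2 = adjW p.1.

Lemma adj_comm y : adjZ (adjW y) = adjW (adjZ y).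
Proof.
apply: (E_ext (d := d) sM); try exact: M_adjZ; try exact: M_adjW.
move=> f Mf; rewrite -adjZP // -adjWP //; last exact: fs_Z.
by rewrite -adjWP // -adjZP //; [rewrite ZW_comm|apply: fs_W].
Qed.

Lemma normalB p q : normal_pair p -> normal_pair q -> normal_pair (p - q).
Proof. by rewrite /normal_pair /= adjZB adjWB => -> ->. Qed.

Lemma zs0 f : zs (X := X) 0 f = Z f. Proof. by rewrite /zs scale0r subr0. Qed.
Lemma ws0 f : ws (X := X) 0 f = W f. Proof. by rewrite /ws scale0r subr0. Qed.

(** The equation for h has the operator adjZ (Z - l1) + adjW (W - l2), coercive because |Zh|^2 +
    |Wh|^2 >= |h|^2 and the perturbation takes away at most half. *)
Lemma normal_solve l1 l2 p : normc l1 + normc l2 <= 2^-1 -> M p.1 -> M p.2 ->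
  exists2 h, M h & normal_pair (p - bnd l1 l2 h).
Proof.
move=> hl M1 M2.
have E0 : M (adjZ p.2 - adjW p.1) by apply: (subB sM); [apply: M_adjZ|apply: M_adjW].
pose A h := adjZ (zs l1 h) + adjW (ws l2 h).
have MA h : M (A h) by apply: (subD sM); [apply: M_adjZ|apply: M_adjW].
have nmz h : M h -> nm d (zs l1 h) <= 2 * nm d h.
  move=> Mh; apply: (le_trans (nmB _ _ _)); rewrite nmZ.
  have h1 := nmZ_le sM (@linW _ X) (@fs_row _ X) Mh.
  have h2 : normc l1 * nm d h <= 1 * nm d h.
    by apply: ler_wpM2r; rewrite ?nm_ge0 //; have := normc_ge0 l2; lra.
  by rewrite mul1r in h2; lra.
have nmw h : M h -> nm d (ws l2 h) <= 2 * nm d h.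
  move=> Mh; apply: (le_trans (nmB _ _ _)); rewrite nmZ.
  have h1 := nmW_le sM (@linZ _ X) (@fs_row _ X) Mh.
  have h2 : normc l2 * nm d h <= 1 * nm d h.
    by apply: ler_wpM2r; rewrite ?nm_ge0 //; have := normc_ge0 l1; lra.
  by rewrite mul1r in h2; lra.
have zsB x y : M x -> M y -> zs l1 (x - y) = zs l1 x - zs l1 y.
  by move=> Mx My; rewrite addrC -scaleN1r zs_lin // scaleN1r addrC.
have wsB x y : M x -> M y -> ws l2 (x - y) = ws l2 x - ws l2 y.
  by move=> Mx My; rewrite addrC -scaleN1r ws_lin // scaleN1r addrC.
have [h Mh Ah] : exists2 h, M h & A h = adjZ p.2 - adjW p.1.
  apply: (lax_milgram sM (@fs_complete _ X) (A := A) (c := 2^-1) (K := 4)) => //.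
  - by rewrite invr_gt0 ltr0n.
  - by move=> x y Mx My; rewrite /A zsB // wsB // adjZB adjWB addr_subACA.
  - move=> x Mx; apply: (le_trans (nmD _ _ _)).
    have := adjZ_nm (zs l1 x); have := adjW_nm (ws l2 x); have := nmz x Mx; have := nmw x Mx; lra.
  - move=> x Mx; rewrite rdDl.
    have e1 : rd d (adjZ (zs l1 x)) x = rd d (zs l1 x) (Z x).
      by rewrite rdC [RHS]rdC /rd adjZP //.
    have e2 : rd d (adjW (ws l2 x)) x = rd d (ws l2 x) (W x).
      by rewrite rdC [RHS]rdC /rd adjWP //.
    rewrite e1 e2 /zs /ws !rdBl -!/(sqn d _).
    have h1 := rd_le d (l1 *: x) (Z x); have h2 := rd_le d (l2 *: x) (W x).
    have n1 := nmZ_le sM (@linW _ X) (@fs_row _ X) Mx.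
    have n2 := nmW_le sM (@linZ _ X) (@fs_row _ X) Mx.
    have c := fs_col Mx; rewrite !nmZ in h1 h2.
    have k1 : normc l1 * nm d x * nm d (Z x) <= normc l1 * sqn d x.
      by rewrite -nmsq expr2 mulrA ler_wpM2l ?mulr_ge0 ?normc_ge0 ?nm_ge0.
    have k2 : normc l2 * nm d x * nm d (W x) <= normc l2 * sqn d x.
      by rewrite -nmsq expr2 mulrA ler_wpM2l ?mulr_ge0 ?normc_ge0 ?nm_ge0.
    have k3 : (normc l1 + normc l2) * sqn d x <= 2^-1 * sqn d x.
      by apply: ler_wpM2r => //; apply: sqn_ge0.
    rewrite mulrDl in k3; lra.
exists h => //; rewrite /normal_pair /bnd /=.
have A2D x y : adjW (x + y) = adjW x + adjW y by have := adjW_lin 1 x y; rewrite !scale1r.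
have e : adjZ p.2 = adjZ (zs l1 h) + (adjW (ws l2 h) + adjW p.1).
  by rewrite addrA -/(A h) Ah subrK.
by rewrite adjZB opprK e addrC addKr addrC A2D.
Qed.

Lemma normal_dot p h : M h -> normal_pair p -> d2 p (bnd 0 0 h) = 0.
Proof.
move=> Mh np; rewrite ip_sym /= /prod_dt /bnd /= zs0 ws0 dtNl adjZP // adjWP // np.
by rewrite addrC subrr conjC0.
Qed.

(** Only the perturbation w of the boundary of h is seen by p, and |w| <= |h|/4, while |h| is
    controlled by the boundary itself; so |p| is at most about |p|/3. *)
Lemma normal_approx l1 l2 p : normc l1 + normc l2 <= 4^-1 ->
  normal_pair p -> approx d2 (boundaries l1 l2) p -> p = 0.
Proof.
move=> hl np ap; apply: (nm_small (d := d2)) => e e0.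
have e2 : 0 < e / 2 by rewrite divr_gt0.
have [_ [h Mh <-] hh] := ap _ e2.
pose w : (H * H)%type := (l2 *: h, - (l1 *: h)).
have ebnd : bnd l1 l2 h = bnd 0 0 h + w.
  rewrite /bnd /w zs0 ws0 /zs /ws; apply: injective_projections; rewrite //=.
  by rewrite opprB addrC.
have nw : nm d2 w <= 4^-1 * nm d h.
  apply: (le_trans (nm_prod _ _)); rewrite /= nmN !nmZ -mulrDl ler_wpM2r ?nm_ge0 //.
  by rewrite addrC.
have nh : nm d h <= nm d2 (bnd 0 0 h).
  rewrite nm_le ?nm_ge0 // nmsq sqn_prod /= zs0 ws0 sqnN addrC; exact: fs_col.
have nb : nm d2 (bnd 0 0 h) <= nm d2 (bnd l1 l2 h) + nm d2 w.
  by have := nmB d2 (bnd l1 l2 h) w; rewrite {1}ebnd addrK.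
have nb2 : nm d2 (bnd l1 l2 h) <= nm d2 p + nm d2 (p - bnd l1 l2 h).
  by have := nmB d2 p (p - bnd l1 l2 h); rewrite subKr.
have [->|n0] := eqVneq (nm d2 p) 0; first exact: ltW.
have np0 : 0 < nm d2 p by rewrite lt_def n0 nm_ge0.
have key : nm d2 p * nm d2 p <= nm d2 p * (nm d2 (p - bnd l1 l2 h) + nm d2 w).
  rewrite -expr2 nmsq /sqn.
  have -> : rd d2 p p = rd d2 p (p - bnd l1 l2 h) + rd d2 p w.
    rewrite {1}/rd [in RHS]/rd -ReD -dtDr ebnd opprD addrA subrK dtBr normal_dot ?subr0 //.
  by rewrite mulrDr; apply: lerD; apply: rd_le.
rewrite ler_pM2l // in key; lra.
Qed.

End Stability.

(** Take a matrix of maximal rank whose row space lies in S; adjoining a row of S cannot raise the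
    rank. *)
Lemma lsub_rV_mx (K : fieldType) n (S : set 'rV[K]_n) : lsub S ->
  exists (m : nat) (A : 'M[K]_(m, n)), forall c, S c <-> (c <= A)%MS.
Proof.
move=> sS.
pose P k := `[< exists m (A : 'M[K]_(m, n)), (forall c, (c <= A)%MS -> S c) /\ \rank A = k >].
have P0 : P 0%N.
  apply/asboolP; exists 0%N, (0 : 'M[K]_(0, n)); split; last by rewrite mxrank0.
  by move=> c /submx0null ->; apply: sub0.
have Pn k : P k -> (k <= n)%N by move=> /asboolP[m [A [_ <-]]]; apply: rank_leq_col.
have [k /asboolP[m [A [hA rA]]] kmax] := ex_maxnP (ex_intro P _ P0) Pn.
exists m, A => c; split=> [Sc|]; last exact: hA.
have : P (\rank (col_mx A c)).
  apply/asboolP; exists (m + 1)%N, (col_mx A c); split=> // c'.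
  move=> /submxP[D ->]; rewrite -[D]hsubmxK mul_row_col; apply: (subD sS).
    by apply: hA; apply: submxMl.
  by rewrite [rsubmx D]mx11_scalar mul_scalar_mx; apply: subZ.
move=> /kmax; rewrite -rA => h.
have hAc : (A <= col_mx A c)%MS by rewrite -addsmxE addsmxSl.
have := mxrank_leqif_sup hAc; move=> [_ /esym].
rewrite eqn_leq h (mxrankS hAc) /= => hs.
by apply: submx_trans hs; rewrite -addsmxE addsmxSr.
Qed.

(** A subspace of a finite dimensional space is cut out by finitely many linear equations, here the
    columns of a cokernel matrix, hence is closed. *)
Lemma lsub_rV_closed (R : realType) n (S : set 'rV[R[i]]_n) (c : 'rV[R[i]]_n) : lsub S ->
  (forall e : R, 0 < e -> exists2 c', S c' & forall j, normc (c 0 j - c' 0 j) <= e) -> S c.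
Proof.
move=> sS h; have [m [A hA]] := lsub_rV_mx sS; apply/hA.
rewrite submxE; apply/eqP/rowP => k; rewrite [RHS]mxE; apply: normc_small => e e0.
pose B := \sum_j normc (cokermx A j k).
have B0 : 0 <= B by apply: sumr_ge0 => j _; apply: normc_ge0.
have B1 : 0 < B + 1 by rewrite ltr_wpDl.
have [c' /hA Sc' hc'] := h _ (divr_gt0 e0 B1).
have : c' *m cokermx A = 0 by apply/eqP; rewrite -submxE.
move=> /rowP/(_ k); rewrite [RHS]mxE => h0.
rewrite -[X in normc X]subr0 -h0 !mxE -sumrB.
apply: (le_trans (normc_sum _ _ _)).
apply: (@le_trans _ _ (\sum_j e / (B + 1) * normc (cokermx A j k))).
  by apply: ler_sum => j _; rewrite -mulrBl normcM ler_wpM2r ?normc_ge0.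
rewrite -mulr_sumr -/B mulrAC ler_pdivrMr // ler_pM2l // lerDl //.
Qed.

(** * Dimension of the first homology at the origin *)

Section HomologyDimension.
Variables (R : realType) (X : fock_submodule R).
Local Notation K := R[i].
Local Notation L := (fsL X).
Local Notation H := (fsH X).
Local Notation M := (@fsM R X).
Local Notation Z := (@fsZ R X).
Local Notation W := (@fsW R X).
Local Notation d := (fs_d X).
Local Notation dL := (fs_dL X).
Local Notation ev := (@fs_ev R X).
Local Notation sM := (fs_sub X).
Local Notation d2 := (ip_prod d).
Local Notation adjZ := (@adjZ R X).
Local Notation adjW := (@adjW R X).
Variables (n : nat) (v : 'I_n -> H).
Hypothesis gv : generators v.
Variables (r : nat) (J : 'I_r -> 'I_n) (l : 'I_r -> L).
Hypothesis rmax : forall (J' : 'I_(r + 1) -> 'I_n) (l' : 'I_(r + 1) -> L) x,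
  ball2 x -> \det (vmat v J' l' x) = 0.
Variables (l1 l2 : K) (c0 : R).
Hypothesis small1 : normc l1 <= 8^-1.
Hypothesis small2 : normc l2 <= 8^-1.
Hypothesis small_c0 : normc l1 + normc l2 <= c0.
Hypothesis c0_gt0 : 0 < c0.
Hypothesis gram_c0 : forall l1 l2, normc l1 + normc l2 <= c0 ->
  (forall y, M y -> c0 * nm d y <= nm d (gram v l1 l2 y)) /\
  (forall m, M m -> exists2 y, M y & gram v l1 l2 y = m).
Hypothesis delta_n0 : delta v J l (l1, l2) != 0.
Implicit Types (f g h y : H) (p q : (H * H)%type).
Local Notation zl := (@zs R X l1).
Local Notation wl := (@ws R X l2).

Let small4 : normc l1 + normc l2 <= 4^-1.
Proof.
have h8 : 8^-1 + 8^-1 <= 4^-1 :> R by lra.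
exact: le_trans (lerD small1 small2) h8.
Qed.

Let small_half : normc l1 + normc l2 <= 2^-1.
Proof. by apply: (le_trans small4); lra. Qed.

Let bl : ball2 (l1, l2).
Proof.
have h82 : 8^-1 < 2^-1 :> R by lra.
exact: (@small_ball R (l1, l2) (le_lt_trans small1 h82) (le_lt_trans small2 h82)).
Qed.

Let zero_c0 : normc (0 : K) + normc (0 : K) <= c0.
Proof. by rewrite normc0 addr0 ltW. Qed.

Let Mv j : M (v j) := M_v gv j.

Definition comb (c : 'rV[K]_n) := \sum_j c 0 j *: v j.
Definition coefs y : 'rV[K]_n := \row_j d y (v j).

Lemma M_comb c : M (comb c).
Proof. by apply: (sub_sum sM) => j _; apply: (subZ sM). Qed.

Lemma comb_lin a c c' : comb (a *: c + c') = a *: comb c + comb c'.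
Proof.
rewrite /comb scaler_sumr -big_split; apply: eq_bigr => j _ /=.
by rewrite !mxE scalerDl scalerA.
Qed.

Lemma combB c c' : comb (c - c') = comb c - comb c'.
Proof. by have := comb_lin (-1) c' c; rewrite !scaleN1r addrC [RHS]addrC. Qed.

Lemma coefs_lin a y y' : coefs (a *: y + y') = a *: coefs y + coefs y'.
Proof. by apply/rowP => j; rewrite !mxE ip_lin. Qed.

Lemma gramE k1 k2 y : gram v k1 k2 y =
  zs k1 (adjZ y) + ws k2 (adjW y) + comb (coefs y).
Proof. by rewrite /gram /comb; congr (_ + _); apply: eq_bigr => j _; rewrite mxE. Qed.

Lemma gram_lin k1 k2 a y y' : M y -> M y' ->
  gram v k1 k2 (a *: y + y') = a *: gram v k1 k2 y + gram v k1 k2 y'.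
Proof.
move=> My My'; rewrite !gramE adjZ_lin adjW_lin coefs_lin comb_lin.
rewrite zs_lin ?ws_lin; try exact: M_adjZ; try exact: M_adjW.
rewrite !scalerDr [X in X + _ = _]addrACA [LHS]addrACA //.
Qed.

(* The kernel of (f, g, c) |-> (z - l1) f + (w - l2) g + sum_j c_j v_j modulo
   boundaries is the graph of a function over the normal cycles at the origin;
   [y] solves the equation defining its value [coefs y] at the cycle [p]. *)
Definition transport p y := [/\ cycles 0 0 p, normal_pair p, M y &
  zl p.1 + wl p.2 + gram v l1 l2 y = 0].

Lemma transport_ex p : cycles 0 0 p -> normal_pair p -> exists y, transport p y.
Proof.
move=> cp np; have [M1 M2 _] := cp.
have Mm : M (zl p.1 + wl p.2) by apply: (subD sM); [apply: M_zs|apply: M_ws].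
have [y My gy] := (gram_c0 small_c0).2 _ (subN sM Mm).
by exists y; split=> //; rewrite gy subrr.
Qed.

Lemma transport_lin a p q y y' : transport p y -> transport q y' ->
  transport (a *: p + q) (a *: y + y').
Proof.
move=> [cp np My hp] [cq nq My' hq]; have [M1 M2 _] := cp; have [N1 N2 _] := cq.
split; first exact: (lsub_cycles X 0 0).2.
- by move: np nq; rewrite /normal_pair /= adjZ_lin adjW_lin => -> ->.
- exact: sM.2.
rewrite /= zs_lin // ws_lin // gram_lin // [X in X + _ = _]addrACA -!scalerDr.
by rewrite [LHS]addrACA -scalerDr hp hq scaler0 addr0.
Qed.

(** Without the v_j, p + (adjZ y, adjW y) is a normal cycle at l, hence zero. As p is a cycle at the
    origin, [gram v 0 0 y] is then 0, so y = 0 and p = 0. *)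
Lemma transport_inj p y : transport p y -> coefs y = 0 -> p = 0.
Proof.
move=> [cp np My hp] cy; have [M1 M2 h0] := cp.
have comb0 : comb 0 = 0.
  by rewrite /comb big1 // => j _; rewrite mxE scale0r.
have N1 : M (adjZ y) by apply: M_adjZ. have N2 : M (adjW y) by apply: M_adjW.
pose q : (H * H)%type := (adjZ y, adjW y).
have zD f g : M f -> M g -> zl (f + g) = zl f + zl g.
  by move=> Mf Mg; rewrite -[f]scale1r zs_lin // !scale1r.
have wD f g : M f -> M g -> wl (f + g) = wl f + wl g.
  by move=> Mf Mg; rewrite -[f]scale1r ws_lin // !scale1r.
have cq : cycles l1 l2 (p + q).
  split; [exact: (subD sM)|exact: (subD sM)|].
  rewrite /= zD // wD // addrACA.
  by rewrite gramE cy comb0 addr0 in hp.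
have nq : normal_pair (p + q).
  have A1D f g : adjZ (f + g) = adjZ f + adjZ g by have := adjZ_lin 1 f g; rewrite !scale1r.
  have A2D f g : adjW (f + g) = adjW f + adjW g by have := adjW_lin 1 f g; rewrite !scale1r.
  by rewrite /normal_pair /= A1D A2D np adj_comm.
have pq : p = - q.
  apply/eqP; rewrite -addr_eq0; apply/eqP.
  exact: normal_approx small4 nq (cycles_approx gv rmax small1 small2 delta_n0 cq).
have : gram v 0 0 y = 0.
  rewrite gramE cy comb0 addr0 zs0 ws0; move: h0; rewrite pq /= zs0 ws0.
  have ZN f : M f -> Z (- f) = - Z f.
    by move=> Mf; rewrite -scaleN1r (ZZ sM (@linZ _ X)) // scaleN1r.
  have WN f : M f -> W (- f) = - W f.
    by move=> Mf; rewrite -scaleN1r (WZ sM (@linW _ X)) // scaleN1r.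
  by rewrite ZN // WN // -opprD => /eqP; rewrite oppr_eq0 => /eqP.
move=> g0; have := (gram_c0 zero_c0).1 y My; rewrite g0 nm0 pmulr_rle0 // => hy.
have y0 : y = 0 by apply: (nm_eq0 (d := d)); apply/eqP; rewrite eq_le hy nm_ge0.
have A10 : adjZ 0 = 0 by have := adjZZ 0 (0 : H); rewrite !scale0r.
have A20 : adjW 0 = 0 by have := adjWZ 0 (0 : H); rewrite !scale0r.
by rewrite pq /q y0 A10 A20; apply: injective_projections; rewrite /= oppr0.
Qed.

(** Make (f, g) normal by a boundary at l, then subtract the part in the range of the adjoint of
    Phi_0 by solving [gram] at the origin; independence of the generators there forces
    [coefs y = c]. *)
Lemma transport_surj c f g : M f -> M g -> zl f + wl g + comb c = 0 ->
  exists p y, transport p y /\ coefs y = c.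
Proof.
move=> Mf Mg h.
have [k Mk nk] := normal_solve (p := (f, g)) small_half Mf Mg.
set q := _ - _ in nk.
have Mq1 : M q.1 by apply: (subB sM) => //; apply: (subN sM); apply: M_ws.
have Mq2 : M q.2 by apply: (subB sM) => //; apply: M_zs.
have hq : zl q.1 + wl q.2 + comb c = 0.
  rewrite -h; congr (_ + _); rewrite /q /=.
  have Mz := M_zs l1 Mk; have Mw := M_ws l2 Mk.
  have -> : zl (f - - wl k) = zl f + zl (wl k).
    by rewrite opprK -[f]scale1r zs_lin // !scale1r.
  have -> : wl (g - zl k) = wl g - wl (zl k).
    by rewrite addrC -scaleN1r ws_lin // scaleN1r addrC.
  by rewrite zs_ws // addrACA subrr addr0.
have [y My gy] := (gram_c0 zero_c0).2 (Z q.1 + W q.2 + comb c)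
  (subD sM (subD sM (fs_Z Mq1) (fs_W Mq2)) (M_comb c)).
have N1 : M (adjZ y) by apply: M_adjZ. have N2 : M (adjW y) by apply: M_adjW.
pose p : (H * H)%type := (q.1 - adjZ y, q.2 - adjW y).
have e0 : Z (q.1 - adjZ y) + W (q.2 - adjW y) + comb (c - coefs y) = 0.
  rewrite (ZB (@linZ _ X)) // (WB (@linW _ X)) // addr_subACA.
  rewrite combB addr_subACA -gy gramE zs0 ws0 subrr //.
have cy : coefs y = c.
  case: gv => _ _ indep; apply/esym/eqP; rewrite -subr_eq0; apply/eqP/rowP => j.
  by rewrite [RHS]mxE; apply: (indep _ _ (fun j => (c - coefs y) 0 j)) e0 j; apply: (subB sM).
exists p, y; split=> //; split=> //.
- split; try exact: (subB sM).
  by rewrite zs0 ws0; rewrite cy subrr in e0; rewrite /comb big1 ?addr0 // in e0 => j _; rewrite mxE scale0r.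
- have -> : p = q - (adjZ y, adjW y) by [].
  by apply: normalB => //; rewrite /normal_pair /= adj_comm.
rewrite gramE cy /= addrA.
have -> : zl (q.1 - adjZ y) = zl q.1 - zl (adjZ y).
  by rewrite addrC -scaleN1r zs_lin // scaleN1r addrC.
have -> : wl (q.2 - adjW y) = wl q.2 - wl (adjW y).
  by rewrite addrC -scaleN1r ws_lin // scaleN1r addrC.
by rewrite addr_subACA subrK hq.
Qed.

Lemma transport_ev p y : transport p y -> ev (comb (coefs y)) (l1, l2) = 0.
Proof.
move=> [[M1 M2 _] _ My /(congr1 (ev^~ (l1, l2)))].
have N1 : M (adjZ y) by apply: M_adjZ. have N2 : M (adjW y) by apply: M_adjW.
have eD a b : ev (zl a + wl b) (l1, l2) = ev (zl a) (l1, l2) + ev (wl b) (l1, l2) by apply: evSD.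
rewrite gramE /= (evSD (zl p.1 + wl p.2)) // (evSD (zl (adjZ y) + wl (adjW y))) // !eD !ev_zs // !ev_ws //= !subrr !scale0r !add0r.
by rewrite evS0.
Qed.

Let I := shift_image M Z W l1 l2.
Let sI : lsub I := shift_image_sub sM (@linZ _ X) (@linW _ X) l1 l2.

(** If s in I is close to [comb c], the difference is [gram y] with y small, so [comb (c - coefs y)]
    is in I. Thus c is a limit in a subspace of row vectors, which is closed. *)
Lemma shift_image_closed c : approx d I (comb c) -> I (comb c).
Proof.
move=> ac; pose S : set 'rV[K]_n := [set c | I (comb c)].
have sS : lsub S.
  split=> [|a c1 c2 h1 h2]; rewrite /S /=.
    by rewrite /comb big1 => [|j _]; [apply: sub0 sI|rewrite mxE scale0r].
  by rewrite comb_lin; apply: sI.2.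
suff : S c by [].
apply: lsub_rV_closed => // e e0.
pose B := \sum_j nm d (v j).
have B0 : 0 <= B by apply: sumr_ge0 => j _; apply: nm_ge0.
have B1 : 0 < B + 1 by rewrite ltr_wpDl.
have [s Is hs] := ac _ (mulr_gt0 c0_gt0 (divr_gt0 e0 B1)).
have Ms : M s by case: Is => f [g [Mf Mg ->]]; apply: (subD sM); [apply: M_zs|apply: M_ws].
have [y My gy] := (gram_c0 small_c0).2 _ (subB sM (M_comb c) Ms).
have ny : nm d y <= e / (B + 1).
  have := (gram_c0 small_c0).1 y My; rewrite gy => hy.
  by rewrite -(ler_pM2l c0_gt0); apply: (le_trans hy); apply: ltW.
exists (c - coefs y) => [|j]; last first.
  rewrite !mxE opprB addrC subrK; apply: (le_trans (cauchy_schwarz _ _ _)).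
  apply: (@le_trans _ _ (e / (B + 1) * (B + 1))); last by rewrite divfK // gt_eqF.
  apply: ler_pM; rewrite ?nm_ge0 //.
  rewrite /B (bigD1 j) //= -addrA lerDl addr_ge0 ?ler01 //.
  by apply: sumr_ge0 => i _; apply: nm_ge0.
rewrite /S /=; have -> : comb (c - coefs y) = s + (zl (adjZ y) + wl (adjW y)).
  rewrite gramE in gy; rewrite combB; apply/eqP; rewrite subr_eq -addrA gy addrC subrK //.
apply: (subD sI) => //; exists (adjZ y), (adjW y); split=> //; [exact: M_adjZ|exact: M_adjW].
Qed.

(** Modulo the closure of I the Cramer relations become delta(l) v_j = sum_k dcol_k(v_j)(l) v_(J k).
    Their combination with coefficients c reads delta(l) [comb c] = 0, since [dcol] of [comb c]
    vanishes at l. *)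
Lemma ev_comb0_image c : ev (comb c) (l1, l2) = 0 -> I (comb c).
Proof.
move=> ec; apply: shift_image_closed.
have sA := lsub_approx d sI.
have [D [bD sD]] := inP_delta gv J l.
have key j : approx d I (delta v J l (l1, l2) *: v j -
    \sum_k dcol v J l (v j) (l1, l2) k 0 *: v (J k)).
  have [F [F0 [q [aF0 aF bq sq e]]]] := cramer_acts gv rmax bD sD j.
  have h1 := acts_sub_eval sM (@fs_Z _ X) (@fs_W _ X) (@linZ _ X) (@linW _ X) (Mv j) (sD _ bl) aF0.
  have h2 k := acts_sub_eval sM (@fs_Z _ X) (@fs_W _ X) (@linZ _ X) (@linW _ X) (Mv (J k)) (sq k _ bl) (aF k).
  have h3 : approx d I (\sum_k (F k - dcol v J l (v j) (l1, l2) k 0 *: v (J k))).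
    by apply: (sub_sum sA) => k _; apply: h2.
  have := subB sA h3 h1; rewrite sumrB -e opprB addrC subrKA //.
have : approx d I (\sum_j c 0 j *: (delta v J l (l1, l2) *: v j -
    \sum_k dcol v J l (v j) (l1, l2) k 0 *: v (J k))).
  by apply: (sub_sum sA) => j _; apply: (subZ sA).
have -> : \sum_j c 0 j *: (delta v J l (l1, l2) *: v j -
    \sum_k dcol v J l (v j) (l1, l2) k 0 *: v (J k)) = delta v J l (l1, l2) *: comb c.
  under eq_bigr do rewrite scalerBr scalerA mulrC -scalerA.
  rewrite sumrB -scaler_sumr -/(comb c).
  have -> : \sum_j c 0 j *: (\sum_k dcol v J l (v j) (l1, l2) k 0 *: v (J k)) =
      \sum_k dcol v J l (comb c) (l1, l2) k 0 *: v (J k).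
    rewrite (dcol_sum v J l (fun j => c 0 j) v bl).
    under eq_bigr do rewrite scaler_sumr.
    rewrite exchange_big; apply: eq_bigr => k _ /=.
    rewrite summxE scaler_suml; apply: eq_bigr => j _.
    by rewrite scalerA [in RHS]mxE.
  rewrite big1 ?subr0 // => k _.
  rewrite /dcol mxE big1 ?scale0r // => a _.
  by rewrite [X in _ * X]mxE ec dt0l mulr0.
by move=> /(subZ sA (delta v J l (l1, l2))^-1); rewrite scalerA mulVf // scale1r.
Qed.

(** Values of the generators at l in Cramer coordinates, so that relations among vectors of L become
    a matrix kernel. *)
Let values : 'M[K]_(n, r) := \matrix_(j, k) dcol v J l (v j) (l1, l2) k 0.

Lemma valuesE c : c *m values = \row_k dcol v J l (comb c) (l1, l2) k 0.
Proof.
apply/rowP => k; rewrite [RHS]mxE /comb (dcol_sum v J l (fun j => c 0 j) v bl) summxE mxE.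
by apply: eq_bigr => j _; rewrite [RHS]mxE [values j k]mxE.
Qed.

Lemma values0 c : c *m values = 0 <-> ev (comb c) (l1, l2) = 0.
Proof.
rewrite valuesE; split=> [h|ec]; last first.
  apply/rowP => k; rewrite !mxE big1 // => a _.
  by rewrite [X in _ * X]mxE ec dt0l mulr0.
have := cramer gv J l rmax (M_comb c) bl; rewrite big1 => [/eqP|k _].
  by rewrite scaler_eq0 (negPf delta_n0) => /eqP.
by move/rowP/(_ k): h; rewrite !mxE => ->; rewrite scale0r.
Qed.

(** The rows indexed by J form the scalar matrix delta(l). *)
Lemma rank_values : \rank values = r.
Proof.
apply/eqP; rewrite eqn_leq rank_leq_col /=.
have rJ : \rank (rowsub J values) = r.
  suff -> : rowsub J values = (delta v J l (l1, l2))%:M by rewrite -scalemx1 mxrank_scale_nz ?mxrank1.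
  by apply/matrixP => a b; rewrite [LHS]mxE [values _ _]mxE dcol_v [RHS]mxE eq_sym.
by rewrite -[leqLHS]rJ; apply: mxrankS; apply: rowsub_sub.
Qed.

Lemma transport0 : transport 0 0.
Proof.
split; [exact: sub0 (lsub_cycles X 0 0)| |exact: sub0 sM|].
  have A10 : adjZ 0 = 0 by have := adjZZ 0 (0 : H); rewrite !scale0r.
  have A20 : adjW 0 = 0 by have := adjWZ 0 (0 : H); rewrite !scale0r.
  by rewrite /normal_pair /= A10 A20.
have z0 : zl 0 = 0.
  by have := zs_lin l1 (-1) (sub0 sM) (sub0 sM); rewrite scaler0 addr0 scaleN1r addNr.
have w0 : wl 0 = 0.
  by have := ws_lin l2 (-1) (sub0 sM) (sub0 sM); rewrite scaler0 addr0 scaleN1r addNr.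
have g0 : gram v l1 l2 0 = 0.
  have := gram_lin l1 l2 (-1) (sub0 sM) (sub0 sM).
  by rewrite scaler0 addr0 scaleN1r addNr.
by rewrite /= z0 w0 g0 !addr0.
Qed.

Lemma transport_sum (T : finType) (c : T -> K) (p : T -> (H * H)%type) (y : T -> H) :
  (forall t, transport (p t) (y t)) -> transport (\sum_t c t *: p t) (\sum_t c t *: y t).
Proof.
move=> h; elim/big_rec2: _ => [|t q z _ hq]; first exact: transport0.
exact: transport_lin.
Qed.

Lemma coefs_sum (T : finType) (c : T -> K) (y : T -> H) :
  coefs (\sum_t c t *: y t) = \sum_t c t *: coefs (y t).
Proof.
elim/big_rec2: _ => [|t q z _ <-]; last exact: coefs_lin.
by apply/rowP => j; rewrite !mxE dt0l.
Qed.

Lemma boundaries_cycles q : boundaries 0 0 q -> cycles 0 0 q.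
Proof.
move=> [h Mh <-]; split; [exact/(subN sM)/M_ws|exact: M_zs|].
rewrite /bnd /= -zs_ws // !zs0 !ws0.
have -> : Z (- W h) = - Z (W h).
  by rewrite -scaleN1r (ZZ sM (@linZ _ X)) ?scaleN1r //; apply: fs_W.
by rewrite addNr.
Qed.

Lemma transport_unique0 y : transport 0 y -> y = 0.
Proof.
move=> [_ _ My]; have [_ _ _] := transport0.
have g0 : gram v l1 l2 0 = 0.
  have := gram_lin l1 l2 (-1) (sub0 sM) (sub0 sM).
  by rewrite scaler0 addr0 scaleN1r addNr.
rewrite g0 addr0 => ->; rewrite add0r => gy.
have := (gram_c0 small_c0).1 y My; rewrite gy nm0 pmulr_rle0 // => hy.
by apply: (nm_eq0 (d := d)); apply/eqP; rewrite eq_le hy nm_ge0.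
Qed.

Lemma koszul_h1_at : (r <= n)%N /\ has_qdim (cycles (X := X) 0 0) (boundaries 0 0) (n - r).
Proof.
split; first by rewrite -rank_values rank_leq_row.
have <- : \rank (kermx values) = (n - r)%N by rewrite mxrank_ker rank_values.
set U := row_base (kermx values).
have hU (c : 'rV[K]_n) : (c <= U)%MS = (c <= kermx values)%MS by apply: eqmxMr0 || rewrite /U !eq_row_base.
have hU0 t : row t U *m values = 0.
  by apply/sub_kermxP; rewrite -hU row_sub.
have ex t : exists py : (H * H) * H, transport py.1 py.2 /\ coefs py.2 = row t U.
  have [f [g [Mf Mg e]]] := ev_comb0_image ((values0 _).1 (hU0 t)).
  have h : zl (- f) + wl (- g) + comb (row t U) = 0.
    have zN : zl (- f) = - zl f.
      have := zs_lin l1 (-1) Mf (sub0 sM); rewrite scaleN1r !addr0 => ->.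
      have z0 : zl 0 = 0 by have := zs_lin l1 (-1) (sub0 sM) (sub0 sM); rewrite scaler0 addr0 scaleN1r addNr.
      by rewrite z0 addr0 scaleN1r.
    have wN : wl (- g) = - wl g.
      have := ws_lin l2 (-1) Mg (sub0 sM); rewrite scaleN1r !addr0 => ->.
      have z0 : wl 0 = 0 by have := ws_lin l2 (-1) (sub0 sM) (sub0 sM); rewrite scaler0 addr0 scaleN1r addNr.
      by rewrite z0 addr0 scaleN1r.
    by rewrite zN wN -opprD e addNr.
  have [p [y hy]] := transport_surj (subN sM Mf) (subN sM Mg) h.
  by exists (p, y).
have [py hpy] := choice ex.
pose p t := (py t).1; pose y t := (py t).2.
have tpy t : transport (p t) (y t) by case: (hpy t).
have cy (c : 'rV[K]_(\rank (kermx values))) : coefs (\sum_t c 0 t *: y t) = c *m U.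
  rewrite coefs_sum mulmx_sum_row; apply: eq_bigr => t _.
  by case: (hpy t) => _ ->.
have sB := lsub_boundaries X 0 0.
have cp t : cycles 0 0 (p t) by case: (tpy t).
apply: (has_qdim_intro sB (v := p)); split=> //.
  move=> x cx; have [M1 M2 _] := cx.
  (* Each class has a normal representative; its coefficients lie in the kernel of [values], and by
     [transport_inj] they determine it. *)
  have z12 : normc (0 : K) + normc (0 : K) <= 2^-1 by rewrite normc0 addr0 invr_ge0.
  have [h Mh nh] := normal_solve z12 M1 M2.
  have ch : cycles 0 0 (x - bnd 0 0 h).
    by apply: (subB (lsub_cycles X 0 0)) => //; apply: boundaries_cycles; exists h.
  have [z tz] := transport_ex ch nh.
  have /submxP[D eD] : (coefs z <= U)%MS.
    by rewrite hU; apply/sub_kermxP/values0; apply: transport_ev tz.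
  exists (D 0).
  have e : x - bnd 0 0 h = \sum_t D 0 t *: p t.
    apply/eqP; rewrite -subr_eq0; apply/eqP.
    have := transport_lin (-1) (transport_sum (D 0) tpy) tz.
    rewrite scaleN1r addrC => /transport_inj; apply.
    by rewrite coefs_lin cy eD scaleN1r addNr.
  by exists h => //; rewrite -e subKr.
move=> c hc; have tc := transport_sum c tpy.
(* This combination is normal and a boundary at the origin, hence orthogonal to itself. *)
have c00 : \sum_t c t *: p t = 0.
  have [_ nc _ _] := tc; case: hc => h Mh eh.
  by apply: (sqn_eq0 (d := d2)); rewrite /sqn /rd -{2}eh normal_dot.
rewrite c00 in tc; have y0 := transport_unique0 tc.
have h0 : (\row_t c t) *m U = 0.
  rewrite -cy; under eq_bigr do rewrite mxE.
  by rewrite y0; apply/rowP => j; rewrite !mxE dt0l.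
have /row_free_inj : row_free U by rewrite /U row_base_free.
move=> inj t; have := inj _ (\row_t c t) 0; rewrite h0 mul0mx => /(_ erefl)/rowP/(_ t).
by rewrite !mxE.
Qed.

End HomologyDimension.

(** By the identity theorem delta does not vanish identically near the origin, so l can be taken
    within all the bounds required above. *)
Lemma koszul_h1 (R : realType) (X : fock_submodule R) n (v : 'I_n -> fsH X)
    r (J : 'I_r -> 'I_n) (l : 'I_r -> fsL X) : generators v ->
  (forall (J' : 'I_(r + 1) -> 'I_n) (l' : 'I_(r + 1) -> fsL X) x,
    ball2 x -> \det (vmat v J' l' x) = 0) ->
  (exists2 x, ball2 x & delta v J l x != 0) ->
  (r <= n)%N /\ has_qdim (cycles (X := X) 0 0) (boundaries 0 0) (n - r).
Proof.
move=> gv rmax [x0 bx0 dx0]; have [c c0 hc] := gram_solve gv.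
pose e := Num.min 8^-1 (c / 2).
have e0 : 0 < e by rewrite lt_min invr_gt0 ltr0n divr_gt0.
have [x [h1 h2 dx]] : exists x : C2 R, [/\ normc x.1 < e, normc x.2 < e & delta v J l x != 0].
  apply: contrapT => h; case/eqP: dx0; apply: (inP_local (inP_delta gv J l) e0 _ bx0).
  move=> x h1 h2; apply/eqP; apply: contrapT => h3; apply: h; exists x; split=> //.
  exact/negP.
case: x h1 h2 dx => l1 l2 /=; rewrite !lt_min => /andP[a1 b1] /andP[a2 b2] dx.
apply: (koszul_h1_at gv rmax (ltW a1) (ltW a2) _ c0 hc dx).
by have := ltrD b1 b2; rewrite -splitr => /ltW.
Qed.

(** * Assembly *)

Section IdealPowers.
Variable K : fieldType.
Implicit Types (p q : {poly {poly K}}).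

Lemma finite_sums1 (V : nmodType) (S : set V) x : S x -> finite_sums S x.
Proof. by move=> Sx; exists 1%N, (fun=> x); rewrite big_ord1. Qed.

Lemma coef2M p q i j : (p * q)`_j`_i =
  \sum_(j' < j.+1) \sum_(i' < i.+1) p`_j'`_i' * q`_(j - j')`_(i - i').
Proof. by rewrite coefM coef_sum; apply: eq_bigr => j' _; rewrite coefM. Qed.

Lemma coef2_sum n (s : 'I_n -> {poly {poly K}}) i j :
  (\sum_k s k)`_j`_i = \sum_k (s k)`_j`_i.
Proof. by rewrite !coef_sum. Qed.

Lemma maxideal0_coef p : @maxideal0 K p -> p`_0`_0 = 0.
Proof.
move=> [n [s [hs ->]]]; rewrite coef2_sum big1 // => k _.
have [a _ [q hq <-]] := hs k; rewrite coef2M !big_ord1 !subn0.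
by case: hq => ->; rewrite /polyz /polyw ?coefC ?coefX /= ?coefX ?coef0 mulr0.
Qed.

(** Together with [monomial_ideal_exp] this identifies the k-th power of (z, w) with the span of the
    monomials of degree at least k. *)
Lemma ideal_exp_coef k p i j : ideal_exp (@maxideal0 K) k p -> (i + j < k)%N -> p`_j`_i = 0.
Proof.
elim: k p i j => // k IHk p i j [n [s [hs ->]]] ijk.
rewrite coef2_sum big1 // => m _; have [a ha [b hb <-]] := hs m.
rewrite coef2M big1 // => j' _; rewrite big1 // => i' _.
have j'j := ltn_ord j'; have i'i := ltn_ord i'.
have [/eqP|] := posnP (i' + j')%N.
  rewrite addn_eq0 => /andP[/eqP -> /eqP ->].
  by rewrite maxideal0_coef // mul0r.
by move=> ij'; rewrite (IHk b) ?mulr0 //; lia.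
Qed.

Lemma maxideal0_gens : @maxideal0 K (@polyz K) /\ @maxideal0 K (@polyw K).
Proof.
by split; apply: finite_sums1; [exists 1 => //; exists (@polyz K); rewrite ?mul1r //; left
  |exists 1 => //; exists (@polyw K); rewrite ?mul1r //; right].
Qed.

Lemma monomial_ideal_exp k i j : (k <= i + j)%N ->
  ideal_exp (@maxideal0 K) k (@polyz K ^+ i * @polyw K ^+ j).
Proof.
elim: k i j => // k IHk i j; have [hz hw] := maxideal0_gens.
case: i => [|i] kij; last first.
  apply: finite_sums1; exists (@polyz K) => //; exists (@polyz K ^+ i * @polyw K ^+ j).
    by apply: IHk.
  by rewrite exprS mulrA.
case: j kij => // j kij; apply: finite_sums1; exists (@polyw K) => //.
exists (@polyz K ^+ 0 * @polyw K ^+ j); first exact: IHk.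
by rewrite !expr0 !mul1r exprS.
Qed.

Lemma poly2_act_monomial (V : lmodType K) (T1 T2 : V -> V) i j v :
  poly2_act T1 T2 (@polyz K ^+ i * @polyw K ^+ j) v = iter i T1 (iter j T2 v).
Proof.
have e : @polyz K ^+ i * @polyw K ^+ j = ('X^i)%:P * 'X^j by rewrite /polyz polyC_exp.
have ce m : (@polyz K ^+ i * @polyw K ^+ j)`_m = 'X^i *+ (m == j).
  by rewrite e coefCM coefXn mulr_natr.
have -> : poly2_act T1 T2 (@polyz K ^+ i * @polyw K ^+ j) v =
   \sum_(j' < j.+1) \sum_(i' < size (('X^i : {poly K}) *+ (j' == j :> nat)))
     (('X^i : {poly K}) *+ (j' == j :> nat))`_i' *: iter i' T1 (iter j' T2 v).
  rewrite /poly2_act; have -> : size (@polyz K ^+ i * @polyw K ^+ j) = j.+1.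
    by rewrite e size_Cmul ?size_polyXn // monic_neq0 // monicXn.
  by apply: eq_bigr => j' _; rewrite ce.
rewrite big_ord_recr /= eqxx mulr1n big1 ?add0r => [|j' _]; last first.
  by rewrite ltn_eqF //= mulr0n size_poly0 big_ord0.
rewrite size_polyXn big_ord_recr /= big1 ?add0r => [|i' _].
  by rewrite coefXn eqxx scale1r.
by rewrite coefXn ltn_eqF // scale0r.
Qed.

End IdealPowers.

Section Images.
Variables (R : realType) (X : fock_submodule R).
Local Notation K := R[i].
Local Notation H := (fsH X).
Local Notation M := (@fsM R X).
Local Notation Z := (@fsZ R X).
Local Notation W := (@fsW R X).
Local Notation sM := (fs_sub X).
Local Notation monX := (@mon R X).
Implicit Types (f g : H).

Lemma power_image_box k : monomial_image (X := X) (box k) (power_image M Z W k).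
Proof.
split=> [|_ [f Mf [g Mg <-]]|i j f|P sP hP _ [f Mf [g Mg <-]]].
- split=> [|c _ _ [f Mf [g Mg <-]] [f' Mf' [g' Mg' <-]]].
    exists 0; first exact: sub0 sM; exists 0; first exact: sub0 sM.
    by have := mon0 X k 0; have := mon0 X 0 k; rewrite /mon /= => -> ->; rewrite addr0.
  exists (c *: f + f'); first exact: sM.2; exists (c *: g + g'); first exact: sM.2.
  have := mon_lin k 0 c Mf Mf'; have := mon_lin 0 k c Mg Mg'.
  rewrite /mon /= => -> ->; by rewrite addrACA scalerDr.
- by apply: (subD sM); [apply: (M_mon k 0)|apply: (M_mon 0 k)].
- rewrite negb_and -!leqNgt => /orP[ki|kj] Mf.
    exists (monX (i - k) j f); first exact: M_mon.
    exists 0; first exact: sub0 sM.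
    rewrite -[iter k W 0]/(monX 0 k 0) mon0 addr0.
    by rewrite -[LHS]/(monX k 0 (monX (i - k) j f)) mon_mon // subnKC.
  exists 0; first exact: sub0 sM.
  exists (monX i (j - k) f); first exact: M_mon.
  rewrite -[iter k Z 0]/(monX k 0 0) mon0 add0r.
  by rewrite -[LHS]/(monX 0 k (monX i (j - k) f)) mon_mon // subnKC.
by apply: (subD sP); [apply: (hP k 0%N)|apply: (hP 0%N k)]; rewrite // /box ltnn ?andbF.
Qed.

Lemma poly2_actZ (p : {poly {poly K}}) c f : M f ->
  poly2_act Z W p (c *: f) = c *: poly2_act Z W p f.
Proof.
move=> Mf; rewrite scaler_sumr; apply: eq_bigr => j _; rewrite scaler_sumr.
by apply: eq_bigr => i _; rewrite -/(monX i j _) monZ // !scalerA mulrC.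
Qed.

Lemma lsub_finite_sums (S : set H) : (forall c f, S f -> S (c *: f)) -> lsub (finite_sums S).
Proof.
move=> SZ; split=> [|c _ _ [m [s [hs ->]]] [m' [s' [hs' ->]]]].
  by exists 0%N, (fun=> 0); split=> [[]|] //; rewrite big_ord0.
exists (m + m')%N, (fun k => match fintype.split k with inl a => c *: s a | inr b => s' b end).
split=> [k|]; first by case: (fintype.split k) => a //; apply: SZ.
rewrite big_split_ord /= scaler_sumr; congr (_ + _); apply: eq_bigr => k _.
  case: splitP => [a /= e|a /= e]; last by have := ltn_ord k; rewrite e; lia.
  by have -> : k = a by apply/val_inj.
case: splitP => [a /= e|a /= e]; first by have := ltn_ord a; lia.
by congr s'; apply/val_inj => /=; lia.
Qed.

Lemma ideal_image_triangle k :
  monomial_image (X := X) (triangle k) (ideal_smul Z W (ideal_exp (@maxideal0 K) k) M).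
Proof.
split=> [|_ [m [s [hs ->]]]|i j f|P sP hP _ [m [s [hs ->]]]].
- apply: lsub_finite_sums => c _ [p Ip [f Mf <-]].
  by exists p => //; exists (c *: f); [apply: (subZ sM)|apply: poly2_actZ].
- apply: (sub_sum sM) => t _; have [p _ [f Mf <-]] := hs t.
  apply: (sub_sum sM) => j _; apply: (sub_sum sM) => i _; apply: (subZ sM).
  exact: M_mon.
- rewrite /triangle -leqNgt => kij Mf; apply: finite_sums1.
  exists (@polyz K ^+ i * @polyw K ^+ j); first exact: monomial_ideal_exp.
  by exists f => //; rewrite poly2_act_monomial.
apply: (sub_sum sP) => t _; have [p Ip [f Mf <-]] := hs t.
apply: (sub_sum sP) => j _; apply: (sub_sum sP) => i _.
have [ijk|kij] := ltnP (i + j)%N k.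
  by rewrite (ideal_exp_coef Ip) // scale0r; apply: sub0 sP.
by apply/(subZ sP)/hP; rewrite // /triangle -leqNgt.
Qed.

Lemma koszul_cycles1E : koszul_cycles1 M Z W = cycles (X := X) 0 0.
Proof.
apply/seteqP; split=> p /=.
  by case=> -[M1 M2] h; split; rewrite // zs0 ws0.
by case=> M1 M2; rewrite zs0 ws0.
Qed.

Lemma koszul_boundaries1E : koszul_boundaries1 M Z W = boundaries (X := X) 0 0.
Proof.
by apply/seteqP; split=> _ [h Mh <-]; exists h => //; rewrite /bnd zs0 ws0.
Qed.

Lemma koszul_boundaries0E : koszul_boundaries0 M Z W = power_image M Z W 1.
Proof.
apply/seteqP; split=> [_ [[f g] [Mf Mg] <-]|_ [f Mf [g Mg <-]]].
  by exists f => //; exists g.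
by exists (f, g).
Qed.

Lemma koszul_cycles2_eq0 f : koszul_cycles2 M Z W f -> f = 0.
Proof.
move=> [Mf [/eqP hW hZ]]; apply: (sqn_eq0 (d := fs_d X)); apply/eqP.
rewrite eq_le sqn_ge0 andbT.
have := fs_col Mf; rewrite hZ; move: hW; rewrite oppr_eq0 => /eqP ->.
by rewrite sqn0 addr0.
Qed.

Lemma koszul_h2 : has_qdim (koszul_cycles2 M Z W) [set 0] 0.
Proof.
have s0 : lsub [set 0 : H] by split=> [//|c f g -> ->]; rewrite /= scaler0 addr0.
apply: (has_qdim_intro s0 (v := fun=> 0)); split; try by case.
  by move=> f /koszul_cycles2_eq0 ->; exists (fun=> 0); rewrite big_ord0 subr0.
by move=> c _ [].
Qed.

(** The defect operator changes each vector by an element of zM + wM, so a basis modulo that space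
    remains one and becomes a family of multipliers. *)
Lemma generators_ex n : has_qdim M (power_image M Z W 1) n ->
  exists v : 'I_n -> H, generators v.
Proof.
set I := power_image M Z W 1 => hn.
have sI : lsub I := sJ (power_image_box 1).
have [u [[Mu su] [_ fu]]] := has_qdim_elim sM sI hn.
pose v j := defect sM (@fs_complete _ X) (@linZ _ X) (@linW _ X) (@fs_row _ X) (u j).
have Iuv j : I (u j - v j).
  exists (@adjZ R X (u j)); first exact: M_adjZ.
  exists (@adjW R X (u j)); first exact: M_adjW.
  by rewrite /v /defect /adjZ /adjW -addrA -opprD subKr.
have Isum (c : 'I_n -> K) : I (\sum_j c j *: u j - \sum_j c j *: v j).
  rewrite -sumrB; apply: (sub_sum sI) => j _; rewrite -scalerBr; exact: (subZ sI).
exists v; split=> [j|f Mf|f1 f2 c M1 M2 h].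
- exists (dfq sM (@fs_complete _ X) (@linZ _ X) (@linW _ X) (@fs_row _ X) (u j)).
  by apply: defect_is_mult => //; [exact: fs_Z|exact: fs_W].
- have [c hc] := su f Mf.
  have [f1 M1 [f2 M2 e]] : I (f - \sum_j c j *: v j).
    by rewrite -(subrKA (\sum_j c j *: u j)); apply: (subD sI).
  by exists f1, f2, c; split=> //; rewrite -[Z f1 + W f2]/(iter 1 Z f1 + iter 1 W f2) e subrK.
apply: fu; rewrite -(subrK (\sum_j c j *: v j) (\sum_j c j *: u j)); apply: (subD sI) => //.
have -> : \sum_j c j *: v j = - (Z f1 + W f2) by apply/eqP; rewrite -addr_eq0 addrC h.
by apply: (subN sI); exists f1 => //; exists f2.
Qed.

Theorem fredholm_index_limits :
  (fredholm M Z W <-> qfindim M (power_image M Z W 1)) /\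
  (fredholm M Z W ->
   (forall k : nat, qfindim M (power_image M Z W k) /\
                    qfindim M (ideal_smul Z W (ideal_exp (@maxideal0 K) k) M)) /\
   exists e0 : R,
     [/\ (fredholm_index M Z W)%:~R = e0,
         (fun k : nat => (qdim M (power_image M Z W k))%:R / k%:R ^+ 2 : R) @ \oo --> e0
       & (fun k : nat => (2`!)%:R *
            ((qdim M (ideal_smul Z W (ideal_exp (@maxideal0 K) k) M))%:R / k%:R ^+ 2) : R)
           @ \oo --> e0]).
Proof.
have key n : has_qdim M (power_image M Z W 1) n -> exists (v : 'I_n -> H) r J l,
  [/\ generators v, forall (J' : 'I_(r + 1) -> 'I_n) l' x, ball2 x -> \det (vmat v J' l' x) = 0,
    (exists2 x, ball2 x & @delta _ X _ v r J l x != 0), (r <= n)%N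
   & has_qdim (koszul_cycles1 M Z W) (koszul_boundaries1 M Z W) (n - r)].
  move=> /generators_ex[v gv]; have [r [J [l [dl rmax]]]] := rank_ex v.
  have [rn h1] := koszul_h1 gv rmax dl.
  by exists v, r, J, l; split=> //; rewrite koszul_cycles1E koszul_boundaries1E.
split.
  split=> [[_ _]|[n hn]]; first by rewrite koszul_boundaries0E.
  have [v [r [J [l [_ _ _ _ h1]]]]] := key n hn.
  by split; [exists 0%N; exact: koszul_h2|exists (n - r)%N|rewrite koszul_boundaries0E; exists n].
move=> [_ _]; rewrite koszul_boundaries0E => -[n hn].
have [v [r [J [l [gv rmax dl rn h1]]]]] := key n hn.
have [fb lb] := box_limit gv rmax dl (fun k => power_image_box k).
have [ft lt] := triangle_limit gv rmax dl (fun k => ideal_image_triangle k).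
split=> [k|]; first by split; [apply: fb|apply: ft].
exists (r%:R); split=> //.
have s0 : lsub [set 0 : H] by split=> [//|c f g -> ->]; rewrite /= scaler0 addr0.
have hC2 : koszul_cycles2 M Z W = [set 0].
  apply/seteqP; split=> f; last first.
    move=> ->; split; first exact: sub0 sM.
    by rewrite /koszul_d2 (Z0 sM (@linZ _ X)) (W0 sM (@linW _ X)) oppr0.
  by move=> /koszul_cycles2_eq0.
have h2 := koszul_h2; rewrite /fredholm_index hC2 in h2 *; rewrite (qdimE s0 s0 h2).
have sc1 := lsub_cycles X 0 0; have sb1 := lsub_boundaries X 0 0.
rewrite -koszul_cycles1E in sc1; rewrite -koszul_boundaries1E in sb1.
rewrite (qdimE sc1 sb1 h1) koszul_boundaries0E (qdimE sM (sJ (power_image_box 1)) hn).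
(* The natural subtraction is exact because r <= n ([rn]). *)
have -> : 0%:Z - (n - r)%N%:Z + n%:Z = r%:Z by lia.
by [].
Qed.

End Images.

(** * The given invariant subspace as an instance of the abstract structure *)

Section Instance.
Variables (R : realType) (L H : completeNormedModType R[i]).
Variables (dotL : {dot L for @Num.conj R[i]}) (dotH : {dot H for @Num.conj R[i]}).
Variables (ev : H -> C2 R -> L) (M : set H).
Hypotheses (hH : hilbert_dot dotH) (fockH : is_fock_space dotL dotH ev).
Hypothesis hM : mult_invariant_subspace ev M.

(** [mulop] picks some product; injectivity of evaluation makes it the one that invariance places in
    M, so the default value 0 never occurs on M. *)
Lemma mulopP phi f : mul_invariant ev phi M -> M f ->
  M (mulop ev phi f) /\ is_product ev phi f (mulop ev phi f).
Proof.
move=> inv Mf; have [g Mg hg] := inv f Mf; rewrite /mulop.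
case: xgetP => [h _ hh|/(_ g)//]; split=> //.
suff -> : h = g by [].
by apply: (ev_inj fockH) => x bx; rewrite hh // hg.
Qed.

Lemma lsub_M : lsub M.
Proof.
case: hM => -[h0 h1] _ _ _; split=> [|a x y Mx My]; first exact: set_mem h0.
by apply: set_mem; apply: h1; apply: mem_set.
Qed.

Let M_mulz f : M f -> M (mulz ev f) /\ is_product ev (fun x => x.1) f (mulz ev f).
Proof. by case: hM => _ _ inv _; apply: mulopP. Qed.

Let M_mulw f : M f -> M (mulw ev f) /\ is_product ev (fun x => x.2) f (mulw ev f).
Proof. by case: hM => _ _ _ inv; apply: mulopP. Qed.

Lemma mul_row f g : M f -> M g -> sqn (ip_of_dot dotH) (mulz ev f + mulw ev g) <=
  sqn (ip_of_dot dotH) f + sqn (ip_of_dot dotH) g.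
Proof.
move=> Mf Mg; apply: (mul_row_bound hH fockH) => x bx.
by rewrite (evD fockH) // (M_mulz Mf).2 // (M_mulw Mg).2.
Qed.

Lemma mul_col f : M f -> sqn (ip_of_dot dotH) f <=
  sqn (ip_of_dot dotH) (mulz ev f) + sqn (ip_of_dot dotH) (mulw ev f).
Proof.
by move=> Mf; apply: (mul_col_bound hH fockH); [exact: (M_mulz Mf).2|exact: (M_mulw Mf).2].
Qed.

Let cM : complete_set (ip_of_dot dotH) M.
Proof. by case: hM => _ cM _ _; apply: (closed_complete hH). Qed.

Definition fock_submodule_of : fock_submodule R :=
  @FockSubmodule R L H (ip_of_dot dotL) (ip_of_dot dotH) ev M (mulz ev) (mulw ev)
    (fun a f g x bx => ev_lin fockH a f g bx) (fun f g h => ev_inj fockH h)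
    (fun x bx => nm_ev fockH bx) (ev_inP hH fockH) lsub_M cM
    (fun f Mf => (M_mulz Mf).1) (fun f Mf => (M_mulw Mf).1)
    (fun f x Mf bx => (M_mulz Mf).2 x bx) (fun f x Mf bx => (M_mulw Mf).2 x bx)
    mul_row mul_col.

End Instance.

Theorem theorem11 (R : realType) (L H : completeNormedModType (complex R))
    (dotL : {dot L for @Num.conj (complex R)})
    (dotH : {dot H for @Num.conj (complex R)})
    (ev : H -> C2 R -> L) (M : set H)
    (hL : hilbert_dot dotL) (sepL : separable_space L)
    (hH : hilbert_dot dotH) (fockH : is_fock_space dotL dotH ev)
    (hM : mult_invariant_subspace ev M) :
  let Mz := mulz ev in
  let Mw := mulw ev in
  let I := @maxideal0 (complex R) in
  (fredholm M Mz Mw <-> qfindim M (power_image M Mz Mw 1))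
  /\
  (fredholm M Mz Mw ->
   (forall k : nat, qfindim M (power_image M Mz Mw k) /\
                    qfindim M (ideal_smul Mz Mw (ideal_exp I k) M)) /\
   exists e0 : R,
     [/\ (fredholm_index M Mz Mw)%:~R = e0,
         (fun k : nat => (qdim M (power_image M Mz Mw k))%:R / k%:R ^+ 2 : R)
           @ \oo --> e0
       & (fun k : nat => (2`!)%:R *
            ((qdim M (ideal_smul Mz Mw (ideal_exp I k) M))%:R / k%:R ^+ 2) : R)
           @ \oo --> e0]).
Proof. exact: (fredholm_index_limits (fock_submodule_of hH fockH hM)). Qed.
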